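(* Let $g\in\mathcal{H}(\mathbb{D})$ be such that $T_g:H^\infty\to H^\infty$ is bounded. Then the following statements are equivalent: (a) $T_g:H^\infty\to H^\infty$ is weakly compact; (b) $T_g:H^\infty\to A$ is bounded; (c) $T_g:A\to A$ is weakly compact.
   Context: $\mathbb{D}$ is the open unit disc, $\mathcal{H}(\mathbb{D})$ the space of analytic functions in $\mathbb{D}$, $H^\infty$ the bounded analytic functions in $\mathbb{D}$ with the sup norm, $A$ the disc algebra (functions analytic in $\mathbb{D}$ and continuous on $\overline{\mathbb{D}}$, sup norm). $T_g(f)(z)=\int_0^z f(\zeta)g'(\zeta)\,d\zeta$. *)

(* Defs.v *)
From HB Require Import structures.
From mathcomp Require Import all_boot all_order all_algebra complex.
From mathcomp Require Import all_classical all_reals all_analysis.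
From mathcomp Require Import lra.

Set Implicit Arguments.
Unset Strict Implicit.
Unset Printing Implicit Defensive.

Import Order.TTheory GRing.Theory Num.Theory.
Import numFieldNormedType.Exports.

Local Open Scope classical_set_scope.
Local Open Scope complex_scope.
Local Open Scope ring_scope.

(* [R[i]] carries its normed topology only as a [numFieldType] (with itself as
   the field of scalars, so that [derivable] is complex differentiability);
   norms of complex normed spaces are nonnegative reals seen in [R[i]]. *)
Notation Cplx R := (R[i] : numFieldType).

Section weak_compactness.
Variables (K : numFieldType) (E F : normedModType K).

Definition bounded_op (T : E -> F) : Prop :=
  exists M : K, forall x, `|T x| <= M * `|x|.

Definition dual : Type := {phi : {linear E -> K^o} | continuous phi}.

HB.instance Definition _ := gen_eqMixin dual.
HB.instance Definition _ := gen_choiceMixin dual.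

(* sigma(E, E'): the coarsest topology making every phi in E' continuous *)
Definition weak : Type :=
  initial_topology
    (fun x : E => (fun phi => sval phi x) : {ptws dual -> K^o}).

HB.instance Definition _ := Topological.on weak.

End weak_compactness.
Arguments weak {K} E.

Definition weakly_compact (K : numFieldType) (E F : normedModType K)
    (T : {linear E -> F}) : Prop :=
  bounded_op T /\ @precompact (weak F) (T @` [set x : E | `|x| <= 1]).

Section sup_norm.
Variable R : realType.
Local Notation C := (Cplx R).
Implicit Types (D : set C) (f g : C -> C) (c z : C).

Definition modulus z : R := complex.Re `|z|.

Lemma modulusE z : (modulus z)%:C = `|z|.
Proof. by apply: RRe_real; exact: normr_real. Qed.

Lemma modulus_ge0 z : 0 <= modulus z.
Proof. by rewrite -lecR modulusE normr_ge0. Qed.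

Lemma modulusD (z w : C) : modulus (z + w) <= modulus z + modulus w.
Proof. by rewrite -lecR rmorphD /= !modulusE ler_normD. Qed.

Lemma modulusM (z w : C) : modulus (z * w) = modulus z * modulus w.
Proof.
by apply: (@complexI R); rewrite rmorphM /= !modulusE normrM.
Qed.

Lemma modulus_sqr (a b : R) : modulus (a +i* b) ^+ 2 = a ^+ 2 + b ^+ 2.
Proof. by rewrite /modulus normc_def /= sqr_sqrtr// addr_ge0// sqr_ge0. Qed.

Lemma modulus_continuous : continuous (modulus : C -> R).
Proof.
move=> z; apply/(@cvgrPdist_le _ _ _ (nbhs (z : C)) (nbhs_filter (z : C))) => e e0.
have e0C : 0 < e%:C :> C by rewrite ltcR.
apply: filterS (nbhsx_ballx (z : C) _ e0C) => w.
rewrite -ball_normE /= -modulusE ltcR => /ltW; apply: le_trans.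
have := modulusD w (z - w); have := modulusD z (w - z).
rewrite !subrKC; have -> : modulus (w - z) = modulus (z - w).
  by rewrite /modulus distrC.
by rewrite ler_norml; lra.
Qed.

Definition bounded_on D f : Prop :=
  exists M : R, forall z, D z -> modulus (f z) <= M.

Definition sup_norm D f : R := sup [set modulus (f z) | z in D].

Lemma sup_norm_ub D f z : bounded_on D f -> D z ->
  modulus (f z) <= sup_norm D f.
Proof.
move=> [M fM] Dz; apply: sup_upper_bound; last by exists z.
by split; [exists (modulus (f z)), z|exists M => _ [w Dw <-]; exact: fM].
Qed.

Lemma sup_norm_le D f (M : R) : 0 <= M ->
  (forall z, D z -> modulus (f z) <= M) -> sup_norm D f <= M.
Proof.
move=> M0 fM; rewrite /sup_norm.
have [->|/set0P[x Ax]] := eqVneq [set modulus (f z) | z in D] set0.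
  by rewrite sup0.
by apply: ge_sup; [exists x|move=> _ [z Dz <-]; exact: fM].
Qed.

Lemma sup_norm_ge0 D f : 0 <= sup_norm D f.
Proof.
rewrite /sup_norm; have [[[x [z Dz _]] [M ubM]]|nsup] :=
  pselect (has_sup [set modulus (f z) | z in D]); last by rewrite sup_out.
apply: le_trans (modulus_ge0 (f z)) _; apply: sup_upper_bound; last by exists z.
by split; [exists (modulus (f z)), z|exists M].
Qed.

Lemma sup_normD D f g : bounded_on D f -> bounded_on D g ->
  sup_norm D (f + g) <= sup_norm D f + sup_norm D g.
Proof.
move=> bf bg; apply: sup_norm_le; first by rewrite addr_ge0 ?sup_norm_ge0.
move=> z Dz; apply: le_trans (modulusD _ _) _.
by apply: lerD; exact: sup_norm_ub.
Qed.

Lemma sup_normZ_le D f c : bounded_on D f ->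
  sup_norm D (c *: f) <= modulus c * sup_norm D f.
Proof.
move=> bf; apply: sup_norm_le; first by rewrite mulr_ge0 ?modulus_ge0 ?sup_norm_ge0.
move=> z Dz; rewrite [(c *: f) z]/(c * f z) modulusM.
by apply: ler_wpM2l; [exact: modulus_ge0|exact: sup_norm_ub].
Qed.

Lemma bounded_onZ D f c : bounded_on D f -> bounded_on D (c *: f).
Proof.
move=> [M fM]; exists (modulus c * M) => z Dz.
rewrite [(c *: f) z]/(c * f z) modulusM.
by apply: ler_wpM2l; [exact: modulus_ge0|exact: fM].
Qed.

Lemma bounded_onD D f g : bounded_on D f -> bounded_on D g ->
  bounded_on D (f + g).
Proof.
move=> [M fM] [N gN]; exists (M + N) => z Dz.
by apply: le_trans (modulusD _ _) _; apply: lerD; [exact: fM|exact: gN].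
Qed.

Lemma sup_normZ D f c : bounded_on D f ->
  sup_norm D (c *: f) = modulus c * sup_norm D f.
Proof.
move=> bf; apply/eqP; rewrite eq_le sup_normZ_le//=.
have [->|c0] := eqVneq c 0.
  by rewrite /modulus normr0 mul0r sup_norm_ge0.
have mc : modulus c * modulus c^-1 = 1.
  by rewrite -modulusM divff// /modulus normr1.
have := sup_normZ_le c^-1 (bounded_onZ c bf).
rewrite scalerA mulVf// scale1r => le1.
by have := ler_wpM2l (modulus_ge0 c) le1; rewrite mulrA mc mul1r.
Qed.

Lemma sup_norm_eq0 D f : bounded_on D f -> sup_norm D f = 0 ->
  forall z, D z -> f z = 0.
Proof.
move=> bf f0 z Dz; apply/eqP; rewrite -normr_le0 -modulusE.
by rewrite -[leRHS]/(0%:C) lecR -f0; exact: sup_norm_ub.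
Qed.

(* A vector space of bounded functions on D.  Its elements are represented by
   total functions that vanish off D, so that functions agreeing on D are
   equal. *)
Record fun_space := FunSpace {
  fs_dom : set C ;
  fs_car : set (C -> C) ;
  fs_submod : submod_closed [pred f | `[< fs_car f >]] ;
  fs_bounded : forall f, fs_car f -> bounded_on fs_dom f ;
  fs_off : forall f, fs_car f -> forall z, ~ fs_dom z -> f z = 0 }.

Definition fs_pred (X : fun_space) : {pred C -> C} :=
  [pred f | `[< fs_car X f >]].

HB.instance Definition _ (X : fun_space) :=
  GRing.isSubmodClosed.Build C (C -> C) (fs_pred X) (fs_submod X).

Record fs_elt (X : fun_space) := FsElt {
  fs_fun :> C -> C ;
  fs_funP : fs_fun \in fs_pred X }.

HB.instance Definition _ (X : fun_space) := [isSub for @fs_fun X].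
HB.instance Definition _ (X : fun_space) := [Choice of fs_elt X by <:].
HB.instance Definition _ (X : fun_space) :=
  [SubChoice_isSubLmodule of fs_elt X by <:].

Section fs_norm.
Variable X : fun_space.

Lemma fs_carP (f : fs_elt X) : fs_car X f.
Proof. by have /asboolP := fs_funP f. Qed.

Definition fs_norm (f : fs_elt X) : C := (sup_norm (fs_dom X) f)%:C.

Lemma fs_normD (f g : fs_elt X) : fs_norm (f + g) <= fs_norm f + fs_norm g.
Proof.
rewrite /fs_norm -rmorphD /= lecR; apply: sup_normD.
- exact: fs_bounded (fs_carP f).
- exact: fs_bounded (fs_carP g).
Qed.

Lemma fs_normZ (c : C) (f : fs_elt X) : fs_norm (c *: f) = `|c| * fs_norm f.
Proof.
rewrite /fs_norm -modulusE -rmorphM /=; congr (_ %:C).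
exact: sup_normZ (fs_bounded (fs_carP f)).
Qed.

Lemma fs_norm_eq0 (f : fs_elt X) : fs_norm f = 0 -> f = 0.
Proof.
move=> /(@complexI R) f0; apply: val_inj; apply/funext => z /=.
have [Dz|Dz] := pselect (fs_dom X z).
  exact: sup_norm_eq0 (fs_bounded (fs_carP f)) f0 z Dz.
exact: fs_off (fs_carP f) z Dz.
Qed.

HB.instance Definition _ :=
  Lmodule_isNormed.Build C (fs_elt X) fs_normD fs_normZ fs_norm_eq0.

End fs_norm.
End sup_norm.

Section disc.
Variable R : realType.
Local Notation C := (Cplx R).
Implicit Types (f g : C -> C) (z : C).

Definition disc : set C := [set z | `|z| < 1].
Definition closed_disc : set C := [set z | `|z| <= 1].

(* complex differentiability at every point of A *)
Definition analytic (A : set C) f : Prop := forall z, A z -> derivable f z 1.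

Definition is_Hinf : set (C -> C) := [set f |
  [/\ analytic disc f, bounded_on disc f & forall z, ~ disc z -> f z = 0]].

Definition is_disc_algebra : set (C -> C) := [set f |
  [/\ analytic disc f, {within closed_disc, continuous f} &
      forall z, ~ closed_disc z -> f z = 0]].

Let lincomb0 (c a b : C) : a = 0 -> b = 0 -> c * a + b = 0.
Proof. by move=> -> ->; rewrite mulr0 addr0. Qed.

Lemma Hinf_submod : submod_closed [pred f | `[< is_Hinf f >]].
Proof.
split=> [|c f g].
  apply/asboolP; split=> [z _||//]; first exact: derivable_cst.
  by exists 0 => z _; rewrite /modulus normr0.
move=> /asboolP[af bf f0] /asboolP[ag bg g0]; apply/asboolP; split.
- move=> z Dz; apply: derivableD; last exact: ag.
  by apply: derivableZ; exact: af.
- by apply: bounded_onD => //; exact: bounded_onZ.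
- by move=> z Dz; exact: lincomb0 (f0 z Dz) (g0 z Dz).
Qed.

Lemma disc_algebra_submod : submod_closed [pred f | `[< is_disc_algebra f >]].
Proof.
split=> [|c f g].
  apply/asboolP; split=> [z _||//]; first exact: derivable_cst.
  by move=> z; exact: cvg_cst.
move=> /asboolP[af cf f0] /asboolP[ag cg g0]; apply/asboolP; split.
- move=> z Dz; apply: derivableD; last exact: ag.
  by apply: derivableZ; exact: af.
- by move=> z; apply: cvgD; [apply: cvgZl_tmp; exact: cf|exact: cg].
- by move=> z Dz; exact: lincomb0 (f0 z Dz) (g0 z Dz).
Qed.

Lemma mkC_continuous : continuous ((fun p => p.1 +i* p.2) : R * R -> C).
Proof.
move=> [x y]; apply/(@cvgrPdist_le _ C) => e e0.
have ee : e = (modulus e)%:C by rewrite modulusE gtr0_norm.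
have me0 : 0 < modulus e / 2 by rewrite divr_gt0// -ltcR -ee.
near=> p.
have -> : (x, y).1 +i* (x, y).2 - (p.1 +i* p.2) =
  (x - p.1) +i* (y - p.2) :> C by [].
rewrite -modulusE ee lecR.
rewrite -(ler_pXn2r (n := 2))// ?nnegrE ?modulus_ge0// modulus_sqr.
have hx : `|x - p.1| <= modulus e / 2.
  near: p; apply: (@cvgr_dist_le _ R _ (nbhs (x, y)) _ fst) => //; exact: cvg_fst.
have hy : `|y - p.2| <= modulus e / 2.
  near: p; apply: (@cvgr_dist_le _ R _ (nbhs (x, y)) _ snd) => //; exact: cvg_snd.
rewrite -(real_normK (num_real (x - p.1))) -(real_normK (num_real (y - p.2))).
have := normr_ge0 (x - p.1); have := normr_ge0 (y - p.2).
nra.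
Unshelve. all: by end_near. Qed.

Lemma closed_disc_compact : compact closed_disc.
Proof.
set h := (fun p => p.1 +i* p.2) : R * R -> C.
have -> : closed_disc = h @`
    (`[-1, 1] `*` `[-1, 1] `&` [set p | p.1 ^+ 2 + p.2 ^+ 2 <= 1]).
  have E (a b : R) : closed_disc (a +i* b) = (a ^+ 2 + b ^+ 2 <= 1) :> Prop.
    rewrite /closed_disc /= -modulusE -[X in _ <= X]/(1%:C) lecR.
    by rewrite -(ler_pXn2r (n := 2))// ?nnegrE ?modulus_ge0// modulus_sqr expr1n.
  apply/seteqP; split=> [[a b]|_ [[a b] [_ ab]] <-]; last by rewrite E.
  rewrite E => ab; exists (a, b) => //; split => //; split=> /=.
  - by rewrite in_itv/=; have := sqr_ge0 b; nra.
  - by rewrite in_itv/=; have := sqr_ge0 a; nra.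
apply: continuous_compact; first exact/continuous_subspaceT/mkC_continuous.
apply: compact_closedI.
  by apply: compact_setX; exact: segment_compact.
apply: (@preimage_closed _ _ (fun p : R * R => p.1 ^+ 2 + p.2 ^+ 2) [set x | x <= 1]).
  move=> p _; apply: cvgD; rewrite /=.
    by apply: (@continuous_comp _ _ _ fst (fun x : R => x ^+ 2));
      [exact: cvg_fst|exact: exprn_continuous].
  by apply: (@continuous_comp _ _ _ snd (fun x : R => x ^+ 2));
    [exact: cvg_snd|exact: exprn_continuous].
exact: closed_le.
Qed.

Lemma disc_algebra_bounded f : is_disc_algebra f -> bounded_on closed_disc f.
Proof.
move=> [_ cf _].
have := continuous_compact (continuous_subspaceT (@modulus_continuous R))
  (continuous_compact cf closed_disc_compact).
move=> /compact_bounded[M [_ bM]]; exists (M + 1) => z Dz.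
apply: le_trans (ler_norm _) _; apply: (bM (M + 1)); first by rewrite ltrDl.
by exists (f z) => //; exists z.
Qed.

Definition Hinf : fun_space R :=
  FunSpace Hinf_submod (fun f Hf => let: And3 _ bf _ := Hf in bf)
    (fun f Hf => let: And3 _ _ f0 := Hf in f0).

Definition disc_algebra : fun_space R :=
  FunSpace disc_algebra_submod disc_algebra_bounded
    (fun f Hf => let: And3 _ _ f0 := Hf in f0).

(* integral over [0, 1] of a complex-valued function *)
Definition cintegral01 (h : R -> C) : C :=
  (\int[lebesgue_measure]_(t in `[0%R, 1%R]) complex.Re (h t)) +i*
  (\int[lebesgue_measure]_(t in `[0%R, 1%R]) complex.Im (h t)).

(* the path integral from 0 to z, parametrised as zeta = t z, 0 <= t <= 1 *)
Definition Tg g f z : C :=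
  cintegral01 (fun t : R => f (t%:C * z) * derive1 g (t%:C * z) * z).

(* A linear map T : X -> Y is the operator T_g.  Equality is required on the
   open disc, where T_g f is defined; this determines T f, also for
   Y = disc_algebra by continuity. *)
Definition is_Tg g (X Y : fun_space R) (T : {linear fs_elt X -> fs_elt Y}) :=
  forall (f : fs_elt X) z, disc z -> T f z = Tg g f z.

Definition Tg_bounded g (X Y : fun_space R) : Prop :=
  exists T : {linear fs_elt X -> fs_elt Y}, is_Tg g T /\ bounded_op T.

Definition Tg_weakly_compact g (X Y : fun_space R) : Prop :=
  exists T : {linear fs_elt X -> fs_elt Y}, is_Tg g T /\ weakly_compact T.

End disc.
Arguments disc {R}.
Arguments Hinf {R}.
Arguments disc_algebra {R}.

(* Main.v *)
Require Import Defs.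
From HB Require Import structures.
From mathcomp Require Import all_boot all_order all_algebra complex.
From mathcomp Require Import all_classical all_reals all_analysis.
From mathcomp Require Import ring lra.

(* (a) => (b) and (c) => (b).  A weak cluster point of T_g applied to functions
   of the unit ball tending pointwise to f is T_g f.  For (c) use dilations of f.
   For (a) use f (1 - q) with q = y / (y + 1 - z / zeta), y -> 0: integration by
   parts shows that T_g (f (1 - q)) extends continuously to zeta, and the
   oscillation at zeta, taken along an ultrafilter, is a bounded functional,
   hence vanishes at T_g f as well.

   (b) => (a) and (c).  By Montel's theorem it suffices that phi (T_g f_n) -> 0
   for every functional phi when f_n is bounded and tends to 0 locally uniformly.
   First, T_g f_n (zeta) -> 0 for |zeta| = 1: otherwise differences of multipliers
   q cut out of the f_n sums bounded on the disc whose images at zeta are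
   unbounded.  Next, pointwise convergence on the closed disc is upgraded to weak
   convergence by Simons' argument: a suitable infinite convex combination of
   the f_n has an image attaining its norm at a point where T_g f_n does not tend
   to 0.  This replaces Bourgain's theorem that H^oo is a Grothendieck space.

   The complex analysis needed (Montel, continuity of g') follows from a
   quantitative form of differentiability, obtained from Goursat's lemma and
   Cauchy's formula on a square. *)

Set Implicit Arguments.
Unset Strict Implicit.
Unset Printing Implicit Defensive.

Import Order.TTheory GRing.Theory Num.Theory.
Import numFieldNormedType.Exports.

Local Open Scope classical_set_scope.
Local Open Scope complex_scope.
Local Open Scope ring_scope.

(** * The modulus and complex derivatives *)

(** The multiplier [q] has this form because [y + 1 - z / zeta] has real part at least [y] on the
    closed disc. Hence [q] and [1 - q] are bounded by 1; a difference of two multipliers is at most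
    twice the difference of the real functions [y / (y + x)] at [x = |1 - z / zeta|], so sums over
    consecutive parameters telescope; and on the radius to [zeta] the total variation of [q] is at
    most 1 for every [y]. Integrating by parts along that radius removes [g'] from the estimates.
    Two opposite limits drive the construction at [zeta]. For fixed [y], the image of [f_n (1 - q)]
    tends to 0 at [zeta] since [f_n] tends to 0 locally uniformly. For fixed [n], the image of
    [f_n q] tends to 0 at [zeta] as [y -> 0] since [T_g f_n] is continuous there: this is where the
    range in [A] enters. Simons' argument uses of [A] only that norms are attained, and of a
    functional only that it is dominated by the norm of [T_g f] in [A]. It therefore treats
    functionals on H^oo and on [A] alike, without representing them by measures. *)

Section modulus_theory.
Variable R : realType.
Local Notation C := (Cplx R).
Implicit Types (z w c : C) (x y : R).

Lemma modulus0 : modulus (0 : C) = 0.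
Proof. by rewrite /modulus normr0. Qed.

Lemma modulus1 : modulus (1 : C) = 1.
Proof. by rewrite /modulus normr1. Qed.

Lemma modulusN z : modulus (- z) = modulus z.
Proof. by rewrite /modulus normrN. Qed.

Lemma modulusBC z w : modulus (z - w) = modulus (w - z).
Proof. by rewrite /modulus distrC. Qed.

Lemma modulus_eq0 z : (modulus z == 0) = (z == 0).
Proof. by rewrite -(inj_eq (@complexI R)) modulusE normr_eq0. Qed.

Lemma modulus_gt0 z : (0 < modulus z) = (z != 0).
Proof. by rewrite lt_def modulus_ge0 andbT modulus_eq0. Qed.

Lemma modulusV z : modulus z^-1 = (modulus z)^-1.
Proof. by apply: (@complexI R); rewrite fmorphV !modulusE normfV. Qed.

Lemma modulusX z n : modulus (z ^+ n) = modulus z ^+ n.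
Proof. by apply: (@complexI R); rewrite rmorphXn !modulusE normrX. Qed.

Lemma modulus_real x : modulus (x%:C : C) = `|x|.
Proof. by apply: (@complexI R); rewrite modulusE normc_def/= expr0n/= addr0 sqrtr_sqr. Qed.

Lemma modulusB_le z w : modulus (z - w) <= modulus z + modulus w.
Proof. by rewrite (le_trans (modulusD _ _))// modulusN. Qed.

Lemma modulus_triangle u z w : modulus (z - w) <= modulus (z - u) + modulus (u - w).
Proof. by apply: le_trans (modulusD _ _); rewrite addrA subrK. Qed.

Lemma le_modulusB z w : modulus z - modulus w <= modulus (z - w).
Proof. by rewrite lerBlDr; apply: le_trans (modulusD _ _); rewrite subrK. Qed.

Lemma modulus_sqrE z : modulus z ^+ 2 = complex.Re z ^+ 2 + complex.Im z ^+ 2.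
Proof. by case: z => a b; exact: modulus_sqr. Qed.

Lemma Re_le_modulus z : `|complex.Re z| <= modulus z.
Proof.
rewrite -(ler_pXn2r (n := 2))// ?nnegrE ?modulus_ge0// modulus_sqrE.
by rewrite real_normK ?num_real// lerDl sqr_ge0.
Qed.

Lemma Im_le_modulus z : `|complex.Im z| <= modulus z.
Proof.
rewrite -(ler_pXn2r (n := 2))// ?nnegrE ?modulus_ge0// modulus_sqrE.
by rewrite real_normK ?num_real// lerDr sqr_ge0.
Qed.

Lemma modulus_le_ReIm z : modulus z <= `|complex.Re z| + `|complex.Im z|.
Proof.
rewrite -(ler_pXn2r (n := 2))// ?nnegrE ?modulus_ge0 ?addr_ge0// modulus_sqrE.
rewrite -(real_normK (num_real (complex.Re z))).
rewrite -(real_normK (num_real (complex.Im z))).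
have := normr_ge0 (complex.Re z); have := normr_ge0 (complex.Im z); nra.
Qed.

Lemma discE z : disc z = (modulus z < 1) :> Prop.
Proof. by rewrite /disc/= -modulusE -[X in _ < X]/(1%:C) ltcR. Qed.

Lemma closed_discE z : closed_disc z = (modulus z <= 1) :> Prop.
Proof. by rewrite /closed_disc/= -modulusE -[X in _ <= X]/(1%:C) lecR. Qed.

Lemma exists_unimodular z :
  exists2 c, modulus c = 1 & c * z = (modulus z)%:C.
Proof.
have [->|z0] := eqVneq z 0.
  by exists 1; rewrite ?modulus1// mulr0 modulus0.
exists ((modulus z)%:C / z).
  by rewrite modulusM modulusV modulus_real ger0_norm ?modulus_ge0// divff// modulus_eq0.
by rewrite -mulrA mulVf// mulr1.
Qed.

Lemma cReD z w : complex.Re (z + w) = complex.Re z + complex.Re w.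
Proof. by case: z; case: w. Qed.
Lemma cImD z w : complex.Im (z + w) = complex.Im z + complex.Im w.
Proof. by case: z; case: w. Qed.
Lemma cReN z : complex.Re (- z) = - complex.Re z.
Proof. by case: z. Qed.
Lemma cImN z : complex.Im (- z) = - complex.Im z.
Proof. by case: z. Qed.
Lemma cReM z w : complex.Re (z * w) =
  complex.Re z * complex.Re w - complex.Im z * complex.Im w.
Proof. by case: z; case: w. Qed.
Lemma cImM z w : complex.Im (z * w) =
  complex.Re z * complex.Im w + complex.Im z * complex.Re w.
Proof. by case: z; case: w. Qed.

Lemma cvgCP T (F : set_system T) {FF : Filter F} (f : T -> C) (l : C) :
  (f @ F --> l) <-> (forall e : R, 0 < e -> \forall t \near F, modulus (f t - l) < e).
Proof.
split=> [H e e0|H].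
  have := proj1 (@cvgrPdist_lt _ C _ F FF f l) H e%:C.
  rewrite ltcR => /(_ e0); apply: filterS => t.
  by rewrite -modulusE ltcR modulusBC.
apply: (proj2 (@cvgrPdist_lt _ C _ F FF f l)) => e e0.
have ee : e = (modulus e)%:C by rewrite modulusE gtr0_norm.
have /H : 0 < modulus e by rewrite -ltcR -ee.
by apply: filterS => t h; rewrite ee -modulusE ltcR modulusBC.
Qed.

Lemma nbhsCP (z : C) (P : set C) :
  nbhs z P <-> exists2 d : R, 0 < d & forall w, modulus (w - z) < d -> P w.
Proof.
split=> [/nbhs_ballP[e /= e0 He]|[d d0 H]].
  have ee : e = (modulus e)%:C by rewrite modulusE gtr0_norm.
  exists (modulus e); first by rewrite -ltcR -ee.
  by move=> w wz; apply: He; rewrite -ball_normE/= -modulusE ee ltcR modulusBC.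
apply/nbhs_ballP; exists d%:C => /=; first by rewrite ltcR.
by move=> w; rewrite -ball_normE/= -modulusE ltcR modulusBC => /H.
Qed.

Definition ccont (f : C -> C) z := forall e : R, 0 < e ->
  exists2 d : R, 0 < d & forall w, modulus (w - z) < d -> modulus (f w - f z) < e.

Lemma ccontP f z : {for z, continuous f} <-> ccont f z.
Proof.
have cP := @cvgCP C (nbhs z) (nbhs_filter z) f (f z).
split=> [/cP H e e0|H]; first by have /nbhsCP := H e e0.
by apply/cP => e e0; apply/nbhsCP; exact: H.
Qed.

(** Free of division and with real [e] and [d], so that estimates are inequalities in [R] and the
    point [w = z] is no exception. *)
Definition cdiff (f : C -> C) z L := forall e : R, 0 < e ->
  exists2 d : R, 0 < d & forall w, modulus (w - z) < d ->
    modulus (f w - f z - L * (w - z)) <= e * modulus (w - z).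

Lemma cdiffP f z L : cdiff f z L <-> is_derive z 1 f L.
Proof.
have s1 (h : C) : h *: (1 : C) = h by exact: mulr1.
have key : cdiff f z L <->
    (fun h : C => h^-1 *: (f (h *: 1 + z) - f z)) @ 0^' --> L.
  have cP := @cvgCP C 0^' _ (fun h : C => h^-1 *: (f (h *: 1 + z) - f z)) L.
  split=> [H|/cP H].
    apply/cP => e e0.
    have [d d0 Hd] := H (e / 2) (divr_gt0 e0 (ltr0Sn _ 1)).
    apply/nbhsCP; exists d => // h; rewrite subr0 => hd h0.
    have := Hd (h + z); rewrite addrK => /(_ hd) {}Hd.
    have -> : h^-1 *: (f (h *: (1 : C) + z) - f z) - L =
        h^-1 * (f (h + z) - f z - L * h).
      rewrite s1.
      rewrite -[_ *: _]/(_ * _) [RHS]mulrBr [L * h]mulrC mulrA mulVf ?mul1r//.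
    rewrite modulusM modulusV.
    have mh : 0 < modulus h by rewrite modulus_gt0.
    rewrite mulrC ltr_pdivrMr//; nra.
  move=> e e0; have /nbhsCP[d d0 Hd] := H e e0.
  exists d => // w wd; have [->|wz] := eqVneq w z.
    by rewrite !subrr mulr0 subrr modulus0 mulr0.
  have wz0 : w - z != 0 by rewrite subr_eq0.
  have := Hd (w - z); rewrite subr0 => /(_ wd wz0).
  have -> : (w - z)^-1 *: (f ((w - z) *: (1:C) + z) - f z) - L =
      (w - z)^-1 * (f w - f z - L * (w - z)).
    rewrite s1 subrK.
    rewrite -[_ *: _]/(_ * _) [RHS]mulrBr [L * _]mulrC mulrA mulVf ?mul1r//.
  rewrite modulusM modulusV.
  have mh : 0 < modulus (w - z) by rewrite modulus_gt0.
  by rewrite mulrC ltr_pdivrMr// => /ltW.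
rewrite key; split=> [H|[df dfL]].
  apply: DeriveDef; first by apply/cvg_ex; exists L.
  exact/cvg_lim.
by rewrite -dfL; exact: df.
Qed.

Lemma derivable_cdiff f z : derivable f z 1 -> cdiff f z (derive1 f z).
Proof. by move=> H; apply/cdiffP; rewrite derive1E; exact: derivableP. Qed.

Lemma cdiff_derivable f z L : cdiff f z L -> derivable f z 1.
Proof. by move=> /cdiffP[]. Qed.

Lemma cdiff_derive1 f z L : cdiff f z L -> derive1 f z = L.
Proof. by move=> /cdiffP H; rewrite derive1E derive_val. Qed.

Lemma cdiff_ccont f z L : cdiff f z L -> ccont f z.
Proof.
move=> /cdiff_derivable/derivable1_diffP/differentiable_continuous H.
exact/ccontP.
Qed.

Lemma cdiffD f g z L M : cdiff f z L -> cdiff g z M ->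
  cdiff (fun z => f z + g z) z (L + M).
Proof. by move=> /cdiffP H /cdiffP K; apply/cdiffP; exact: is_deriveD. Qed.

Lemma cdiffB f g z L M : cdiff f z L -> cdiff g z M ->
  cdiff (fun z => f z - g z) z (L - M).
Proof. by move=> /cdiffP H /cdiffP K; apply/cdiffP; exact: is_deriveB. Qed.

Lemma cdiffM f g z L M : cdiff f z L -> cdiff g z M ->
  cdiff (fun z => f z * g z) z (f z * M + L * g z).
Proof.
move=> /cdiffP H /cdiffP K; apply/cdiffP.
have := is_deriveM H K; rewrite -![_ *: _]/(_ * _) [g z * L]mulrC.
exact.
Qed.

Lemma cdiff_cst c z : cdiff (fun=> c) z 0.
Proof. by apply/cdiffP; exact: is_derive_cst. Qed.

Lemma cdiff_id z : cdiff id z 1.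
Proof. by apply/cdiffP; exact: is_derive_id. Qed.

Lemma cdiff_ext f g z L : (exists2 d : R, 0 < d &
  forall w, modulus (w - z) < d -> f w = g w) -> cdiff f z L -> cdiff g z L.
Proof.
move=> [d d0 fg] H e e0; have [d' d'0 Hd] := H e e0.
exists (Num.min d d'); first by rewrite lt_min d0.
move=> w; rewrite lt_min => /andP[wd wd']; rewrite -!fg//; first exact: Hd.
by rewrite subrr modulus0.
Qed.

Lemma cdiff_comp f g z L M : cdiff f z L -> cdiff g (f z) M ->
  cdiff (g \o f) z (M * L).
Proof.
move=> H K e e0; have := cdiff_ccont H => Hc.
have mL : 0 <= modulus L := modulus_ge0 L.
have mM : 0 <= modulus M := modulus_ge0 M.
(* The error of [g] contributes [e1 (|L| + 1) = e / 2] and that of [f] contributes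
   [|M| e2 <= e / 2]; the bound [e2 <= 1] gives the Lipschitz constant [|L| + 1] for [f] at [z]. *)
pose e1 := e / 2 / (modulus L + 1).
have e10 : 0 < e1 by rewrite !divr_gt0//; lra.
pose e2 := Num.min 1 (e / 2 / (modulus M + 1)).
have e20 : 0 < e2 by rewrite lt_min ltr01 !divr_gt0//; lra.
have e21 : e2 <= 1 by rewrite ge_min lexx.
have e22 : e2 * (modulus M) <= e / 2.
  have : e2 <= e / 2 / (modulus M + 1) by rewrite ge_min lexx orbT.
  rewrite ler_pdivlMr; last lra.
  by apply: le_trans; rewrite ler_wpM2l ?(ltW e20)//; lra.
have e12 : e1 * (modulus L + 1) = e / 2.
  by rewrite /e1 -mulrA mulVf ?mulr1// lt0r_neq0//; lra.
have [d1 d10 K1] := K _ e10.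
have [d2 d20 H2] := H _ e20.
have [d3 d30 H3] := Hc _ d10.
exists (Num.min d2 d3); first by rewrite lt_min d20.
move=> w; rewrite lt_min => /andP[w2 w3] /=.
have {}K1 := K1 _ (H3 _ w3); have {}H2 := H2 _ w2.
have -> : g (f w) - g (f z) - M * L * (w - z) =
  (g (f w) - g (f z) - M * (f w - f z)) + M * (f w - f z - L * (w - z)) by ring.
have D := modulusD (g (f w) - g (f z) - M * (f w - f z)) (M * (f w - f z - L * (w - z))).
rewrite modulusM in D.
have mwz := modulus_ge0 (w - z).
have B : modulus (f w - f z) <= (modulus L + 1) * modulus (w - z).
  have -> : f w - f z = (f w - f z - L * (w - z)) + L * (w - z) by ring.
  apply: le_trans (modulusD _ _) _; rewrite modulusM; nra.
have E1 := ler_wpM2l (ltW e10) B; rewrite mulrA e12 in E1.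
have E2 := ler_wpM2l mM H2.
have E3 := ler_wpM2r mwz e22.
have : modulus M * (e2 * modulus (w - z)) = e2 * modulus M * modulus (w - z) by ring.
move=> E4; lra.
Qed.

End modulus_theory.

(** * Calculus in one real variable *)

Section real_variable.
Variable R : realType.
Local Notation C := (Cplx R).
Implicit Types (w : R -> C) (c L : C) (s t : R).

Definition rcont (w : R -> C) t := forall e : R, 0 < e ->
  exists2 d : R, 0 < d & forall s, `|s - t| < d -> modulus (w s - w t) < e.

Definition rdiff (w : R -> C) t L := forall e : R, 0 < e ->
  exists2 d : R, 0 < d & forall s, `|s - t| < d ->
    modulus (w s - w t - (s - t)%:C * L) <= e * `|s - t|.

Lemma nbhsRP (x : R) (P : set R) :
  nbhs x P <-> exists2 d : R, 0 < d & forall y, `|y - x| < d -> P y.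
Proof.
split=> [/nbhs_ballP[e /= e0 He]|[d d0 H]].
  by exists e => // y yx; apply: He; rewrite -ball_normE/= distrC.
apply/nbhs_ballP; exists d => //= y; rewrite -ball_normE/= distrC; exact: H.
Qed.

Lemma continuousRP (f : R -> R) (x : R) : {for x, continuous f} <->
  forall e : R, 0 < e ->
  exists2 d : R, 0 < d & forall y, `|y - x| < d -> `|f y - f x| < e.
Proof.
split=> [/cvgrPdist_lt H e e0|H].
  by have /nbhsRP[d d0 Hd] := H e e0; exists d => // y /Hd; rewrite distrC.
apply/cvgrPdist_lt => e e0; apply/nbhsRP.
by have [d d0 Hd] := H e e0; exists d => // y /Hd; rewrite distrC.
Qed.

Lemma is_deriveRP (f : R -> R) (x l : R) : is_derive x 1 f l <->
  forall e : R, 0 < e -> exists2 d : R, 0 < d & forall y, `|y - x| < d ->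
    `|f y - f x - l * (y - x)| <= e * `|y - x|.
Proof.
have s1 (h : R) : h *: (1 : R) = h by exact: mulr1.
have key : (forall e : R, 0 < e -> exists2 d : R, 0 < d &
      forall y, `|y - x| < d -> `|f y - f x - l * (y - x)| <= e * `|y - x|) <->
    (fun h : R => h^-1 *: (f (h *: 1 + x) - f x)) @ 0^' --> l.
  split=> [H|/cvgrPdist_lt H].
    apply/cvgrPdist_lt => e e0.
    have [d d0 Hd] := H (e / 2) (divr_gt0 e0 (ltr0Sn _ 1)).
    apply/nbhsRP; exists d => // h; rewrite subr0 => hd h0.
    have := Hd (h + x); rewrite addrK => /(_ hd) {}Hd.
    rewrite distrC.
    have -> : h^-1 *: (f (h *: (1 : R) + x) - f x) - l =
        h^-1 * (f (h + x) - f x - l * h).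
      rewrite s1 -[_ *: _]/(_ * _) [RHS]mulrBr [l * h]mulrC mulrA mulVf ?mul1r//.
    rewrite normrM normfV.
    have mh : 0 < `|h| by rewrite normr_gt0.
    rewrite mulrC ltr_pdivrMr//; nra.
  move=> e e0; have /nbhsRP[d d0 Hd] := H e e0.
  exists d => // w wd; have [->|wz] := eqVneq w x.
    by rewrite !subrr mulr0 subrr normr0 mulr0.
  have wz0 : w - x != 0 by rewrite subr_eq0.
  have := Hd (w - x); rewrite subr0 => /(_ wd wz0).
  rewrite distrC.
  have -> : (w - x)^-1 *: (f ((w - x) *: (1:R) + x) - f x) - l =
      (w - x)^-1 * (f w - f x - l * (w - x)).
    rewrite s1 subrK.
    rewrite -[_ *: _]/(_ * _) [RHS]mulrBr [l * _]mulrC mulrA mulVf ?mul1r//.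
  rewrite normrM normfV.
  have mh : 0 < `|w - x| by rewrite normr_gt0.
  by rewrite mulrC ltr_pdivrMr// => /ltW.
rewrite key; split=> [[df <-]|H]; first exact: df.
apply: DeriveDef; first by apply/cvg_ex; exists l.
exact/cvg_lim.
Qed.

Lemma rdiff_Re c w t L : rdiff w t L ->
  is_derive t 1 (fun s => complex.Re (c * w s)) (complex.Re (c * L)).
Proof.
move=> H; apply/is_deriveRP => e e0.
have c0 := modulus_ge0 c.
have [|d d0 Hd] := H (e / (modulus c + 1)); first by rewrite divr_gt0//; lra.
exists d => // s /Hd {}Hd.
have -> : complex.Re (c * w s) - complex.Re (c * w t) - complex.Re (c * L) * (s - t) =
    complex.Re (c * (w s - w t - (s - t)%:C * L)).
  by rewrite !(cReM, cReD, cReN, cImM, cImD, cImN)/=; ring.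
apply: le_trans (Re_le_modulus _) _; rewrite modulusM.
apply: le_trans (ler_wpM2l c0 Hd) _; rewrite mulrA ler_wpM2r//.
rewrite mulrCA ger_pMr// ler_pdivrMr ?mul1r; lra.
Qed.

Lemma rdiff_ReIm w t L :
  is_derive t 1 (fun s => complex.Re (w s)) (complex.Re L) ->
  is_derive t 1 (fun s => complex.Im (w s)) (complex.Im L) -> rdiff w t L.
Proof.
move=> /is_deriveRP H /is_deriveRP K e e0.
have [d d0 Hd] := H (e / 2) (divr_gt0 e0 (ltr0Sn _ 1)).
have [d' d'0 Kd] := K (e / 2) (divr_gt0 e0 (ltr0Sn _ 1)).
exists (Num.min d d'); first by rewrite lt_min d0.
move=> s; rewrite lt_min => /andP[/Hd {}Hd /Kd {}Kd].
apply: le_trans (modulus_le_ReIm _) _.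
have -> : complex.Re (w s - w t - (s - t)%:C * L) =
    complex.Re (w s) - complex.Re (w t) - complex.Re L * (s - t).
  by rewrite !(cReM, cReD, cReN, cImM, cImD, cImN)/=; ring.
have -> : complex.Im (w s - w t - (s - t)%:C * L) =
    complex.Im (w s) - complex.Im (w t) - complex.Im L * (s - t).
  by rewrite !(cReM, cReD, cReN, cImM, cImD, cImN)/=; ring.
lra.
Qed.

Lemma rdiffD w1 w2 t L1 L2 : rdiff w1 t L1 -> rdiff w2 t L2 ->
  rdiff (fun s => w1 s + w2 s) t (L1 + L2).
Proof.
move=> H K e e0.
have [d d0 Hd] := H (e / 2) (divr_gt0 e0 (ltr0Sn _ 1)).
have [d' d'0 Kd] := K (e / 2) (divr_gt0 e0 (ltr0Sn _ 1)).
exists (Num.min d d'); first by rewrite lt_min d0.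
move=> s; rewrite lt_min => /andP[/Hd {}Hd /Kd {}Kd].
have -> : w1 s + w2 s - (w1 t + w2 t) - (s - t)%:C * (L1 + L2) =
  (w1 s - w1 t - (s - t)%:C * L1) + (w2 s - w2 t - (s - t)%:C * L2) by ring.
apply: le_trans (modulusD _ _) _; lra.
Qed.

Lemma rdiffZ c w t L : rdiff w t L -> rdiff (fun s => c * w s) t (c * L).
Proof.
move=> H e e0; have c0 := modulus_ge0 c.
have [|d d0 Hd] := H (e / (modulus c + 1)); first by rewrite divr_gt0//; lra.
exists d => // s /Hd {}Hd.
have -> : c * w s - c * w t - (s - t)%:C * (c * L) =
  c * (w s - w t - (s - t)%:C * L) by ring.
rewrite modulusM.
apply: le_trans (ler_wpM2l c0 Hd) _; rewrite mulrA ler_wpM2r//.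
rewrite mulrCA ger_pMr// ler_pdivrMr ?mul1r; lra.
Qed.

Lemma rdiff_affine w (x y : R) t L : rdiff w (x + y * t) L ->
  rdiff (fun s => w (x + y * s)) t (y%:C * L).
Proof.
move=> H e e0; have c0 := normr_ge0 y.
have [|d d0 Hd] := H (e / (`|y| + 1)); first by rewrite divr_gt0//; lra.
exists (d / (`|y| + 1)); first by rewrite divr_gt0//; lra.
move=> s; rewrite ltr_pdivlMr => [sd|]; last lra.
have E : x + y * s - (x + y * t) = y * (s - t) by ring.
have st := normr_ge0 (s - t).
have := Hd (x + y * s); rewrite E normrM => /(_ _){}Hd.
have {}Hd := Hd ltac:(nra).
rewrite rmorphM/= in Hd.
have -> : (s - t)%:C * (y%:C * L) = y%:C * (s - t)%:C * L by ring.
apply: le_trans Hd _.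
rewrite mulrA ler_wpM2r// mulrAC ler_pdivrMr; last lra.
by rewrite ler_wpM2l ?(ltW e0)//; lra.
Qed.

Lemma rdiff_line (F : C -> C) (a v : C) t L : cdiff F (a + t%:C * v) L ->
  rdiff (fun s => F (a + s%:C * v)) t (L * v).
Proof.
move=> H e e0; have c0 := modulus_ge0 v.
have [|d d0 Hd] := H (e / (modulus v + 1)); first by rewrite divr_gt0//; lra.
exists (d / (modulus v + 1)); first by rewrite divr_gt0//; lra.
move=> s; rewrite ltr_pdivlMr => [sd|]; last lra.
have E : a + s%:C * v - (a + t%:C * v) = (s - t)%:C * v by rewrite rmorphB/=; ring.
have st := normr_ge0 (s - t).
have := Hd (a + s%:C * v); rewrite E modulusM modulus_real => /(_ _){}Hd.
have {}Hd := Hd ltac:(nra).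
have -> : (s - t)%:C * (L * v) = L * ((s - t)%:C * v) by ring.
apply: le_trans Hd _.
rewrite [`|_| * _]mulrC mulrA ler_wpM2r// mulrAC ler_pdivrMr; last lra.
by rewrite ler_wpM2l ?(ltW e0)//; lra.
Qed.

Lemma rcont_line (F : C -> C) (a v : C) t : ccont F (a + t%:C * v) ->
  rcont (fun s => F (a + s%:C * v)) t.
Proof.
move=> H e e0; have c0 := modulus_ge0 v; have [d d0 Hd] := H _ e0.
exists (d / (modulus v + 1)); first by rewrite divr_gt0//; lra.
move=> s; rewrite ltr_pdivlMr => [sd|]; last lra.
apply: Hd.
have -> : a + s%:C * v - (a + t%:C * v) = (s - t)%:C * v by rewrite rmorphB/=; ring.
rewrite modulusM modulus_real; have := normr_ge0 (s - t); nra.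
Qed.

Lemma rcontZ c w t : rcont w t -> rcont (fun s => c * w s) t.
Proof.
move=> H e e0; have c0 := modulus_ge0 c.
have [|d d0 Hd] := H (e / (modulus c + 1)); first by rewrite divr_gt0//; lra.
exists d => // s /Hd; rewrite ltr_pdivlMr => [|]; last lra.
rewrite -mulrBr modulusM; have := modulus_ge0 (w s - w t); nra.
Qed.

(* Rotate [w] so that its increment is a nonnegative real and apply the mean
   value theorem to [r - Re w]. *)
Lemma mean_value_bound w w' (r r' : R -> R) (a b : R) : a <= b ->
  (forall t, t \in `[a, b] -> rdiff w t (w' t)) ->
  (forall t, t \in `[a, b] -> is_derive t 1 r (r' t)) ->
  (forall t, t \in `[a, b] -> modulus (w' t) <= r' t) ->
  modulus (w b - w a) <= r b - r a.
Proof.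
move=> ab dw dr wr; have [c c1 cE] := exists_unimodular (w b - w a).
pose psi s := r s - complex.Re (c * w s).
have dpsi t : t \in `[a, b] -> is_derive t 1 psi (r' t - complex.Re (c * w' t)).
  by move=> tab; apply: is_deriveB; [exact: dr|exact/rdiff_Re/dw].
have cpsi : {within `[a, b], continuous psi}.
  by apply: derivable_within_continuous => t /dpsi[].
pose dps t := r' t - complex.Re (c * w' t).
have dpsio t : t \in `]a, b[ -> is_derive t 1 psi (dps t).
  by move=> tab; apply: dpsi; exact: subset_itv_oo_cc tab.
have [t tab] := MVT_segment ab dpsio cpsi; rewrite /dps.
have : 0 <= r' t - complex.Re (c * w' t).
  rewrite subr_ge0; apply: le_trans (wr _ tab).
  apply: le_trans (ler_norm _) _; apply: le_trans (Re_le_modulus _) _.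
  by rewrite modulusM c1 mul1r.
move=> p0 E; have : 0 <= psi b - psi a by rewrite E mulr_ge0// subr_ge0.
rewrite /psi => {}E.
have : complex.Re (c * w b) - complex.Re (c * w a) = modulus (w b - w a).
  by rewrite -cReN -cReD -mulrBr cE.
lra.
Qed.

Lemma mean_value_le w w' (K a b : R) : a <= b ->
  (forall t, t \in `[a, b] -> rdiff w t (w' t)) ->
  (forall t, t \in `[a, b] -> modulus (w' t) <= K) ->
  modulus (w b - w a) <= K * (b - a).
Proof.
move=> ab dw wK; rewrite mulrBr.
apply: (@mean_value_bound w w' (fun t => K * t) (fun=> K)) => // t _.
apply/is_deriveRP => e e0; exists 1 => // y _.
by rewrite -mulrBr subrr normr0 mulr_ge0// ltW.
Qed.

(** Extends functions on [0, 1] continuously to the line, so that their antiderivatives have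
    two-sided derivatives at 0 and 1 as well. *)
Definition clamp01 (x : R) := Num.min 1 (Num.max 0 x).

Lemma clamp01_itv x : clamp01 x \in `[0, 1].
Proof. by rewrite in_itv/= /clamp01 le_min ler01 le_max lexx ge_min lexx. Qed.

Lemma clamp01_id x : x \in `[0, 1] -> clamp01 x = x.
Proof. by rewrite in_itv/= /clamp01 => /andP[x0 x1]; rewrite max_r// min_r. Qed.

Lemma clamp01_lip x y : `|clamp01 x - clamp01 y| <= `|x - y|.
Proof.
rewrite /clamp01 /Order.min /Order.max; case: (ltP 0 x) => ?; case: (ltP 0 y) => ?;
  try (case: (ltP 1 x) => ?); try (case: (ltP 1 y) => ?); try (case: (ltP 1 0) => ?);
  rewrite ?subrr ?normr0 ?normr_ge0//; rewrite !ler_norml; have := ler_norm (x - y);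
  have := ler_norm (y - x); rewrite [`|y - x|]distrC; lra.
Qed.

Lemma antiderivative_real (f : R -> R) : continuous f ->
  exists F : R -> R, forall x : R, x \in `[0, 1] -> is_derive x 1 F (f x).
Proof.
move=> cf.
(* Starting the integral at -1 puts [0, 1] in the interior of [-1, 2], where the fundamental theorem
   gives derivatives. *)
exists (fun x => \int[lebesgue_measure]_(t in [set` `[-1, x]]) f t) => x.
rewrite in_itv/= => /andP[x0 x1].
have [||||dF F'] := @continuous_FTC1_closed R f (-1) x 2; [lra| |lra|exact: cf|].
  apply: continuous_compact_integrable; first exact: segment_compact.
  by apply: continuous_subspaceT.
by rewrite derive1E in F'; exact: DeriveDef dF F'.
Qed.

Lemma antiderivative (w : R -> C) :
  (forall t, t \in `[0, 1] -> rcont w t) ->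
  exists W : R -> C, forall t, t \in `[0, 1] -> rdiff W t (w t).
Proof.
move=> cw.
have cwc t e : 0 < e -> exists2 d, 0 < d & forall s, `|s - t| < d ->
    modulus (w (clamp01 s) - w (clamp01 t)) < e.
  move=> e0; have [d d0 Hd] := cw _ (clamp01_itv t) _ e0.
  by exists d => // s st; apply: Hd; apply: le_lt_trans (clamp01_lip _ _) _.
have [|F HF] := @antiderivative_real (fun t => complex.Re (w (clamp01 t))).
  move=> t; apply/continuousRP => e e0; have [d d0 Hd] := cwc t e e0.
  exists d => // s /Hd; apply: le_lt_trans; rewrite -cReN -cReD.
  exact: Re_le_modulus.
have [|G HG] := @antiderivative_real (fun t => complex.Im (w (clamp01 t))).
  move=> t; apply/continuousRP => e e0; have [d d0 Hd] := cwc t e e0.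
  exists d => // s /Hd; apply: le_lt_trans; rewrite -cImN -cImD.
  exact: Im_le_modulus.
exists (fun t => F t +i* G t) => t t01; apply: rdiff_ReIm => /=.
  by have := HF t t01; rewrite clamp01_id.
by have := HG t t01; rewrite clamp01_id.
Qed.

Lemma FTC_real (F f : R -> R) : (forall x : R, x \in `[0, 1] -> is_derive x 1 F (f x)) ->
  {within `[0, 1], continuous f} ->
  \int[lebesgue_measure]_(t in `[0%R, 1%R]) f t = F 1 - F 0.
Proof.
move=> dF cf; rewrite /Rintegral.
rewrite (@continuous_FTC2 R f F 0 1)//=.
- split=> [x /subset_itv_oo_cc/dF[]//||].
  + apply/cvg_at_right_filter/differentiable_continuous/derivable1_diffP.
    by have [] := dF 0; rewrite ?in_itv/= ?lexx ?ler01.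
  + apply/cvg_at_left_filter/differentiable_continuous/derivable1_diffP.
    by have [] := dF 1; rewrite ?in_itv/= ?lexx ?ler01.
- by move=> x /subset_itv_oo_cc/dF H; rewrite derive1E derive_val.
Qed.

Lemma cintegral01_FTC (W w : R -> C) :
  (forall t, t \in `[0, 1] -> rdiff W t (w t)) ->
  (forall t, t \in `[0, 1] -> rcont w t) ->
  cintegral01 w = W 1 - W 0.
Proof.
move=> dW cw; rewrite /cintegral01.
have dRe t : t \in `[0, 1] ->
    is_derive t 1 (fun s => complex.Re (W s)) (complex.Re (w t)).
  move=> t01; have := rdiff_Re 1 (dW t t01); rewrite mul1r.
  by under eq_fun do rewrite mul1r.
have dIm t : t \in `[0, 1] ->
    is_derive t 1 (fun s => complex.Im (W s)) (complex.Im (w t)).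
  (* Multiplication by [-i] turns imaginary parts into real parts. *)
  move=> t01; have := rdiff_Re (0 -i* 1) (dW t t01).
  have E c : complex.Re ((0 -i* 1) * c) = complex.Im c.
    by case: c => x y /=; ring.
  by rewrite E; under eq_fun do rewrite E.
rewrite (FTC_real dRe); last first.
  apply: continuous_in_subspaceT => t /set_mem t01; apply/continuousRP => e e0.
  have [d d0 Hd] := cw t t01 e e0; exists d => // s /Hd; apply: le_lt_trans.
  by rewrite -cReN -cReD; exact: Re_le_modulus.
rewrite (FTC_real dIm); last first.
  apply: continuous_in_subspaceT => t /set_mem t01; apply/continuousRP => e e0.
  have [d d0 Hd] := cw t t01 e e0; exists d => // s /Hd; apply: le_lt_trans.
  by rewrite -cImN -cImD; exact: Im_le_modulus.
by case: (W 1) => a b; case: (W 0).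
Qed.

End real_variable.

(** * Limits along ultrafilters and integrals along segments *)

Section ultralimits.
Variable R : realType.
Local Notation C := (Cplx R).

Definition ulim T (U : set_system T) (x : T -> C) (l : C) :=
  forall e : R, 0 < e -> U [set t | modulus (x t - l) < e].

Section fixed_ultrafilter.
Variables (T : Type) (U : set_system T).
Hypothesis UU : UltraFilter U.

(** Scaled into the closed disc, [x] has a cluster point by compactness, and along an ultrafilter a
    cluster point is a limit. *)
Lemma ulim_ex (x : T -> C) (M : R) : U [set t | modulus (x t) <= M] ->
  exists l, ulim U x l.
Proof.
move=> xM; pose N := `|M| + 1; have N0 : 0 < N by rewrite ltr_wpDl.
pose y t : C := x t / N%:C.
have yU : (y @ U) (@closed_disc R).
  change (U [set t | closed_disc (y t)]); apply: filterS xM => t /= xtM; rewrite closed_discE /y. rewrite modulusM modulusV modulus_real.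
  rewrite ger0_norm ?(ltW N0)// ler_pdivrMr// mul1r (le_trans xtM)//.
  by rewrite (le_trans (ler_norm M))// lerDl.
have [p [_ py]] := @closed_disc_compact R (y @ U) _ yU.
exists (N%:C * p) => e e0.
have eN : 0 < e / N by rewrite divr_gt0.
have [//|H] := in_ultra_setVsetC [set t | modulus (x t - N%:C * p) < e] UU.
have nb : nbhs p [set w | modulus (w - p) < e / N] by apply/nbhsCP; exists (e / N).
have [|w [/= [t tH tw] wp]] := py (y @` [set t | ~ modulus (x t - N%:C * p) < e]) _ _ nb.
  change (U [set t' | (y @` [set t | ~ modulus (x t - N%:C * p) < e]) (y t')]).
  by apply: filterS H => t /= Ht; exists t.
exfalso; apply: tH; move: wp; rewrite -tw /y ltr_pdivlMr//.
have -> : x t / N%:C - p = (N%:C)^-1 * (x t - N%:C * p).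
  by rewrite mulrBr mulrA mulVf ?mul1r 1?mulrC// -modulus_eq0 modulus_real normr_eq0 gt_eqF.
by rewrite modulusM modulusV modulus_real ger0_norm ?(ltW N0)// mulrAC mulVf ?mul1r// gt_eqF.
Qed.

Lemma ulim_le (x : T -> C) (l c : C) (M : R) : ulim U x l ->
  U [set t | modulus (x t - c) <= M] -> modulus (l - c) <= M.
Proof.
move=> xl xM; apply/ler_addgt0Pr => e e0.
have [t [/= h1 h2]] := filter_ex (filterI (xl e e0) xM).
have := modulus_triangle (x t) l c; rewrite [modulus (l - x t)]modulusBC; lra.
Qed.

Lemma ulim_unique (x : T -> C) l l' : ulim U x l -> ulim U x l' -> l = l'.
Proof.
move=> xl xl'; apply/eqP; rewrite -subr_eq0 -modulus_eq0 eq_le modulus_ge0 andbT.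
apply/ler_addgt0Pr => e e0; rewrite add0r; apply: (ulim_le xl).
by apply: filterS (xl' e e0) => t /ltW.
Qed.

Lemma ulimD (x y : T -> C) l m : ulim U x l -> ulim U y m ->
  ulim U (fun t => x t + y t) (l + m).
Proof.
move=> xl ym e e0; have e2 : 0 < e / 2 by rewrite divr_gt0.
apply: filterS (filterI (xl _ e2) (ym _ e2)) => t [/= h1 h2].
have -> : x t + y t - (l + m) = (x t - l) + (y t - m) by ring.
apply: le_lt_trans (modulusD _ _) _; lra.
Qed.

Lemma ulimZ c (x : T -> C) l : ulim U x l -> ulim U (fun t => c * x t) (c * l).
Proof.
move=> xl e e0; have c0 := modulus_ge0 c.
have e2 : 0 < e / (modulus c + 1) by rewrite divr_gt0//; lra.
apply: filterS (xl _ e2) => t /=; rewrite -mulrBr modulusM ltr_pdivlMr; last lra.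
have := modulus_ge0 (x t - l); nra.
Qed.

End fixed_ultrafilter.

Lemma ultra_nat : exists2 U : set_system nat, UltraFilter U &
  forall n, U [set k | (n <= k)%N].
Proof.
have [U [UU sU]] := ultraFilterLemma (_ : ProperFilter (\oo : set_system nat)).
by exists U => // n; apply: sU; exists n.
Qed.

(** Boundedness already gives a limit along an ultrafilter; the error is the tail of a geometric
    series. *)
Lemma geometric_limit (a : nat -> C) (p : R) :
  (forall n, modulus (a n.+1 - a n) <= p / 2 ^+ n) ->
  exists l, forall n, modulus (l - a n) <= 2 * p / 2 ^+ n.
Proof.
move=> Ha; have [U UU Un] := ultra_nat.
have key n k : modulus (a (n + k)%N - a n) <= 2 * p / 2 ^+ n - 2 * p / 2 ^+ (n + k).
  elim: k => [|k IHk]; first by rewrite addn0 !subrr modulus0.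
  apply: le_trans (modulus_triangle (a (n + k)%N) _ _) _.
  rewrite addnS; have := Ha (n + k)%N.
  have -> : 2 * p / 2 ^+ (n + k).+1 = p / 2 ^+ (n + k).
    by rewrite exprS invfM mulrACA mulrA mulfV ?mul1r// pnatr_eq0.
  lra.
have p0 : 0 <= p by have := Ha 0%N; rewrite expr0 divr1; apply: le_trans (modulus_ge0 _).
have keyw n k : (n <= k)%N -> modulus (a k - a n) <= 2 * p / 2 ^+ n.
  move=> nk; have := key n (k - n)%N; rewrite subnKC// => /le_trans; apply.
  by rewrite gerBl divr_ge0 ?mulr_ge0// exprn_ge0.
have [|l al] := @ulim_ex _ U UU a (modulus (a 0%N) + 2 * p / 2 ^+ 0).
  apply: filterS (Un 0%N) => k /= /keyw h; have := le_modulusB (a k) (a 0%N); lra.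
exists l => n; apply: (ulim_le UU al).
by apply: filterS (Un n) => k; exact: keyw.
Qed.

End ultralimits.

(** * Path integrals along segments *)

Section segments.
Variable R : realType.
Local Notation C := (Cplx R).
Implicit Types (h : C -> C) (a b c z : C).

Definition on_segment (P : C -> Prop) a b :=
  forall t : R, t \in `[0, 1] -> P (a + t%:C * (b - a)).

Definition seg h a b : C := cintegral01 (fun t => (b - a) * h (a + t%:C * (b - a))).

Let line0 a b : a + 0%:C * (b - a) = a.
Proof. by rewrite mul0r addr0. Qed.

Let line1 a b : a + 1%:C * (b - a) = b.
Proof. by rewrite mul1r addrC subrK. Qed.

Lemma seg_antiderivative h a b : on_segment (ccont h) a b ->
  exists2 W : R -> C,
    forall t, t \in `[0, 1] -> rdiff W t ((b - a) * h (a + t%:C * (b - a))) &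
    seg h a b = W 1 - W 0.
Proof.
move=> ch; have cw (t : R) : t \in `[0, 1] ->
    rcont (fun t => (b - a) * h (a + t%:C * (b - a))) t.
  by move=> t01; apply/rcontZ/rcont_line/ch.
by have [W dW] := antiderivative cw; exists W => //; exact: cintegral01_FTC.
Qed.

Lemma rdiff_unique (W V w : R -> C) :
  (forall t : R, t \in `[0, 1] -> rdiff W t (w t)) ->
  (forall t : R, t \in `[0, 1] -> rdiff V t (w t)) -> W 1 - W 0 = V 1 - V 0.
Proof.
move=> dW dV; apply/eqP; rewrite -subr_eq0 -modulus_eq0 eq_le modulus_ge0 andbT.
have -> : W 1 - W 0 - (V 1 - V 0) = W 1 + (-1) * V 1 - (W 0 + (-1) * V 0) by ring.
rewrite -[leRHS](mul0r (1 - 0)).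
apply: (@mean_value_le R (fun t => W t + (-1) * V t) (fun t => w t + (-1) * w t)) => // t t01.
- by apply: rdiffD; [exact: dW|apply: rdiffZ; exact: dV].
- by rewrite mulN1r subrr modulus0.
Qed.

Lemma seg_primitive h F a b : on_segment (ccont h) a b ->
  on_segment (fun z => cdiff F z (h z)) a b -> seg h a b = F b - F a.
Proof.
move=> ch dF; have [W dW ->] := seg_antiderivative ch.
have := @rdiff_unique W (fun t => F (a + t%:C * (b - a))) _ dW.
rewrite line0 line1 => -> // t t01.
by rewrite mulrC; exact/rdiff_line/dF.
Qed.

Lemma seg_bound h a b (K : R) : on_segment (ccont h) a b ->
  on_segment (fun z => modulus (h z) <= K) a b ->
  modulus (seg h a b) <= K * modulus (b - a).
Proof.
move=> ch hK; have [W dW ->] := seg_antiderivative ch.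
have := @mean_value_le R W _ (K * modulus (b - a)) 0 1 ler01 dW.
rewrite subr0 mulr1; apply => t t01.
by rewrite modulusM mulrC ler_wpM2r ?modulus_ge0//; exact: hK.
Qed.

Lemma ccontD h1 h2 z : ccont h1 z -> ccont h2 z -> ccont (fun z => h1 z + h2 z) z.
Proof. by move=> /ccontP H1 /ccontP H2; apply/ccontP; exact: (cvgD H1 H2). Qed.

Lemma ccontM h1 h2 z : ccont h1 z -> ccont h2 z -> ccont (fun z => h1 z * h2 z) z.
Proof. by move=> /ccontP H1 /ccontP H2; apply/ccontP; exact: (cvgM H1 H2). Qed.

Lemma ccont_cst c z : ccont (fun=> c) z.
Proof. by move=> e e0; exists 1 => // w _; rewrite subrr modulus0. Qed.

Lemma ccontZ c h z : ccont h z -> ccont (fun z => c * h z) z.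
Proof. by apply: ccontM; exact: ccont_cst. Qed.

Lemma segDZ h1 h2 c a b : on_segment (ccont h1) a b -> on_segment (ccont h2) a b ->
  seg (fun z => h1 z + c * h2 z) a b = seg h1 a b + c * seg h2 a b.
Proof.
move=> c1 c2; have [W1 dW1 ->] := seg_antiderivative c1.
have [W2 dW2 ->] := seg_antiderivative c2.
have [|W dW ->] := @seg_antiderivative (fun z => h1 z + c * h2 z) a b.
  by move=> t t01; apply: ccontD; [exact: c1|apply: ccontZ; exact: c2].
have := @rdiff_unique W (fun t => W1 t + c * W2 t) _ dW.
move=> -> => [|t t01]; first by ring.
rewrite mulrDr; apply: rdiffD; first exact: dW1.
by rewrite mulrCA; apply: rdiffZ; exact: dW2.
Qed.

Lemma eq_seg h1 h2 a b : on_segment (ccont h1) a b -> on_segment (ccont h2) a b ->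
  on_segment (fun z => h1 z = h2 z) a b -> seg h1 a b = seg h2 a b.
Proof.
move=> c1 c2 e12; have [W1 dW1 ->] := seg_antiderivative c1.
have [W2 dW2 ->] := seg_antiderivative c2.
by apply: (rdiff_unique dW1) => t t01; rewrite e12//; exact: dW2.
Qed.

Lemma itv01_convex (x y t : R) : x \in `[0, 1] -> y \in `[0, 1] -> t \in `[0, 1] ->
  x + (y - x) * t \in `[0, 1].
Proof. rewrite !in_itv/= => /andP[? ?] /andP[? ?] /andP[? ?]; apply/andP; split; nra. Qed.

(** One antiderivative serves all sub-segments, so that bisection and reversal of a segment become
    identities between differences. *)
Lemma seg_additive h a b : on_segment (ccont h) a b ->
  exists2 W : R -> C,
    forall t, t \in `[0, 1] -> rdiff W t ((b - a) * h (a + t%:C * (b - a))) &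
    forall x y : R, x \in `[0, 1] -> y \in `[0, 1] ->
    seg h (a + x%:C * (b - a)) (a + y%:C * (b - a)) = W y - W x.
Proof.
move=> ch; have [W dW _] := seg_antiderivative ch; exists W => // x y x01 y01.
have E (t : R) : a + x%:C * (b - a) + t%:C * (a + y%:C * (b - a) - (a + x%:C * (b - a))) =
    a + (x + (y - x) * t)%:C * (b - a).
  by rewrite rmorphD rmorphM rmorphB/=; ring.
have [|V dV ->] := @seg_antiderivative h (a + x%:C * (b - a)) (a + y%:C * (b - a)).
  by move=> t t01; rewrite E; apply: ch; exact: itv01_convex.
have := @rdiff_unique V (fun t => W (x + (y - x) * t)) _ dV.
rewrite mulr0 addr0 mulr1 [x + _]addrC subrK => -> // t t01.
have := dW _ (itv01_convex x01 y01 t01) => /rdiff_affine.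
rewrite E; congr rdiff; rewrite rmorphB/=; ring.
Qed.

Definition mid a b : C := a + (2^-1)%:C * (b - a).

Let half01 : (2^-1 : R) \in `[0, 1].
Proof. by rewrite in_itv/=; apply/andP; split; lra. Qed.

Let zero01 : (0 : R) \in `[0, 1].
Proof. by rewrite in_itv/= lexx ler01. Qed.

Let one01 : (1 : R) \in `[0, 1].
Proof. by rewrite in_itv/= lexx ler01. Qed.

Lemma seg_mid h a b : on_segment (ccont h) a b ->
  seg h a b = seg h a (mid a b) + seg h (mid a b) b.
Proof.
move=> /seg_additive[W _ HW].
have := HW _ _ zero01 one01; have := HW _ _ zero01 half01; have := HW _ _ half01 one01.
by rewrite line0 line1 => -> -> ->; ring.
Qed.

Lemma seg_rev h a b : on_segment (ccont h) a b -> seg h b a = - seg h a b.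
Proof.
move=> /seg_additive[W _ HW].
have := HW _ _ zero01 one01; have := HW _ _ one01 zero01.
by rewrite line0 line1 => -> ->; ring.
Qed.

Lemma modulus_mid a b : modulus (mid a b - a) = modulus (b - a) / 2.
Proof.
rewrite /mid addrAC subrr add0r modulusM modulus_real ger0_norm ?invr_ge0//.
by rewrite mulrC.
Qed.

End segments.

(** * Goursat's lemma *)

Section goursat.
Variable R : realType.
Local Notation C := (Cplx R).
Implicit Types (h : C -> C) (a b c z : C) (K : set C).

Definition tri h a b c := seg h a b + seg h b c + seg h c a.

Definition convexC K := forall a b, K a -> K b -> on_segment K a b.

Definition closedC K := forall z,
  (forall e : R, 0 < e -> exists2 w, K w & modulus (w - z) < e) -> K z.

Lemma convexC_mid K a b : convexC K -> K a -> K b -> K (mid a b).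
Proof. by move=> KK Ka Kb; apply: KK => //; rewrite in_itv/=; apply/andP; split; lra. Qed.

Lemma convexC_seg K P a b : (forall z, K z -> P z) -> convexC K -> K a -> K b ->
  on_segment P a b.
Proof. by move=> KP KK Ka Kb t t01; apply: KP; exact: KK. Qed.

Definition perimeter a b c := modulus (b - a) + modulus (c - b) + modulus (a - c).

Lemma perimeter_ge0 a b c : 0 <= perimeter a b c.
Proof. by rewrite !addr_ge0 ?modulus_ge0. Qed.

(** The sides of the middle triangle are traversed twice, in opposite directions, and cancel. *)
Lemma tri_split K h a b c : convexC K -> (forall z, K z -> ccont h z) ->
  K a -> K b -> K c ->
  tri h a b c = tri h a (mid a b) (mid c a) + tri h (mid a b) b (mid b c) +
    tri h (mid c a) (mid b c) c + tri h (mid a b) (mid b c) (mid c a).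
Proof.
move=> KK Kh Ka Kb Kc.
have S x y : K x -> K y -> on_segment (ccont h) x y by exact: convexC_seg.
have Km := convexC_mid KK Ka Kb; have Kk := convexC_mid KK Kb Kc.
have Kn := convexC_mid KK Kc Ka.
rewrite /tri (seg_mid (S _ _ Ka Kb)) (seg_mid (S _ _ Kb Kc)) (seg_mid (S _ _ Kc Ka)).
rewrite (seg_rev (S _ _ Km Kn)) (seg_rev (S _ _ Km Kk)) (seg_rev (S _ _ Kk Kn)).
move: (seg h a (mid a b)) (seg h (mid a b) b) (seg h b (mid b c)) (seg h (mid b c) c).
move: (seg h c (mid c a)) (seg h (mid c a) a) (seg h (mid a b) (mid c a)).
move: (seg h (mid a b) (mid b c)) (seg h (mid b c) (mid c a)) => *; ring.
Qed.

(* Affine functions have a primitive, so only the remainder of the first order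
   expansion at [z] contributes to the integral over the triangle. *)
Lemma tri_cdiff_bound K h z L a b c (e d : R) : convexC K ->
  (forall w, K w -> ccont h w) -> K a -> K b -> K c ->
  (forall w, K w -> modulus (w - z) <= d ->
    modulus (h w - h z - L * (w - z)) <= e * modulus (w - z)) -> 0 <= e ->
  modulus (a - z) + perimeter a b c <= d ->
  modulus (tri h a b c) <= e * d * perimeter a b c.
Proof.
move=> KK Kh Ka Kb Kc He e0 Hd.
pose aff w := h z + L * (w - z).
pose F w := (h z - L * z) * w + L / 2 * (w * w).
have dF w : cdiff F w (aff w).
  have := cdiffD (cdiffM (cdiff_cst (h z - L * z) w) (cdiff_id w))
    (cdiffM (cdiff_cst (L / 2) w) (cdiffM (cdiff_id w) (cdiff_id w))).
  by congr cdiff; rewrite /aff /=; field.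
have caff w : ccont aff w.
  apply: (@cdiff_ccont _ _ _ L).
  have := cdiffD (cdiff_cst (h z) w)
    (cdiffM (cdiff_cst L w) (cdiffB (cdiff_id w) (cdiff_cst z w))).
  by congr cdiff; rewrite /=; ring.
pose r w := h w + (-1) * aff w.
have cr w : K w -> ccont r w.
  by move=> Kw; apply: ccontD; [exact: Kh|apply: ccontZ; exact: caff].
have S x y : K x -> K y -> seg h x y = seg r x y + (F y - F x).
  move=> Kx Ky; rewrite /r segDZ; last 2 first.
  - exact: (convexC_seg Kh).
  - by move=> t _; exact: caff.
  rewrite (@seg_primitive _ aff F); first by ring.
  - by move=> t _; exact: caff.
  - by move=> t _; exact: dF.
have per := perimeter_ge0 a b c.
have B x y : K x -> K y -> modulus (x - z) + modulus (y - x) <= d ->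
    modulus (seg r x y) <= e * d * modulus (y - x).
  move=> Kx Ky xyd; apply: seg_bound; first exact: (convexC_seg cr).
  move=> t t01; have Kt := KK _ _ Kx Ky t t01.
  have tz : modulus (x + t%:C * (y - x) - z) <= d.
    have -> : x + t%:C * (y - x) - z = (x - z) + t%:C * (y - x) by ring.
    apply: le_trans (modulusD _ _) _; rewrite modulusM modulus_real.
    move: t01; rewrite in_itv/= => /andP[t0 t1]; rewrite ger0_norm//.
    have := modulus_ge0 (y - x); nra.
  have := He _ Kt tz.
  have -> : r (x + t%:C * (y - x)) = h (x + t%:C * (y - x)) - h z - L * (x + t%:C * (y - x) - z).
    by rewrite /r /aff; ring.
  by move=> /le_trans; apply; rewrite ler_wpM2l.
have -> : tri h a b c = seg r a b + seg r b c + seg r c a.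
  by rewrite /tri !S//; ring.
have mab := modulus_ge0 (b - a); have mbc := modulus_ge0 (c - b).
have mca := modulus_ge0 (a - c).
move: Hd; rewrite {1}/perimeter => Hd.
have B1 := B a b Ka Kb ltac:(lra).
have B2 := B b c Kb Kc ltac:(have := modulus_triangle a b z; lra).
have B3 := B c a Kc Ka ltac:(have := modulus_triangle b c z; have := modulus_triangle a b z; lra).
apply: le_trans (modulusD _ _) _; apply: le_trans (lerD (modulusD _ _) (lexx _)) _.
by rewrite /perimeter !mulrDr; apply: lerD B3; exact: lerD.
Qed.

Lemma modulus_half z w : z = (2^-1)%:C * w -> modulus z = modulus w / 2.
Proof. by move=> ->; rewrite modulusM modulus_real ger0_norm ?invr_ge0// mulrC. Qed.

Lemma perimeter_half a b c a' b' c' :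
  b' - a' = (2^-1)%:C * (b - a) -> c' - b' = (2^-1)%:C * (c - b) ->
  a' - c' = (2^-1)%:C * (a - c) -> perimeter a' b' c' = perimeter a b c / 2.
Proof.
move=> /modulus_half E1 /modulus_half E2 /modulus_half E3.
by rewrite /perimeter E1 E2 E3; lra.
Qed.

Let half2 : ((2^-1)%:C : C) = 2^-1.
Proof. by rewrite fmorphV rmorph_nat. Qed.

(** One of the four quarter triangles carries at least a quarter of the integral. The bound on the
    displacement of the first vertex makes these vertices converge geometrically under iteration. *)
Lemma goursat_step K h (p : C * C * C) : convexC K -> (forall z, K z -> ccont h z) ->
  K p.1.1 -> K p.1.2 -> K p.2 ->
  exists q : C * C * C, [/\ K q.1.1, K q.1.2, K q.2 &
   [/\ perimeter q.1.1 q.1.2 q.2 = perimeter p.1.1 p.1.2 p.2 / 2,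
    modulus (q.1.1 - p.1.1) <= perimeter p.1.1 p.1.2 p.2 &
    modulus (tri h p.1.1 p.1.2 p.2) <= 4 * modulus (tri h q.1.1 q.1.2 q.2)]].
Proof.
case: p => -[a b] c /= KK Kh Ka Kb Kc.
have Km := convexC_mid KK Ka Kb; have Kk := convexC_mid KK Kb Kc.
have Kn := convexC_mid KK Kc Ka.
have E := tri_split KK Kh Ka Kb Kc.
set t1 := tri h a (mid a b) (mid c a) in E.
set t2 := tri h (mid a b) b (mid b c) in E.
set t3 := tri h (mid c a) (mid b c) c in E.
set t4 := tri h (mid a b) (mid b c) (mid c a) in E.
have mab := modulus_ge0 (b - a); have mbc := modulus_ge0 (c - b).
have mca := modulus_ge0 (a - c).
have Mm : modulus (mid a b - a) = modulus (b - a) / 2 := modulus_mid a b.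
have Mn : modulus (mid c a - a) = modulus (a - c) / 2.
  by rewrite modulusBC; apply: modulus_half; rewrite /mid half2; field.
have [H1|H1] := leP (modulus (tri h a b c)) (4 * modulus t1).
  exists (a, mid a b, mid c a); split => //=; split=> //.
  - by apply: perimeter_half; rewrite /mid half2; field.
  - by rewrite subrr modulus0 perimeter_ge0.
have [H2|H2] := leP (modulus (tri h a b c)) (4 * modulus t2).
  exists (mid a b, b, mid b c); split => //=; split=> //.
  - by apply: perimeter_half; rewrite /mid half2; field.
  - by rewrite /perimeter Mm; clear -mab mbc mca; lra.
have [H3|H3] := leP (modulus (tri h a b c)) (4 * modulus t3).
  exists (mid c a, mid b c, c); split => //=; split=> //.
  - by apply: perimeter_half; rewrite /mid half2; field.
  - by rewrite /perimeter Mn; clear -mab mbc mca; lra.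
have [H4|H4] := leP (modulus (tri h a b c)) (4 * modulus t4).
  exists (mid a b, mid b c, mid c a); split => //=; split=> //.
  - have -> : perimeter a b c = perimeter c a b by rewrite /perimeter; ring.
    rewrite /perimeter.
    have -> : modulus (mid b c - mid a b) = modulus (a - c) / 2.
      by rewrite modulusBC; apply: modulus_half; rewrite /mid half2; field.
    have -> : modulus (mid c a - mid b c) = modulus (b - a) / 2.
      by rewrite modulusBC; apply: modulus_half; rewrite /mid half2; field.
    have -> : modulus (mid a b - mid c a) = modulus (c - b) / 2.
      by rewrite modulusBC; apply: modulus_half; rewrite /mid half2; field.
    by clear; lra.
  - by rewrite /perimeter Mm; clear -mab mbc mca; lra.
suff : modulus (tri h a b c) < modulus (tri h a b c) by rewrite ltxx.
have D : modulus (tri h a b c) <=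
    modulus t1 + modulus t2 + modulus t3 + modulus t4.
  rewrite E; apply: le_trans (modulusD _ _) _; rewrite lerD2r.
  by apply: le_trans (modulusD _ _) _; rewrite lerD2r modulusD.
move: H1 H2 H3 H4 D; move: (modulus t1) (modulus t2) (modulus t3) (modulus t4).
by move: (modulus _) => T m1 m2 m3 m4; lra.
Qed.

Lemma two_pow_unbounded (x : R) : exists n, x < 2 ^+ n.
Proof.
have [n Hn] : exists n : nat, x < n%:R.
  exists (Num.bound `|x|); exact: le_lt_trans (ler_norm x) (archi_boundP (normr_ge0 x)).
exists n; apply: lt_le_trans Hn _.
by rewrite -natrX ler_nat ltnW// ltn_expl.
Qed.

(** A closed convex [K] takes the place of the solid triangle: convexity keeps the bisected
    triangles inside, closedness keeps their limit point. *)
Theorem goursat K h a b c : convexC K -> closedC K ->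
  (forall z, K z -> exists L, cdiff h z L) -> K a -> K b -> K c -> tri h a b c = 0.
Proof.
move=> KK cK dh Ka Kb Kc.
have Kh z : K z -> ccont h z by move=> /dh[L]; exact: cdiff_ccont.
apply/eqP; rewrite -modulus_eq0; apply/negPn/negP => tri0.
have {}tri0 : 0 < modulus (tri h a b c) by rewrite lt_def tri0 modulus_ge0.
pose Kp (p : C * C * C) := [/\ K p.1.1, K p.1.2 & K p.2].
(* The guard [Kp p] gives every triple a successor, as dependent choice requires. *)
pose Q (p q : C * C * C) := Kp p -> Kp q /\
   [/\ perimeter q.1.1 q.1.2 q.2 = perimeter p.1.1 p.1.2 p.2 / 2,
    modulus (q.1.1 - p.1.1) <= perimeter p.1.1 p.1.2 p.2 &
    modulus (tri h p.1.1 p.1.2 p.2) <= 4 * modulus (tri h q.1.1 q.1.2 q.2)].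
have stepQ p : {q | Q p q}.
  apply: cid; have [[K1 K2 K3]|nK] := pselect (Kp p); last by exists p.
  by have [q [L1 L2 L3 Hq]] := goursat_step KK Kh K1 K2 K3; exists q.
have [s [s0 sS]] := dependent_choice stepQ (a, b, c).
have Ks n : Kp (s n).
  by elim: n => [|n IHn]; [rewrite s0; split|have [] := sS n IHn].
pose P0 := perimeter a b c; have P00 : 0 <= P0 := perimeter_ge0 a b c.
pose per n := perimeter (s n).1.1 (s n).1.2 (s n).2.
have perE n : per n = P0 / 2 ^+ n.
  elim: n => [|n IHn]; first by rewrite /per s0 expr0 divr1.
  have [_ [H _ _]] := sS n (Ks n); rewrite /per H -/(per n) IHn exprS invfM.
  by rewrite -mulrA [_^-1 * _]mulrC.
pose J n := modulus (tri h (s n).1.1 (s n).1.2 (s n).2).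
have JE n : modulus (tri h a b c) <= 4 ^+ n * J n.
  elim: n => [|n IHn]; first by rewrite /J s0 expr0 mul1r.
  have [_ [_ _ H]] := sS n (Ks n).
  apply: le_trans IHn _; rewrite exprSr -mulrA ler_wpM2l// exprn_ge0//.
have [|z Hz] := @geometric_limit R (fun n => (s n).1.1) P0.
  by move=> n; rewrite -perE; have [_ []] := sS n (Ks n).
have lim0 (e : R) : 0 < e -> exists n, 3 * P0 / 2 ^+ n < e.
  move=> e0; have [n Hn] := @two_pow_unbounded (3 * P0 / e).
  by exists n; rewrite ltr_pdivrMr ?exprn_gt0// [e * _]mulrC -ltr_pdivrMr.
have Kz : K z.
  apply: cK => e /lim0[n Hn]; exists (s n).1.1; first by have [] := Ks n.
  rewrite modulusBC; apply: le_lt_trans (Hz n) _; apply: le_lt_trans Hn.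
  rewrite ler_wpM2r ?invr_ge0 ?exprn_ge0//; lra.
have [L dL] := dh z Kz.
(* The final estimate is [4^n * e * (3 P0 / 2^n) * (P0 / 2^n) = 3 e P0^2], which this [e] makes
   smaller than the integral; the 1 keeps the denominator positive if [P0 = 0]. *)
pose e := modulus (tri h a b c) / (6 * P0 ^+ 2 + 1).
have P02 : 0 <= P0 ^+ 2 by rewrite sqr_ge0.
have e0 : 0 < e by rewrite divr_gt0//; lra.
have [d d0 Hd] := dL e e0; have [n Hn] := lim0 d d0.
have [K1 K2 K3] := Ks n.
(* [3 P0 / 2^n] is the distance [2 P0 / 2^n] from the first vertex to [z] plus the perimeter
   [P0 / 2^n]. *)
have := @tri_cdiff_bound K h z L _ _ _ e (3 * P0 / 2 ^+ n) KK Kh K1 K2 K3 _ (ltW e0).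
rewrite -/(J n) -/(per n) perE => B.
have {}B : J n <= e * (3 * P0 / 2 ^+ n) * (P0 / 2 ^+ n).
  apply: B.
    by move=> w Kw wz; apply: Hd; apply: le_lt_trans Hn.
  have := Hz n; rewrite modulusBC; lra.
have := JE n; rewrite leNgt => /negP; apply.
apply: le_lt_trans (ler_wpM2l _ B) _; first by rewrite exprn_ge0.
have -> : 4 ^+ n * (e * (3 * P0 / 2 ^+ n) * (P0 / 2 ^+ n)) = 3 * e * P0 ^+ 2.
  have -> : (4 : R) = 2 * 2 by lra.
  rewrite exprMn; field; exact/expf_neq0.
rewrite /e; set T := modulus _ in tri0 *.
have -> : 3 * (T / (6 * P0 ^+ 2 + 1)) * P0 ^+ 2 = T * (3 * P0 ^+ 2) / (6 * P0 ^+ 2 + 1) by ring.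
rewrite ltr_pdivrMr; last lra.
rewrite ltr_pM2l//; lra.
Qed.

End goursat.

(** * Cauchy's theorem for a triangle with an exceptional vertex *)

Section cauchy.
Variable R : realType.
Local Notation C := (Cplx R).
Implicit Types (h F : C -> C) (a b c z w : C).

Lemma cReZ (x : R) z : complex.Re (x%:C * z) = x * complex.Re z.
Proof. by rewrite cReM /= mul0r subr0. Qed.

Let convex_lt (x y r t : R) : 0 <= t -> t <= 1 -> x < r -> y < r ->
  (1 - t) * x + t * y < r.
Proof.
move=> t0 t1 xr yr; have [xy|/ltW xy] := leP x y.
  by apply: le_lt_trans yr; nra.
by apply: le_lt_trans xr; nra.
Qed.

Lemma convexC_disc : convexC (@disc R).
Proof.
move=> a b; rewrite !discE => a1 b1 t; rewrite in_itv/= => /andP[t0 t1].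
rewrite discE.
have -> : a + t%:C * (b - a) = (1 - t)%:C * a + t%:C * b by rewrite rmorphB/=; ring.
apply: le_lt_trans (modulusD _ _) _; rewrite !modulusM !modulus_real !ger0_norm//; last lra.
exact: convex_lt.
Qed.

Lemma convexC_ball c (r : R) : convexC [set z | modulus (z - c) < r].
Proof.
move=> a b /= a1 b1 t; rewrite in_itv/= => /andP[t0 t1] /=.
have -> : a + t%:C * (b - a) - c = (1 - t)%:C * (a - c) + t%:C * (b - c).
  by rewrite rmorphB/=; ring.
apply: le_lt_trans (modulusD _ _) _; rewrite !modulusM !modulus_real !ger0_norm//; last lra.
exact: convex_lt.
Qed.

(** For [r < 1] and [0 < k] this is a closed convex subset of the open disc that misses [p], so
    Goursat's lemma applies on it to functions differentiable away from [p]. *)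
Definition half_disc u p (r k : R) :=
  [set z : C | modulus z <= r /\ k <= complex.Re (u * (z - p))].

Lemma convexC_half_disc u p r k : convexC (half_disc u p r k).
Proof.
move=> a b /= [a1 a2] [b1 b2] t; rewrite in_itv/= => /andP[t0 t1]; split.
  have -> : a + t%:C * (b - a) = (1 - t)%:C * a + t%:C * b by rewrite rmorphB/=; ring.
  apply: le_trans (modulusD _ _) _; rewrite !modulusM !modulus_real !ger0_norm//; last lra.
  nra.
have -> : u * (a + t%:C * (b - a) - p) = (1 - t)%:C * (u * (a - p)) + t%:C * (u * (b - p)).
  by rewrite rmorphB/=; ring.
rewrite cReD !cReZ; nra.
Qed.

Lemma closedC_half_disc u p r k : closedC (half_disc u p r k).
Proof.
move=> z H; split.
  apply/ler_addgt0Pr => e e0; have [w [wr _] wz] := H e e0.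
  have := le_modulusB z w; rewrite modulusBC; lra.
apply/ler_addgt0Pr => e e0; have u0 := modulus_ge0 u.
have [|w [_ wk] wz] := H (e / (modulus u + 1)); first by rewrite divr_gt0//; lra.
move: wz; rewrite ltr_pdivlMr; last lra.
move=> wz.
have := Re_le_modulus (u * (w - z)); rewrite modulusM.
have -> : u * (w - z) = u * (w - p) - u * (z - p) by ring.
rewrite cReD cReN; have := ler_norm (complex.Re (u * (w - p)) - complex.Re (u * (z - p))).
have := modulus_ge0 (w - z); nra.
Qed.

Section vertex.
Variables (h : C -> C) (p u : C).
Hypothesis ch : forall z, disc z -> ccont h z.
Hypothesis dh : forall z, disc z -> z != p -> exists L, cdiff h z L.

Let pos z := 0 < complex.Re (u * (z - p)).

Let mid_pos z : pos z -> pos (mid p z).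
Proof.
rewrite /pos /mid; have -> : u * (p + (2^-1)%:C * (z - p) - p) = (2^-1)%:C * (u * (z - p)) by ring.
by rewrite cReZ => ?; rewrite mulr_gt0// invr_gt0.
Qed.

Lemma mid_sym a b : mid a b = mid b a.
Proof.
by rewrite /mid fmorphV rmorph_nat; field.
Qed.

(** The three quarter triangles that do not touch [p] lie in a half disc missing [p], and their
    integrals vanish. *)
Lemma tri_vertex_half b c : disc p -> disc b -> disc c -> pos b -> pos c ->
  tri h p b c = tri h p (mid p b) (mid p c).
Proof.
move=> Dp Db Dc bp cp.
have Dm z : disc z -> disc (mid p z) by move=> Dz; apply: (convexC_mid convexC_disc).
have Mb := mid_pos bp; have Mc := mid_pos cp.
pose r := Num.max (modulus p) (Num.max (modulus b) (modulus c)).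
(* The midpoints on the two sides through [p] are the vertices nearest to the line through [p], so
   their smaller height bounds all others. *)
pose k := Num.min (complex.Re (u * (mid p b - p))) (complex.Re (u * (mid p c - p))).
have k0 : 0 < k by rewrite lt_min; apply/andP; split.
have r1 : r < 1 by move: Dp Db Dc; rewrite !discE !gt_max => -> -> ->.
pose K := half_disc u p r k.
have Kdisc z : K z -> disc z /\ z != p.
  move=> [z1 z2]; split; first by rewrite discE (le_lt_trans z1).
  by apply: contraTneq (lt_le_trans k0 z2) => ->; rewrite subrr mulr0 ltxx.
have Kin z : disc z -> modulus z <= r -> k <= complex.Re (u * (z - p)) -> K z by [].
have pm z : complex.Re (u * (mid p z - p)) = complex.Re (u * (z - p)) / 2.
  rewrite /mid; have -> : u * (p + (2^-1)%:C * (z - p) - p) = (2^-1)%:C * (u * (z - p)) by ring.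
  by rewrite cReZ mulrC.
have kb : k <= complex.Re (u * (b - p)) / 2 by rewrite -pm /k ge_min lexx.
have kc : k <= complex.Re (u * (c - p)) / 2 by rewrite -pm /k ge_min lexx orbT.
have pr : modulus p <= r by rewrite le_max lexx.
have br : modulus b <= r by rewrite !le_max lexx orbT.
have cr : modulus c <= r by rewrite !le_max lexx !orbT.
have mr x y : modulus x <= r -> modulus y <= r -> modulus (mid x y) <= r.
  move=> xr yr; have -> : mid x y = (2^-1)%:C * (x + y).
    by rewrite /mid fmorphV rmorph_nat; field.
  rewrite modulusM modulus_real ger0_norm ?invr_ge0//.
  have := modulusD x y; lra.
have Kb : K b by split => //; lra.
have Kc : K c by split => //; lra.
have KM : K (mid p b) by split; [exact: mr|rewrite pm].
have KN : K (mid p c) by split; [exact: mr|rewrite pm].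
have KP : K (mid b c) by exact: (convexC_mid (@convexC_half_disc _ _ _ _)).
have G x y z : K x -> K y -> K z -> tri h x y z = 0.
  apply: goursat; [exact: convexC_half_disc|exact: closedC_half_disc|].
  by move=> t /Kdisc[]; exact: dh.
rewrite (tri_split convexC_disc ch Dp Db Dc) [mid c p]mid_sym.
by rewrite (G (mid p b) b)// (G (mid p c) _ c)// (G (mid p b) (mid b c))// !addr0.
Qed.

(** Halving repeatedly shrinks the triangle to [p] without changing the integral. Near [p]
    continuity bounds [h] by [|h p| + 1], so the integral is at most a multiple of a perimeter
    tending to 0. *)
Lemma tri_vertex b c : disc p -> disc b -> disc c -> pos b -> pos c ->
  tri h p b c = 0.
Proof.
move=> Dp Db Dc bp cp.
pose bs := fun n => iter n (mid p) b; pose cs := fun n => iter n (mid p) c.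
have Ds z n : disc z -> disc (iter n (mid p) z).
  by move=> Dz; elim: n => //= n IHn; apply: (convexC_mid convexC_disc).
have Ps z n : pos z -> pos (iter n (mid p) z).
  by move=> Dz; elim: n => //= n IHn; exact: mid_pos.
have E n : tri h p b c = tri h p (bs n) (cs n).
  elim: n => // n ->; rewrite tri_vertex_half//; [exact: Ds|exact: Ds|exact: Ps|exact: Ps].
have dist z n : modulus (iter n (mid p) z - p) = modulus (z - p) / 2 ^+ n.
  elim: n => [|n IHn]; first by rewrite expr0 divr1.
  by rewrite iterS modulus_mid IHn exprSr invfM mulrA.
apply/eqP; rewrite -modulus_eq0; apply/negPn/negP => tri0.
have {}tri0 : 0 < modulus (tri h p b c) by rewrite lt_def tri0 modulus_ge0.
have [d d0 Hd] := ch Dp ltr01.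
pose A := modulus (h p) + 1; have A0 : 0 < A by rewrite ltr_wpDl ?modulus_ge0.
pose e := Num.min d (modulus (tri h p b c) / (5 * A)).
have e0 : 0 < e by rewrite lt_min d0 divr_gt0// mulr_gt0.
have [n Hn] := @two_pow_unbounded R ((modulus (b - p) + modulus (c - p)) / e).
have p2 : (0 : R) < 2 ^+ n by rewrite exprn_gt0.
have {}Hn : modulus (bs n - p) + modulus (cs n - p) < e.
  by rewrite /bs /cs !dist -mulrDl ltr_pdivrMr// [e * _]mulrC -ltr_pdivrMr.
have bd : modulus (bs n - p) < e by have := modulus_ge0 (cs n - p); lra.
have cd : modulus (cs n - p) < e by have := modulus_ge0 (bs n - p); lra.
have ed : e <= d by rewrite ge_min lexx.
have et : e * (5 * A) <= modulus (tri h p b c).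
  by rewrite -ler_pdivlMr ?mulr_gt0// ge_min lexx orbT.
have S x y : disc x -> disc y -> modulus (x - p) < e -> modulus (y - p) < e ->
    modulus (seg h x y) <= A * modulus (y - x).
  move=> Dx Dy xe ye; apply: seg_bound; first exact: (convexC_seg ch convexC_disc).
  apply: (@convexC_seg _ [set z | modulus (z - p) < e]) => //; last exact: convexC_ball.
  move=> z /= ze; have := Hd z (lt_le_trans ze ed).
  have := le_modulusB (h z) (h p); rewrite /A; lra.
have Dbs : disc (bs n) := Ds _ n Db; have Dcs : disc (cs n) := Ds _ n Dc.
have pe : modulus (p - p) < e by rewrite subrr modulus0.
have B1 := S _ _ Dp Dbs pe bd; have B2 := S _ _ Dbs Dcs bd cd.
have B3 := S _ _ Dcs Dp cd pe.
have B4 := modulus_triangle p (cs n) (bs n).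
suff : modulus (tri h p b c) < modulus (tri h p b c) by rewrite ltxx.
rewrite {1}(E n) {E}; apply: lt_le_trans et.
apply: le_lt_trans (modulusD _ _) _; apply: le_lt_trans (lerD (modulusD _ _) (lexx _)) _.
apply: le_lt_trans (lerD (lerD B1 B2) B3) _.
rewrite [modulus (p - cs n)]modulusBC; rewrite [modulus (p - bs n)]modulusBC in B4.
move: bd cd B4 Hn; move: (modulus (bs n - p)) (modulus (cs n - bs n)) (modulus (cs n - p)).
move=> x y z; clear -A0 e0; nra.
Qed.

End vertex.
End cauchy.

(** * Cauchy's formula on a square *)

Section square.
Variable R : realType.
Local Notation C := (Cplx R).
Implicit Types (h F : C -> C) (a b c z w : C).

Let im : C := 0 +i* 1.

Let im2 : im * im = -1.
Proof. by apply/eqP; rewrite eq_complex /=; apply/andP; split; apply/eqP; ring. Qed.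

Let im0 : im != 0.
Proof. by rewrite eq_complex /= oner_eq0 andbF. Qed.

Let im1 : modulus im = 1.
Proof.
apply/eqP; rewrite -(eqrXn2 (n := 2)) ?modulus_ge0 ?ler01//.
by rewrite modulus_sqr expr0n add0r.
Qed.

(** Vertices of the square. A square keeps the contour a union of segments, and multiplication by
    [im] permutes its sides. *)
Let v n : C := (3 / 4 : R)%:C * im ^+ n.

Let vS n : v n.+1 = im * v n.
Proof. by rewrite /v exprS mulrCA. Qed.

Let v4 : v 4%N = v 0%N.
Proof.
rewrite /v; have -> : im ^+ 4%N = (im * im) ^+ 2 by ring.
by rewrite im2 sqrrN expr1n expr0.
Qed.

Let Dv n : disc (v n).
Proof.
rewrite discE modulusM modulusX im1 expr1n mulr1 modulus_real ger0_norm; lra.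
Qed.

Definition square_int h : C :=
  seg h (v 0%N) (v 1%N) + seg h (v 1%N) (v 2%N) + seg h (v 2%N) (v 3%N) + seg h (v 3%N) (v 0%N).

Let side (P : C -> Prop) := forall n, on_segment P (v n) (v n.+1).

(* [normal n] is the conjugate of a normal vector to the n-th side *)
Let normal n : C := (1 - im) * (- im) ^+ n.

Let normalv n : normal n * v n = (3 / 4 : R)%:C * (1 - im).
Proof.
rewrite /normal /v; have -> : (1 - im) * (- im) ^+ n * ((3 / 4)%:C * im ^+ n) =
  (3 / 4)%:C * (1 - im) * ((- im * im) ^+ n) by rewrite exprMn; ring.
by rewrite mulNr im2 opprK expr1n mulr1.
Qed.

Let normalvS n : normal n * v n.+1 = (3 / 4 : R)%:C * (1 + im).
Proof.
by rewrite vS mulrCA normalv mulrCA mulrBr mulr1 im2 opprK [im + 1]addrC.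
Qed.

Let modulus_normal n : modulus (normal n) <= 3 / 2.
Proof.
rewrite modulusM modulusX modulusN im1 expr1n mulr1.
rewrite -(ler_pXn2r (n := 2)) ?nnegrE ?modulus_ge0 ?divr_ge0//.
rewrite modulus_sqrE /=; lra.
Qed.

Let side_normal n (t : R) :
  complex.Re (normal n * (v n + t%:C * (v n.+1 - v n))) = 3 / 4.
Proof.
have -> : normal n * (v n + t%:C * (v n.+1 - v n)) =
  normal n * v n + t%:C * (normal n * v n.+1 - normal n * v n).
  by move: (normal n) (v n) (v n.+1) => x y z; ring.
rewrite normalvS normalv -mulrBr mulrCA -mulrDr cReZ.
have -> : 1 - im + t%:C * (1 + im - (1 - im)) = 1 - im + (2 * t)%:C * im.
  have G (i x y : C) : y = 2 * x -> 1 - i + x * (1 + i - (1 - i)) = 1 - i + y * i.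
    by move=> ->; ring.
  by apply: G; rewrite rmorphM rmorph_nat.
by rewrite cReD cReZ /=; lra.
Qed.

Let Re_normal n w : modulus w <= 1 / 4 -> complex.Re (normal n * w) <= 3 / 8.
Proof.
move=> w4; apply: le_trans (ler_norm _) _; apply: le_trans (Re_le_modulus _) _.
rewrite modulusM; have := modulus_normal n; have := modulus_ge0 (normal n).
have := modulus_ge0 w; nra.
Qed.

(** On the side [Re (normal z) = 3 / 4], while [Re (normal w) <= 3 / 8]; the gap divided by
    [|normal| <= 3 / 2] is [1 / 4]. *)
Let side_dist w : modulus w <= 1 / 4 -> side (fun z => 1 / 4 <= modulus (z - w)).
Proof.
move=> w4 n t t01; have := Re_normal n w4; have := side_normal n t.
set z := _ + _; have := Re_le_modulus (normal n * (z - w)).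
rewrite mulrBr cReD cReN -mulrBr modulusM.
have := ler_norm (complex.Re (normal n * z) - complex.Re (normal n * w)).
have := modulus_normal n; have := modulus_ge0 (normal n).
have := modulus_ge0 (z - w); nra.
Qed.

Let side_disc : side disc.
Proof. by move=> n; apply: convexC_disc; exact: Dv. Qed.

Let side_vS h : side (ccont h) -> on_segment (ccont h) (v 3%N) (v 0%N).
Proof. by move=> /(_ 3%N); rewrite v4. Qed.

Lemma square_intDZ h1 h2 c : side (ccont h1) -> side (ccont h2) ->
  square_int (fun z => h1 z + c * h2 z) = square_int h1 + c * square_int h2.
Proof.
move=> c1 c2; rewrite /square_int !segDZ//; try exact: side_vS.
move: (seg h1 _ _) (seg h1 _ _) (seg h1 _ _) (seg h1 _ _) => x1 x2 x3 x4.
move: (seg h2 _ _) (seg h2 _ _) (seg h2 _ _) (seg h2 _ _) => y1 y2 y3 y4.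
ring.
Qed.

Lemma eq_square_int h1 h2 : side (ccont h1) -> side (ccont h2) ->
  side (fun z => h1 z = h2 z) -> square_int h1 = square_int h2.
Proof.
move=> c1 c2 e; rewrite /square_int !(eq_seg (c1 _) (c2 _) (e _)).
by rewrite (eq_seg (side_vS c1) (side_vS c2))//; have := e 3%N; rewrite v4.
Qed.

Lemma square_int_bound h (K : R) : side (ccont h) -> side (fun z => modulus (h z) <= K) ->
  modulus (square_int h) <= 6 * K.
Proof.
move=> ch hK.
have K0 : 0 <= K.
  by apply: le_trans (hK 0%N 0 _); rewrite ?modulus_ge0// in_itv/= lexx ler01.
have B n : modulus (seg h (v n) (v n.+1)) <= K * (3 / 2).
  apply: le_trans (seg_bound (ch n) (hK n)) _; rewrite ler_wpM2l//.
  apply: le_trans (modulusB_le _ _) _.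
  by rewrite !modulusM !modulusX im1 !expr1n !mulr1 modulus_real ger0_norm; lra.
have := B 3%N; rewrite v4 /square_int => B3.
have B0 := B 0%N; have B1 := B 1%N; have B2 := B 2%N.
apply: le_trans (modulusD _ _) _; apply: le_trans (lerD (modulusD _ _) (lexx _)) _.
apply: le_trans (lerD (lerD (modulusD _ _) (lexx _)) (lexx _)) _.
move: B0 B1 B2 B3; move: (modulus _) (modulus _) (modulus _) (modulus _) => x y z t; lra.
Qed.

Lemma square_int_tri h w : disc w -> (forall z, disc z -> ccont h z) ->
  square_int h = tri h w (v 0%N) (v 1%N) + tri h w (v 1%N) (v 2%N) +
    tri h w (v 2%N) (v 3%N) + tri h w (v 3%N) (v 0%N).
Proof.
move=> Dw ch; rewrite /square_int /tri.
have S n : seg h (v n) w = - seg h w (v n).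
  by apply: seg_rev; exact: (convexC_seg ch (@convexC_disc R)).
by rewrite !S; move: (seg h) => s; ring.
Qed.

(** The contour splits into the triangles with apex [w] over the four sides. Each side lies strictly
    to one side of the line through [w] perpendicular to its normal, so [tri_vertex] applies with
    exceptional vertex [w]. *)
Lemma square_int_eq0 h w : modulus w <= 1 / 4 -> (forall z, disc z -> ccont h z) ->
  (forall z, disc z -> z != w -> exists L, cdiff h z L) -> square_int h = 0.
Proof.
move=> w4 ch dh; have Dw : disc w by rewrite discE; lra.
have T n : tri h w (v n) (v n.+1) = 0.
  have P (b : R) : b = 3 / 4 -> 0 < b - complex.Re (normal n * w).
    by have := Re_normal n w4; lra.
  apply: (@tri_vertex _ h w (normal n)) => //.
  - by rewrite mulrBr cReD cReN normalv cReZ /=; apply: P; lra.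
  - by rewrite mulrBr cReD cReN normalvS cReZ /=; apply: P; lra.
by rewrite (square_int_tri Dw ch) -{2}v4 !T !addr0.
Qed.

Lemma cdiff_inv z : z != 0 -> cdiff (fun z => z^-1) z (- (z * z)^-1).
Proof.
move=> z0 e e0; have mz : 0 < modulus z by rewrite modulus_gt0.
exists (Num.min (modulus z / 2) (e * modulus z ^+ 3 / 2)).
  by rewrite lt_min !divr_gt0// mulr_gt0// exprn_gt0.
move=> w; rewrite lt_min => /andP[wz1 wz2].
have wz : modulus z / 2 <= modulus w.
  by have := le_modulusB z w; rewrite modulusBC; lra.
have w0 : w != 0 by rewrite -modulus_gt0; lra.
have -> : w^-1 - z^-1 - - (z * z)^-1 * (w - z) = (w - z) * (w - z) * ((z * z)^-1 * w^-1).
  by field; rewrite z0 w0.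
rewrite !modulusM !modulusV modulusM -mulrA [leRHS]mulrC ler_wpM2l ?modulus_ge0//.
rewrite -invfM ler_pdivrMr; last by rewrite !mulr_gt0//; lra.
have mz2 : 0 < modulus z * modulus z by rewrite mulr_gt0.
have := ler_wpM2l (ltW mz2) wz.
rewrite !exprS expr0 in wz2.
nra.
Qed.

Lemma cdiff_inv_shift w z : z != w -> cdiff (fun z => (z - w)^-1) z (- ((z - w) * (z - w))^-1).
Proof.
move=> zw; have zw0 : z - w != 0 by rewrite subr_eq0.
have := cdiff_comp (cdiffB (cdiff_id z) (cdiff_cst w z)) (cdiff_inv zw0).
by rewrite subr0 mulr1.
Qed.

Let dist_neq z w : 1 / 4 <= modulus (z - w) -> z != w.
Proof. by move=> H; rewrite -subr_eq0 -modulus_gt0; lra. Qed.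

Let side_inv w : modulus w <= 1 / 4 -> side (ccont (fun z => (z - w)^-1)).
Proof.
move=> w4 n t t01; apply: cdiff_ccont; apply: cdiff_inv_shift.
by apply: dist_neq; exact: side_dist.
Qed.

(* The integral of [1 / (z - w)] is not evaluated: that it is a nonzero constant
   up to O(w^2) is enough for the next lemma. *)
Lemma cauchy_square F w : modulus w <= 1 / 4 ->
  (forall z, disc z -> exists L, cdiff F z L) ->
  square_int (fun z => F z * (z - w)^-1) = F w * square_int (fun z => (z - w)^-1).
Proof.
move=> w4 dF; have Dw : disc w by rewrite discE; lra.
have cF z : disc z -> ccont F z by move=> /dF[L]; exact: cdiff_ccont.
have [L dL] := dF w Dw.
(* The difference quotient, completed by the derivative at [w], is continuous on the disc and
   differentiable off [w]. *)
pose h z := if z == w then L else (F z - F w) * (z - w)^-1.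
have dh z : disc z -> z != w -> exists L, cdiff h z L.
  move=> Dz zw; have [M dM] := dF z Dz.
  eexists; apply: cdiff_ext; last first.
    exact: (cdiffM (cdiffB dM (cdiff_cst (F w) z)) (cdiff_inv_shift zw)).
  exists (modulus (z - w)); first by rewrite modulus_gt0 subr_eq0.
  move=> y yz; rewrite /h; case: eqP => // yw.
  by move: yz; rewrite yw modulusBC ltxx.
have ch z : disc z -> ccont h z.
  move=> Dz; have [->|zw] := eqVneq z w; last first.
    by have [M] := dh z Dz zw; exact: cdiff_ccont.
  move=> e e0; have [d d0 Hd] := dL (e / 2) (divr_gt0 e0 (ltr0Sn _ 1)).
  exists d => // y yd; rewrite /h eqxx; case: eqVneq => yw.
    by rewrite subrr modulus0.
  have yw0 : y - w != 0 by rewrite subr_eq0.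
  have -> : (F y - F w) * (y - w)^-1 - L = (F y - F w - L * (y - w)) * (y - w)^-1 by field.
  rewrite modulusM modulusV ltr_pdivrMr ?modulus_gt0//.
  apply: le_lt_trans (Hd y yd) _; rewrite ltr_pM2r ?modulus_gt0//; lra.
have cFk : side (ccont (fun z => F z * (z - w)^-1)).
  by move=> n t t01; apply: ccontM; [exact/cF/side_disc|exact: side_inv].
have S := square_int_eq0 w4 ch dh.
have := @eq_square_int (fun z => F z * (z - w)^-1 + (- F w) * (z - w)^-1) h.
rewrite S square_intDZ//; last exact: side_inv.
rewrite mulNr => E; apply/eqP; rewrite -subr_eq0; apply/eqP; apply: E.
- by move=> n t t01; apply: ccontD; [exact: cFk|apply: ccontZ; exact: side_inv].
- by move=> n t t01; exact/ch/side_disc.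
- move=> n t t01; rewrite /h; have /negPf -> := dist_neq (@side_dist w w4 n t t01).
  by rewrite mulrBl mulNr.
Qed.

Let seg_inv_rot a b : seg (fun z => z^-1) (im * a) (im * b) = seg (fun z => z^-1) a b.
Proof.
rewrite /seg; congr cintegral01; apply/funext => t.
have -> : im * a + t%:C * (im * b - im * a) = im * (a + t%:C * (b - a)) by ring.
by rewrite invfM -mulrBr mulrACA divff// mul1r.
Qed.

Lemma segZ h c a b : on_segment (ccont h) a b -> seg (fun z => c * h z) a b = c * seg h a b.
Proof.
move=> ch; have c0 : on_segment (ccont (fun=> 0 : C)) a b by move=> t _; exact: ccont_cst.
have := segDZ c c0 ch; have -> : (fun z => 0 + c * h z) = (fun z => c * h z).
  by apply/funext => z; rewrite add0r.
move=> ->; suff -> : seg (fun=> 0 : C) a b = 0 by rewrite add0r.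
rewrite (@seg_primitive _ _ (fun=> 0))//; first by rewrite subrr.
by move=> t _; exact: cdiff_cst.
Qed.

Let modulus0_le : modulus (0 : C) <= 1 / 4.
Proof. by rewrite modulus0; lra. Qed.

Let side_neq0 : side (fun z => z != 0).
Proof. by move=> n t t01; apply: dist_neq; apply: side_dist. Qed.

Let side_inv0 : side (ccont (fun z => z^-1)).
Proof. by move=> n t t01; apply: cdiff_ccont; apply: cdiff_inv; exact: side_neq0. Qed.

Let side_inv2 : side (ccont (fun z => z^-1 * z^-1)).
Proof. by move=> n t t01; apply: ccontM; exact: side_inv0. Qed.

(** Rotation by [im] multiplies the integral over a side by [j = 1 / im], and
    [1 + j + j^2 + j^3 = 0]. *)
Let square_inv2 : square_int (fun z => z^-1 * z^-1) = 0.
Proof.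
have E n : seg (fun z => z^-1 * z^-1) (v n.+1) (v n.+2) =
    im^-1 * seg (fun z => z^-1 * z^-1) (v n) (v n.+1).
  rewrite -segZ; last exact: side_inv2.
  rewrite /seg !vS; congr cintegral01; apply/funext => t.
  have -> : im * v n + t%:C * (im * (im * v n) - im * v n) =
    im * (v n + t%:C * (im * v n - v n)) by ring.
  rewrite !invfM -mulrBr; move: (_ + _)^-1 => x.
  have : im * im^-1 = 1 by rewrite divff.
  move: (im^-1) (im) (v n) => j i y ij.
  by rewrite -[RHS]mul1r -ij; ring.
rewrite /square_int -{2}v4 !E.
have im2' : im^-1 * im^-1 = -1 by rewrite -invfM im2 invrN1.
move: im2'; move: (im^-1) (seg _ _ _) => j s j2.
have -> : 0 = (1 + j * j) * (1 + j) * s by rewrite j2 addrN !mul0r.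
ring.
Qed.

(** The form [dz / z] is invariant under rotation, so all four sides contribute equally. On the
    first side the imaginary part of the antiderivative has a positive derivative, and the mean
    value theorem excludes a zero increment. *)
Let square_inv_neq0 : square_int (fun z => z^-1) != 0.
Proof.
have E n : seg (fun z => z^-1) (v n.+1) (v n.+2) = seg (fun z => z^-1) (v n) (v n.+1).
  by rewrite [v n.+2]vS [v n.+1]vS seg_inv_rot.
have S4 : square_int (fun z => z^-1) = 4 * seg (fun z => z^-1) (v 0%N) (v 1%N).
  by rewrite /square_int -{2}v4 !E; move: (seg _ _ _) => s; ring.
rewrite S4 mulf_neq0// ?pnatr_eq0//.
have [W dW ->] := seg_antiderivative (@side_inv0 0%N).
have dI (t : R) : t \in `[0, 1] -> is_derive t 1 (fun s => complex.Re ((- im) * W s))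
    (((1 - t) ^+ 2 + t ^+ 2)^-1).
  move=> t01; have := rdiff_Re (- im) (dW t t01); congr is_derive.
  have -> : v 1%N - v 0%N = (3 / 4 : R)%:C * (im - 1) by rewrite /v expr0 expr1; ring.
  have -> : v 0%N + t%:C * ((3 / 4 : R)%:C * (im - 1)) =
    (3 / 4 : R)%:C * ((1 - t) +i* t).
    have -> : (1 - t) +i* t = 1 + t%:C * (im - 1).
      by apply/eqP; rewrite eq_complex /=; apply/andP; split; apply/eqP; ring.
    rewrite /v expr0; ring.
  have n0 : ((3 / 4 : R)%:C : C) != 0.
    by rewrite -modulus_gt0 modulus_real ger0_norm; lra.
  rewrite invfM mulrACA divff// mul1r.
  set D := (1 - t) ^+ 2 + t ^+ 2.
  have D0 : 0 < D by rewrite /D; nra.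
  (* [q] is the conjugate of [z] times [im - 1], so that [(im - 1) / z = q / D]. *)
  pose z : C := (1 - t) +i* t; pose q : C := (2 * t - 1) +i* 1.
  have zq : z * q = D%:C * (im - 1).
    by apply/eqP; rewrite eq_complex /=; apply/andP; split; apply/eqP; rewrite /D; ring.
  have z0 : z != 0.
    rewrite -modulus_gt0 -(ltr_pXn2r (n := 2)) ?nnegrE ?modulus_ge0//.
    by rewrite expr0n modulus_sqrE.
  have DC : (D%:C : C) != 0 by rewrite -modulus_gt0 modulus_real normr_gt0 gt_eqF.
  have -> : (im - 1) * z^-1 = (D^-1)%:C * q.
    by rewrite fmorphV; apply: (mulfI DC); rewrite mulrA -zq; field; rewrite z0 DC.
  by rewrite mulrCA cReZ /=; ring.
have c1 : {within `[0, 1], continuous (fun s => complex.Re ((- im) * W s))}.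
  by apply: derivable_within_continuous => t /dI[].
have dIo (t : R) : t \in `]0, 1[ -> is_derive t 1 (fun s => complex.Re ((- im) * W s))
    (((1 - t) ^+ 2 + t ^+ 2)^-1).
  by move=> t01; apply: dI; exact: subset_itv_oo_cc t01.
have [t _ E1] := MVT_segment ler01 dIo c1.
apply/eqP => W0; move: E1; rewrite -cReN -cReD -mulrBr W0 mulr0 subr0 mulr1 => /esym/eqP.
by rewrite invr_eq0 gt_eqF//; nra.
Qed.

(** The point is that [K] is uniform in [F]: derivative bounds, continuity of derivatives and
    Montel's theorem all follow by comparing or passing to the limit in this estimate. *)
Lemma quantitative_differentiability0 : exists2 K : R, 0 < K & forall F (M : R),
  (forall z, disc z -> exists L, cdiff F z L) ->
  (forall z, disc z -> modulus (F z) <= M) ->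
  exists L, forall w, modulus w <= 1 / 4 ->
    modulus (F w - F 0 - L * w) <= K * M * modulus w ^+ 2.
Proof.
pose c0 := square_int (fun z => z^-1); have c00 : c0 != 0 := square_inv_neq0.
have mc0 : 0 < modulus c0 by rewrite modulus_gt0.
(* The kernel remainders for [F] and for the constant 1, the latter multiplied by [F w], contribute
   [384 M] each. *)
exists (768 / modulus c0); first by apply: divr_gt0; [lra|exact: mc0].
move=> F M dF FM.
have cF z : disc z -> ccont F z by move=> /dF[L]; exact: cdiff_ccont.
have M0 : 0 <= M by apply: le_trans (FM _ (Dv 0%N)); exact: modulus_ge0.
(* Expansion of the Cauchy kernel:
   [1 / (z - w) = 1 / z + w / z^2 + w^2 / (z^2 (z - w))] *)
have expand G (N : R) w : (forall z, disc z -> ccont G z) ->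
    (forall z, disc z -> modulus (G z) <= N) -> modulus w <= 1 / 4 ->
    exists2 e, modulus e <= 384 * N & square_int (fun z => G z * (z - w)^-1) =
      square_int (fun z => G z * z^-1) + w * square_int (fun z => G z * (z^-1 * z^-1))
       + (w * w) * e.
  move=> cG GN w4.
  have sG : side (ccont G) by move=> n t t01; exact/cG/side_disc.
  pose k z := G z * (z^-1 * z^-1 * (z - w)^-1).
  have ck : side (ccont k).
    move=> n t t01; apply: ccontM; first exact: sG.
    by apply: ccontM; [exact: side_inv2|exact: side_inv].
  exists (square_int k).
    (* [64 = 4^3], since [|z|] and [|z - w|] are at least [1 / 4] on the sides. *)
    apply: le_trans (square_int_bound (K := 64 * N) ck _) _; last by lra.
    move=> n t t01; rewrite !modulusM !modulusV [leRHS]mulrC.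
    have := @side_dist 0 modulus0_le n t t01; have := @side_dist w w4 n t t01.
    have := GN _ (@side_disc n t t01); rewrite subr0; set z := _ + _ => h1 h2 h3.
    have inv4 (x : R) : 1 / 4 <= x -> 0 <= x^-1 /\ x^-1 <= 4.
      move=> x4; have x0 : 0 < x by lra.
      split; first by rewrite invr_ge0 ltW.
      by rewrite invf_ple ?posrE//; lra.
    have [p1 p2] := inv4 _ h3; have [q1 q2] := inv4 _ h2.
    apply: ler_pM => //; [exact: modulus_ge0|by rewrite !mulr_ge0|].
    have -> : (64 : R) = 4 * 4 * 4 by lra.
    by apply: ler_pM => //; [exact: mulr_ge0|exact: ler_pM].
  have c1 : side (ccont (fun z => G z * z^-1)).
    by move=> n t t01; apply: ccontM; [exact: sG|exact: side_inv0].
  have c2 : side (ccont (fun z => G z * (z^-1 * z^-1))).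
    by move=> n t t01; apply: ccontM; [exact: sG|exact: side_inv2].
  have c3 : side (ccont (fun z => G z * z^-1 + w * (G z * (z^-1 * z^-1)))).
    by move=> n t t01; apply: ccontD; [exact: c1|apply: ccontZ; exact: c2].
  rewrite -square_intDZ// -square_intDZ//; apply: eq_square_int.
  - by move=> n t t01; apply: ccontM; [exact: sG|exact: side_inv].
  - by move=> n t t01; apply: ccontD; [exact: c3|apply: ccontZ; exact: ck].
  - move=> n t t01; have zw := dist_neq (@side_dist w w4 n t t01).
    have z0 := @side_neq0 n t t01; rewrite /k; set z := _ + _ in zw z0 *.
    have zw0 : z - w != 0 by rewrite subr_eq0.
    by field; rewrite ?z0 ?zw0.
pose A1 := square_int (fun z => F z * (z^-1 * z^-1)).
exists (A1 / c0) => w w4.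
have [e he E] := expand F M w cF FM w4.
have one_ct z : disc z -> ccont (fun=> 1 : C) z by move=> _; exact: ccont_cst.
have one1 z : disc z -> modulus (1 : C) <= 1 by rewrite modulus1.
(* The same expansion for the constant 1 compares the integral of [1 / (z - w)] with [c0]; its first
   order term is zero by [square_inv2]. *)
have [e' he' E'] := expand (fun=> 1) 1 w one_ct one1 w4.
have mul1 h : (fun z => 1 * h z) = h by apply/funext => z; rewrite mul1r.
rewrite !mul1 square_inv2 mulr0 addr0 -/c0 in E'.
rewrite (cauchy_square w4 dF) E' in E.
have := cauchy_square modulus0_le dF.
have sub0 : (fun z : C => (z - 0)^-1) = (fun z => z^-1) by apply/funext => z; rewrite subr0.
have sub0' : (fun z : C => F z * (z - 0)^-1) = (fun z => F z * z^-1) by apply/funext => z; rewrite subr0.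
rewrite sub0 sub0' -/c0 => E0; rewrite E0 -/A1 in E.
have -> : F w - F 0 - A1 / c0 * w = c0^-1 * ((w * w) * (e - F w * e')).
  apply: (mulfI c00); rewrite [RHS]mulrA divff// mul1r.
  have -> : w * w * (e - F w * e') = w * w * e - F w * (c0 + w * w * e') + F w * c0 by ring.
  by rewrite E; field.
have Dw : disc w by rewrite discE; lra.
have ee : modulus (e - F w * e') <= 768 * M.
  apply: le_trans (modulusB_le _ _) _; rewrite modulusM.
  have := FM w Dw; have := modulus_ge0 (F w); have := modulus_ge0 e'; nra.
rewrite !modulusM modulusV -expr2 [leRHS]mulrAC.
have -> : 768 / modulus c0 * modulus w ^+ 2 * M =
  (modulus c0)^-1 * (modulus w ^+ 2 * (768 * M)) by ring.
by rewrite ler_wpM2l ?invr_ge0 ?modulus_ge0// ler_wpM2l ?sqr_ge0.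
Qed.

End square.

(** * Bounded analytic functions *)

Section bounded_analytic.
Variable R : realType.
Local Notation C := (Cplx R).
Implicit Types (f F : C -> C) (a b c z w : C).

Definition analytic_ball (M : R) F : Prop :=
  analytic disc F /\ forall z, disc z -> modulus (F z) <= M.

Lemma analytic_cdiff F z : analytic disc F -> disc z -> cdiff F z (derive1 F z).
Proof. by move=> aF Dz; apply: derivable_cdiff; exact: aF. Qed.

Lemma analytic_ccont F z : analytic disc F -> disc z -> ccont F z.
Proof. by move=> aF Dz; apply: cdiff_ccont; exact: analytic_cdiff. Qed.

Lemma disc0 : @disc R 0.
Proof. by rewrite discE modulus0. Qed.

Lemma analytic_ball_ge0 M F : analytic_ball M F -> 0 <= M.
Proof. by move=> [_ FM]; apply: le_trans (FM 0 disc0); exact: modulus_ge0. Qed.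

(** The estimate at 0 is rescaled to the disc of radius [1 - |a|] about [a], which lies in the unit
    disc. *)
Lemma quantitative_differentiability : exists2 K : R, 0 < K & forall F M,
  analytic_ball M F -> forall a w, disc a -> modulus (w - a) <= (1 - modulus a) / 4 ->
  modulus (F w - F a - derive1 F a * (w - a)) <=
    K * M * (modulus (w - a) / (1 - modulus a)) ^+ 2.
Proof.
have [K K0 HK] := @quantitative_differentiability0 R; exists K => // F M FM a w Da wa.
have M0 := analytic_ball_ge0 FM; move: FM => [aF FM].
pose r := 1 - modulus a; have r0 : 0 < r by move: Da; rewrite discE /r; lra.
have rC : (r%:C : C) != 0 by rewrite -modulus_gt0 modulus_real normr_gt0 gt_eqF.
have Dr z : disc z -> disc (a + r%:C * z).
  rewrite !discE => z1; apply: le_lt_trans (modulusD _ _) _.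
  rewrite modulusM modulus_real gtr0_norm//; have := modulus_ge0 z; rewrite /r in r0 *; nra.
pose G z := F (a + r%:C * z).
have [L HL] : exists L, forall w, modulus w <= 1 / 4 ->
    modulus (G w - G 0 - L * w) <= K * M * modulus w ^+ 2.
  apply: HK => z Dz; last exact/FM/Dr.
  eexists; apply: (@cdiff_comp _ (fun z => a + r%:C * z) F).
    exact: (cdiffD (cdiff_cst a z) (cdiffM (cdiff_cst r%:C z) (cdiff_id z))).
  exact: (analytic_cdiff aF (Dr _ Dz)).
have {}HL y : modulus (y - a) <= r / 4 ->
    modulus (F y - F a - L / r%:C * (y - a)) <= K * M * (modulus (y - a) / r) ^+ 2.
  move=> ya; have := HL ((y - a) / r%:C).
  rewrite modulusM modulusV modulus_real gtr0_norm// ler_pdivrMr//.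
  rewrite [1 / 4 * r]mulrC mul1r => /(_ ya).
  rewrite /G mulr0 addr0 mulrCA divff// mulr1 [a + _]addrC subrK.
  by have -> : L / r%:C * (y - a) = L * ((y - a) / r%:C) by ring.
have dF : cdiff F a (L / r%:C).
  move=> e e0; have KM : 0 <= K * M by rewrite mulr_ge0// ltW.
  pose D := K * M / r ^+ 2 + 1.
  have D0 : 0 < D by rewrite ltr_wpDl// divr_ge0// sqr_ge0.
  exists (Num.min (r / 4) (e / D)); first by rewrite lt_min !divr_gt0.
  move=> y; rewrite lt_min => /andP[/ltW ya]; rewrite ltr_pdivlMr// => ye.
  apply: le_trans (HL y ya) _.
  rewrite exprMn exprVn mulrCA -[leRHS]mulrC expr2 -mulrA ler_wpM2l ?modulus_ge0//.
  have := modulus_ge0 (y - a); rewrite /D in ye; move: ye; move: (modulus _) => x.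
  have : 0 <= K * M / r ^+ 2 by rewrite divr_ge0// sqr_ge0.
  by move: (K * M / r ^+ 2) => k; nra.
by rewrite (cdiff_derive1 dF); exact: HL.
Qed.

(** A single point [w] at distance [r / 4] from [a] suffices: there [|F w - F a| <= 2 M], and
    solving the second order estimate for the derivative gives [(8 + K / 4) M / r]. *)
Lemma cauchy_estimate : exists2 K : R, 0 < K & forall F M, analytic_ball M F ->
  forall a, disc a -> modulus (derive1 F a) <= K * M / (1 - modulus a).
Proof.
have [K K0 HK] := quantitative_differentiability; exists (8 + K) => [|F M FM a Da].
  by lra.
have M0 := analytic_ball_ge0 FM.
pose r := 1 - modulus a; have r0 : 0 < r by move: Da; rewrite discE /r; lra.
pose w := a + (r / 4)%:C.
have wa : w - a = (r / 4)%:C by rewrite /w addrC addKr.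
have mwa : modulus (w - a) = r / 4 by rewrite wa modulus_real ger0_norm; lra.
have Dw : disc w.
  rewrite discE /w; apply: le_lt_trans (modulusD _ _) _.
  by rewrite modulus_real ger0_norm /r; rewrite /r in r0; lra.
have := HK F M FM a w Da; rewrite mwa -/r => /(_ (lexx _)).
have -> : r / 4 / r = 4^-1 by field; rewrite gt_eqF.
have D := le_modulusB (derive1 F a * (w - a)) (F w - F a).
have E : modulus (derive1 F a * (w - a) - (F w - F a)) =
  modulus (F w - F a - derive1 F a * (w - a)) by rewrite modulusBC.
rewrite E modulusM mwa in D.
have B := modulusB_le (F w) (F a); have [_ Fb] := FM; have := Fb w Dw; have := Fb a Da.
rewrite ler_pdivlMr// expr2; nra.
Qed.

Lemma analytic_lipschitz : exists2 K : R, 0 < K & forall F M, analytic_ball M F ->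
  forall (r : R) z w, r < 1 -> modulus z <= r -> modulus w <= r ->
  modulus (F w - F z) <= K * M / (1 - r) * modulus (w - z).
Proof.
have [K K0 HK] := cauchy_estimate; exists K => // F M FM r z w r1 zr wr.
have M0 := analytic_ball_ge0 FM.
have cv (t : R) : t \in `[0, 1] -> modulus (z + t%:C * (w - z)) <= r.
  rewrite in_itv/= => /andP[t0 t1].
  have -> : z + t%:C * (w - z) = (1 - t)%:C * z + t%:C * w by rewrite rmorphB/=; ring.
  apply: le_trans (modulusD _ _) _; rewrite !modulusM !modulus_real !ger0_norm//; last lra.
  nra.
have := @mean_value_le R (fun t => F (z + t%:C * (w - z)))
  (fun t => derive1 F (z + t%:C * (w - z)) * (w - z))
  (K * M / (1 - r) * modulus (w - z)) 0 1 ler01.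
rewrite mul0r addr0 mul1r [z + _]addrC subrK subr0 mulr1; apply => t t01.
  apply: rdiff_line; apply: analytic_cdiff; first by case: FM.
  by rewrite discE; apply: le_lt_trans (cv t t01) _.
rewrite modulusM ler_wpM2r ?modulus_ge0//.
have Dt : disc (z + t%:C * (w - z)) by rewrite discE; apply: le_lt_trans (cv t t01) _.
apply: le_trans (HK _ _ FM _ Dt) _.
have KM : 0 <= K * M by rewrite mulr_ge0// ltW.
have := cv t t01; move: Dt; rewrite discE => D1 D2.
by rewrite ler_wpM2l// lef_pV2 ?posrE; lra.
Qed.

Lemma continuous_bounded_closed_disc f :
  (forall z, closed_disc z -> ccont f z) -> bounded_on (@closed_disc R) f.
Proof.
move=> cf.
have cfw : {within @closed_disc R, continuous f}.
  by apply: continuous_in_subspaceT => z /set_mem /cf /ccontP.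
have := continuous_compact (continuous_subspaceT (@modulus_continuous R))
  (continuous_compact cfw (@closed_disc_compact R)).
move=> /compact_bounded[M [_ bM]]; exists (M + 1) => z Dz.
apply: le_trans (ler_norm _) _; apply: (bM (M + 1)); first by rewrite ltrDl.
by exists (f z) => //; exists z.
Qed.

(** The dilation [G] of [F] is bounded by compactness. Adding its second order estimates about [a]
    and about [b] cancels the values and bounds [(G' b - G' a) (b - a)] by a multiple of
    [|b - a|^2]. *)
Lemma derive1_ccont F z : analytic disc F -> disc z -> ccont (derive1 F) z.
Proof.
move=> aF Dz; have z1 := Dz; rewrite discE in z1.
pose r := (1 + modulus z) / 2; have mz := modulus_ge0 z.
have r0 : 0 < r by rewrite /r; lra.
have r1 : r < 1 by rewrite /r; lra.
have zr : modulus z < r by rewrite /r; lra.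
have rC : (r%:C : C) != 0 by rewrite -modulus_gt0 modulus_real normr_gt0 gt_eqF.
pose G y := F (r%:C * y).
have Dr y : closed_disc y -> disc (r%:C * y).
  rewrite discE closed_discE modulusM modulus_real gtr0_norm// => y1; nra.
have dcd (y : C) : disc y -> closed_disc y by rewrite discE closed_discE => /ltW.
have dG y : closed_disc y -> cdiff G y (derive1 F (r%:C * y) * r%:C).
  move=> Dy; have := cdiff_comp (cdiffM (cdiff_cst r%:C y) (cdiff_id y))
    (analytic_cdiff aF (Dr y Dy)).
  by rewrite /= mulr1 mul0r addr0.
have [M GM] : bounded_on (@closed_disc R) G.
  by apply: continuous_bounded_closed_disc => y /dG; exact: cdiff_ccont.
have Gball : analytic_ball M G.
  split=> [y /dcd/dG/cdiff_derivable//|y /dcd]; exact: GM.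
have M0 := analytic_ball_ge0 Gball.
have [K K0 HK] := quantitative_differentiability.
have dGE y : disc y -> derive1 G y = derive1 F (r%:C * y) * r%:C.
  by move=> /dcd/dG/cdiff_derive1.
have cdG a : disc a -> ccont (derive1 G) a.
  move=> Da; have a1 : modulus a < 1 by rewrite -discE.
  pose p := (1 - modulus a) / 2; have p0 : 0 < p by rewrite /p; lra.
  pose A := 2 * K * M / p ^+ 2 + 1.
  have A0 : 0 < A by rewrite ltr_wpDl// divr_ge0 ?sqr_ge0// !mulr_ge0// ltW.
  move=> e e0; exists (Num.min (p / 4) (e / A)).
    by rewrite lt_min; apply/andP; split; apply: divr_gt0.
  move=> b; rewrite lt_min => /andP[bap]; rewrite ltr_pdivlMr// => bae.
  have [->|ba0] := eqVneq b a; first by rewrite subrr modulus0.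
  have {}ba0 : 0 < modulus (b - a) by rewrite modulus_gt0 subr_eq0.
  have pb : p <= 1 - modulus b by have := le_modulusB b a; rewrite /p in bap *; lra.
  have pa : p <= 1 - modulus a by rewrite /p; lra.
  have Db : disc b by rewrite discE; lra.
  have H1 := HK G M Gball a b Da ltac:(lra).
  have H2 := HK G M Gball b a Db ltac:(rewrite modulusBC; lra).
  rewrite -(ltr_pM2r ba0) -modulusM.
  have -> : (derive1 G b - derive1 G a) * (b - a) =
    (G b - G a - derive1 G a * (b - a)) + (G a - G b - derive1 G b * (a - b)).
    by move: (derive1 G a) (derive1 G b) (G a) (G b) => *; ring.
  apply: le_lt_trans (modulusD _ _) _.
  apply: le_lt_trans (lerD H1 H2) _; rewrite [modulus (a - b)]modulusBC -mulrDr.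
  have KM : 0 <= K * M by rewrite mulr_ge0// ltW.
  have le_sq q : p <= q -> (modulus (b - a) / q) ^+ 2 <= (modulus (b - a) / p) ^+ 2.
    move=> pq; have q0 := lt_le_trans p0 pq.
    have h x : 0 < x -> 0 <= modulus (b - a) / x.
      by move=> /ltW x0; rewrite divr_ge0 ?modulus_ge0.
    rewrite ler_pXn2r ?nnegrE ?h//.
    by rewrite ler_wpM2l ?modulus_ge0// lef_pV2.
  apply: le_lt_trans (ler_wpM2l KM (lerD (le_sq _ pa) (le_sq _ pb))) _.
  have -> : K * M * ((modulus (b - a) / p) ^+ 2 + (modulus (b - a) / p) ^+ 2) =
    (A - 1) * modulus (b - a) * modulus (b - a).
    by rewrite /A; move: (modulus (b - a)) (lt0r_neq0 p0) => x; move: (p) => q q0; field.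
  by rewrite ltr_pM2r//; nra.
move=> e e0; have Dzr : disc (z / r%:C).
  by rewrite discE modulusM modulusV modulus_real gtr0_norm// ltr_pdivrMr// mul1r.
have [d d0 Hd] := cdG _ Dzr (e * r) (mulr_gt0 e0 r0).
exists (Num.min (r - modulus z) (d * r)); first by rewrite lt_min mulr_gt0// subr_gt0 zr.
move=> w; rewrite lt_min => /andP[w1 w2].
have Dwr : disc (w / r%:C).
  rewrite discE modulusM modulusV modulus_real gtr0_norm// ltr_pdivrMr// mul1r.
  by have := le_modulusB w z; lra.
have := Hd (w / r%:C); rewrite -mulrBl modulusM modulusV modulus_real gtr0_norm//.
rewrite ltr_pdivrMr// => /(_ w2); rewrite !dGE// ![r%:C * (_ / _)]mulrCA divff// !mulr1.
by rewrite -mulrBl modulusM modulus_real gtr0_norm// ltr_pM2r.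
Qed.

(** * Montel's theorem along an ultrafilter *)

Section montel.
Variables (T : Type) (U : set_system T).
Hypothesis UU : UltraFilter U.
Variables (M : R) (f : T -> C -> C) (F : C -> C).
Hypothesis fM : U [set t | analytic_ball M (f t)].
Hypothesis fF : forall z, disc z -> ulim U (fun t => f t z) (F z).

(** The derivatives at [a] are bounded, hence have a limit [L] along [U]; the second order estimate,
    uniform over the ball, passes to the limit and shows that [L] is the derivative of [F]. *)
Lemma analytic_ball_ulim : analytic_ball M F.
Proof.
have [K K0 HK] := quantitative_differentiability.
have [K' K'0 HK'] := cauchy_estimate.
have M0 : 0 <= M by have [t] := filter_ex fM; exact: analytic_ball_ge0.
split=> [a Da|z Dz]; last first.
  rewrite -[F z]subr0; apply: (ulim_le UU (fF Dz)).
  by apply: filterS fM => t [_ /(_ z Dz)] /=; rewrite subr0.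
have a1 : modulus a < 1 by rewrite -discE.
pose p := 1 - modulus a; have p0 : 0 < p by rewrite /p; lra.
have [L dL] : exists L, ulim U (fun t => derive1 (f t) a) L.
  apply: (@ulim_ex R _ U UU _ (K' * M / (1 - modulus a))).
  by apply: filterS fM => t /HK' /(_ a Da).
have HF w : modulus (w - a) <= p / 4 ->
    modulus (F w - F a - L * (w - a)) <= K * M * (modulus (w - a) / p) ^+ 2.
  move=> wa; have Dw : disc w by rewrite discE; have := le_modulusB w a; rewrite /p in wa *; lra.
  rewrite -[X in modulus X]subr0.
  have lim : ulim U (fun t => f t w + (-1) * f t a + (a - w) * derive1 (f t) a)
      (F w - F a - L * (w - a)).
    have -> : F w - F a - L * (w - a) = F w + (-1) * F a + (a - w) * L by ring.
    by apply: ulimD; [apply: ulimD; [exact: fF|apply: ulimZ; exact: fF]|exact: ulimZ].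
  apply: (ulim_le UU lim); apply: filterS fM => t /HK /(_ a w Da wa) /=.
  have -> // : f t w + -1 * f t a + (a - w) * derive1 (f t) a - 0 =
     f t w - f t a - derive1 (f t) a * (w - a) by ring.
apply: (@cdiff_derivable _ _ _ L) => e e0.
have KM : 0 <= K * M by rewrite mulr_ge0// ltW.
pose D := K * M / p ^+ 2 + 1.
have D0 : 0 < D by rewrite ltr_wpDl// divr_ge0// sqr_ge0.
exists (Num.min (p / 4) (e / D)); first by rewrite lt_min !divr_gt0.
move=> y; rewrite lt_min => /andP[/ltW ya]; rewrite ltr_pdivlMr// => ye.
apply: le_trans (HF y ya) _.
have -> : K * M * (modulus (y - a) / p) ^+ 2 = (D - 1) * modulus (y - a) * modulus (y - a).
  by rewrite /D; move: (modulus (y - a)) (lt0r_neq0 p0) => x; move: (p) => q q0; field.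
by rewrite ler_wpM2r ?modulus_ge0//; have := modulus_ge0 (y - a); nra.
Qed.

(** Otherwise points [x t] where convergence fails have a limit [z] along [U], and the common
    Lipschitz constant on [|z| <= r] carries the convergence at [z] over to [x t]. *)
Lemma ulim_uniform (r e : R) : r < 1 -> 0 < e ->
  U [set t | forall z, modulus z <= r -> modulus (f t z - F z) < e].
Proof.
move=> r1 e0; have Fb := analytic_ball_ulim.
have M0 := analytic_ball_ge0 Fb.
have [K K0 HK] := analytic_lipschitz.
have [//|H] := in_ultra_setVsetC [set t | forall z, modulus z <= r -> modulus (f t z - F z) < e] UU.
exfalso.
pose Q t z := modulus z <= r /\ e <= modulus (f t z - F z).
have exQ t : exists z, (exists z, Q t z) -> Q t z.
  by have [[z Qz]|nQ] := pselect (exists z, Q t z); [exists z|exists 0].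
have [x Hx] := choice exQ.
have {}H : U [set t | Q t (x t)].
  apply: filterS H => t /= Ht; apply: Hx; apply: contrapT => nQ; apply: Ht => z zr.
  by rewrite ltNge; apply/negP => ez; apply: nQ; exists z.
have [z xz] : exists z, ulim U x z.
  by apply: (@ulim_ex R _ U UU x r); apply: filterS H => t [].
have zr : modulus z <= r.
  rewrite -[z]subr0; apply: (ulim_le UU xz); apply: filterS H => t [] /=.
  by rewrite subr0.
have Dz : disc z by rewrite discE (le_lt_trans zr).
pose A := K * M / (1 - r).
have A0 : 0 <= A by rewrite divr_ge0 ?mulr_ge0 ?(ltW K0)// subr_ge0 ltW.
have e2 : 0 < e / (4 * (A + 1)) by rewrite divr_gt0// mulr_gt0//; lra.
have e4 : 0 < e / 4 by lra.
have [t [[[ft fz] xt] [xr Qt]]] :=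
  filter_ex (filterI (filterI (filterI fM (fF Dz e4)) (xz _ e2)) H).
move: fz xt => /= fz; rewrite ltr_pdivlMr; last by rewrite mulr_gt0//; lra.
move=> xt.
have L1 := HK _ _ ft r z (x t) r1 zr xr; have L2 := HK _ _ Fb r z (x t) r1 zr xr.
rewrite -/A in L1 L2.
have E : f t (x t) - F (x t) = (f t (x t) - f t z) + (f t z - F z) - (F (x t) - F z) by ring.
have := modulusB_le ((f t (x t) - f t z) + (f t z - F z)) (F (x t) - F z).
rewrite -E; have := modulusD (f t (x t) - f t z) (f t z - F z).
have := modulus_ge0 (x t - z); nra.
Qed.

End montel.

End bounded_analytic.

(** * Spaces of functions and weak topologies *)

Section function_spaces.
Variable R : realType.
Local Notation C := (Cplx R).

Lemma fs_lin (X : fun_space R) (c : C) (f g : fs_elt X) z :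
  (c *: f + g) z = c * f z + g z.
Proof. by []. Qed.

Lemma fs_scale (X : fun_space R) (c : C) (f : fs_elt X) z : (c *: f) z = c * f z.
Proof. by []. Qed.

Lemma fs_sub (X : fun_space R) (f g : fs_elt X) z : (f - g) z = f z - g z.
Proof. by []. Qed.

Lemma fs_add (X : fun_space R) (f g : fs_elt X) z : (f + g) z = f z + g z.
Proof. by []. Qed.

Lemma fs_zero (X : fun_space R) z : (0 : fs_elt X) z = 0.
Proof. by []. Qed.

Definition snorm (X : fun_space R) (f : fs_elt X) : R := sup_norm (fs_dom X) f.

Lemma normE (X : fun_space R) (f : fs_elt X) : `|f| = (snorm f)%:C.
Proof. by []. Qed.

Lemma snorm_ge0 (X : fun_space R) (f : fs_elt X) : 0 <= snorm f.
Proof. exact: sup_norm_ge0. Qed.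

Lemma snorm_ub (X : fun_space R) (f : fs_elt X) z : fs_dom X z -> modulus (f z) <= snorm f.
Proof. exact/sup_norm_ub/fs_bounded/fs_carP. Qed.

Lemma snorm_le (X : fun_space R) (f : fs_elt X) (M : R) : 0 <= M ->
  (forall z, fs_dom X z -> modulus (f z) <= M) -> snorm f <= M.
Proof. exact: sup_norm_le. Qed.

Lemma snormD (X : fun_space R) (f g : fs_elt X) : snorm (f + g) <= snorm f + snorm g.
Proof. by have := ler_normD f g; rewrite !normE -rmorphD /= lecR. Qed.

Lemma snormZ (X : fun_space R) c (f : fs_elt X) : snorm (c *: f) = modulus c * snorm f.
Proof.
by apply: (@complexI R); rewrite -normE normrZ normE -modulusE -rmorphM.
Qed.

Lemma fs_ext (X : fun_space R) (f g : fs_elt X) :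
  (forall z, fs_dom X z -> f z = g z) -> f = g.
Proof.
move=> fg; apply: val_inj; apply/funext => z /=.
have [Dz|Dz] := pselect (fs_dom X z); first exact: fg.
by rewrite !(fs_off (fs_carP _) Dz).
Qed.

Lemma bounded_opP (X Y : fun_space R) (T : {linear fs_elt X -> fs_elt Y}) :
  bounded_op T <-> exists2 M : R, 0 <= M & forall x, snorm (T x) <= M * snorm x.
Proof.
split=> [[M HM]|[M M0 HM]]; last first.
  by exists M%:C => x; rewrite !normE -rmorphM lecR.
exists (modulus M) => [|x]; first exact: modulus_ge0.
have := HM x; rewrite !normE lecE => /andP[_].
rewrite [complex.Re (snorm (T x))%:C]/=.
have -> : complex.Re (M * (snorm x)%:C) = complex.Re M * snorm x.
  by rewrite cReM /= mulr0 subr0.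
move=> /le_trans; apply; rewrite ler_wpM2r ?snorm_ge0//.
by apply: le_trans (ler_norm _) _; exact: Re_le_modulus.
Qed.

Lemma dual_bounded (X : fun_space R) (phi : dual (fs_elt X)) :
  exists2 M : R, 0 <= M & forall x, modulus (sval phi x) <= M * snorm x.
Proof.
have /(_ 0)/cvgrPdist_lt/(_ 1 ltr01) := svalP phi.
rewrite linear0 => /nbhs_ballP[e /= e0 He].
have ee : e = (modulus e)%:C by rewrite modulusE gtr0_norm.
pose d := modulus e; have d0 : 0 < d by rewrite -ltcR -ee.
have key x : snorm x < d -> modulus (sval phi x) < 1.
  move=> xd; have := He x; rewrite -ball_normE /= sub0r normrN normE ee ltcR => /(_ xd).
  by rewrite /= sub0r normrN -modulusE -[X in _ < X]/(1%:C) ltcR.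
exists (2 / d) => [|x]; first by rewrite divr_ge0// ltW.
have [x0|x0] := eqVneq (snorm x) 0.
  have -> : x = 0 by apply/eqP; rewrite -normr_eq0 normE x0.
  by rewrite linear0 modulus0 mulr_ge0 ?snorm_ge0// divr_ge0// ltW.
have {}x0 : 0 < snorm x by rewrite lt_def x0 snorm_ge0.
pose c := d / 2 / snorm x; have c0 : 0 < c by rewrite !divr_gt0.
have H : modulus (sval phi (c%:C *: x)) < 1.
  apply: key; rewrite snormZ modulus_real gtr0_norm//.
  by rewrite /c -mulrA mulVf ?mulr1 ?gt_eqF//; lra.
have -> : 2 / d * snorm x = c^-1 by rewrite /c !invfM !invrK; ring.
move: H; rewrite linearZ /= -[_ *: _]/(_ * _) modulusM modulus_real gtr0_norm// mulrC.
by rewrite -ltr_pdivlMr// mul1r => /ltW.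
Qed.

Lemma dual_exists (X : fun_space R) (L : fs_elt X -> C) (M : R) :
  (forall c f g, L (c *: f + g) = c * L f + L g) ->
  (forall f, modulus (L f) <= M * snorm f) ->
  exists phi : dual (fs_elt X), forall f, sval phi f = L f.
Proof.
move=> Llin LM.
have Ll : linear (L : fs_elt X -> C^o) by move=> c f g; exact: Llin.
pose lin : {linear fs_elt X -> C^o} :=
  HB.pack (L : fs_elt X -> C^o) (GRing.isLinear.Build _ _ _ _ (L : fs_elt X -> C^o) Ll).
have clin : continuous lin.
  apply: bounded_linear_continuous; apply/linear_boundedP.
  exists (`|M| + 1)%:C; split; first by rewrite ger0_real// lecR addr_ge0.
  move=> r Mr x; rewrite normE -modulusE.
  have r0 : 0 <= r by apply: le_trans (ltW Mr); rewrite lecR addr_ge0.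
  have rr : r = (modulus r)%:C by rewrite modulusE ger0_norm.
  rewrite rr -rmorphM lecR; apply: le_trans (LM x) _.
  rewrite ler_wpM2r ?snorm_ge0//; move: Mr; rewrite {1}rr ltcR => /ltW Mr.
  by apply: le_trans Mr; rewrite (le_trans (ler_norm M))// lerDl.
by exists (exist _ lin clin).
Qed.

Lemma initial_cvg (S : choiceType) (T : topologicalType) (f : S -> T)
    (F : set_system S) (s : S) : Filter F -> f @ F --> f s ->
  (F : set_system (initial_topology f)) --> (s : initial_topology f).
Proof.
move=> FF H B Bs; have : nbhs (s : initial_topology f) B by exact: Bs.
rewrite nbhsE => -[V [[A oA AV] Vs] VB].
apply: filterS VB _; rewrite -AV; apply: H.
by apply: open_nbhs_nbhs; split => //; rewrite -AV in Vs.
Qed.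

(** The weak topology is initial for a map into a product whose own topology is a supremum of
    initial topologies; hence the two uses of [initial_cvg]. *)
Lemma weak_cvgP (X : fun_space R) (F : set_system (fs_elt X)) (y : fs_elt X) : Filter F ->
  (F : set_system (weak (fs_elt X))) --> (y : weak (fs_elt X)) <->
  forall phi : dual (fs_elt X), forall e : R, 0 < e ->
    F [set x | modulus (sval phi x - sval phi y) < e].
Proof.
move=> FF; pose ev (x : fs_elt X) : {ptws dual (fs_elt X) -> C^o} := fun phi => sval phi x.
have cP (phi : dual (fs_elt X)) : (fun x => sval phi x : C) @ F --> (sval phi y : C) <->
    forall e : R, 0 < e -> F [set x | modulus (sval phi x - sval phi y) < e].
  exact: cvgCP.
split=> [Fy phi|H].
  have Fev : ev @ F --> ev y.
    by apply: cvg_trans (@initial_continuous _ _ ev y); exact: cvg_app Fy.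
  have Fphi : (fun x => sval phi x : C) @ F --> (sval phi y : C).
    apply: cvg_trans (@proj_continuous _ (fun=> C^o) phi (ev y)); exact: cvg_app Fev.
  exact: (proj1 (cP phi) Fphi).
apply: (@initial_cvg _ _ ev) => //.
apply/cvg_sup => phi; apply: initial_cvg; exact: (proj2 (cP phi) (H phi)).
Qed.

End function_spaces.

(** * Weak compactness tested along ultrafilters *)

Section weak_compactness.
Variable R : realType.
Local Notation C := (Cplx R).

Lemma dual_eval (X : fun_space R) z : fs_dom X z ->
  exists phi : dual (fs_elt X), forall f, sval phi f = f z.
Proof.
move=> Dz; apply: (@dual_exists R X (fun f => f z) 1) => [//|f].
by rewrite mul1r; exact: snorm_ub.
Qed.

(** Evaluations at points of the domain are continuous functionals and separate the functions. *)
Lemma weak_hausdorff (X : fun_space R) : hausdorff_space (weak (fs_elt X)).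
Proof.
move=> p q pq; apply: (@fs_ext R X p q) => z /dual_eval[phi phiE].
rewrite -!phiE; apply/eqP; rewrite -subr_eq0 -modulus_eq0 eq_le modulus_ge0 andbT.
have N (x : weak (fs_elt X)) (e : R) : 0 < e ->
    nbhs x [set y | modulus (sval phi y - sval phi x) < e].
  by apply: (proj1 (@weak_cvgP R X (nbhs x) x _)); exact: cvg_id.
apply/ler_addgt0Pr => e e0; rewrite add0r; have e2 : 0 < e / 2 by lra.
have [w [/= w1 w2]] := pq _ _ (N p _ e2) (N q _ e2).
apply: le_trans (modulus_triangle (sval phi w) _ _) _; rewrite [e]splitr.
by apply: lerD; [rewrite modulusBC; exact: ltW w1|exact: ltW w2].
Qed.

Lemma weakly_compact_ulim (X Y : fun_space R) (T : {linear fs_elt X -> fs_elt Y})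
    I (U : set_system I) (x : I -> fs_elt X) : UltraFilter U -> weakly_compact T ->
  (forall i, snorm (x i) <= 1) ->
  exists y, forall phi : dual (fs_elt Y), ulim U (fun i => sval phi (T (x i))) (sval phi y).
Proof.
move=> UU [_]; rewrite precompactE => cT x1.
pose B : set (weak (fs_elt Y)) := T @` [set x : fs_elt X | `|x| <= 1].
have TB i : B (T (x i)).
  by exists (x i) => //=; rewrite normE -[X in _ <= X]/(1%:C) lecR.
pose Tx i : weak (fs_elt Y) := T (x i).
have FB : (Tx @ U) (closure B).
  have : U [set i | closure B (Tx i)].
    by apply: filterS filterT => i _; apply: subset_closure; exact: TB.
  exact.
have [y [_ cy]] := cT (Tx @ U) _ FB.
exists y => phi e e0.
have [//|H] := in_ultra_setVsetC [set i | modulus (sval phi (T (x i)) - sval phi y) < e] UU.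
have N : nbhs (y : weak (fs_elt Y)) [set w | modulus (sval phi w - sval phi y) < e].
  by apply: (proj1 (@weak_cvgP R Y (nbhs (y : weak (fs_elt Y))) y _)) => //; exact: cvg_id.
have HT : (Tx @ U) (~` [set w : weak (fs_elt Y) | modulus (sval phi w - sval phi y) < e]).
  exact: H.
by have [w [/= w1 w2]] := cy _ _ HT N.
Qed.

(** As the limits are images of points of the unit ball, the image of the ball is itself weakly
    compact, and being closed in a Hausdorff space it equals its closure. *)
Lemma weakly_compact_of_ulim (X Y : fun_space R) (T : {linear fs_elt X -> fs_elt Y}) :
  bounded_op T ->
  (forall I (U : set_system I) (x : I -> fs_elt X), UltraFilter U ->
    (forall i, snorm (x i) <= 1) ->
    exists2 x0, snorm x0 <= 1 & forall phi : dual (fs_elt Y),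
      ulim U (fun i => sval phi (T (x i))) (sval phi (T x0))) ->
  weakly_compact T.
Proof.
move=> bT H; split => //; rewrite precompactE.
pose B : set (weak (fs_elt Y)) := T @` [set x : fs_elt X | `|x| <= 1].
have norm1 (x : fs_elt X) : (`|x| <= 1) = (snorm x <= 1).
  by rewrite normE -[X in _ <= X]/(1%:C) lecR.
have cB : compact B.
  rewrite compact_ultra => F UF FB.
  (* A choice of preimages in the ball turns an ultrafilter of values into a bounded family of
     arguments; off the image the default 0 keeps the norm bound. *)
  have exS (y : fs_elt Y) : exists x : fs_elt X, snorm x <= 1 /\ (B y -> T x = y).
    have [[x /= x1 <-]|nB] := pselect (B y); first by exists x; rewrite -norm1.
    by exists 0; split => //; rewrite -norm1 normr0 ler01.
  have [s Hs] := choice exS.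
  have [|x0 x01 Hx] := H _ F s UF; first by move=> y; have [] := Hs y.
  exists (T x0); split; first by exists x0 => //=; rewrite norm1.
  apply: (proj2 (@weak_cvgP R Y F (T x0) _)) => phi e e0.
  apply: filterS (filterI FB (Hx phi e e0)) => y [By /=].
  by have [_ ->] := Hs y.
have /closure_id clB : closed B by apply: compact_closed cB; exact: weak_hausdorff.
by move: cB; rewrite {1}clB.
Qed.

End weak_compactness.

(** * Elements of H^oo and of the disc algebra *)

Section Hinf_disc_algebra.
Variable R : realType.
Local Notation C := (Cplx R).
Implicit Types (F : C -> C) (z w : C).

Lemma disc_closed_disc z : disc z -> closed_disc z.
Proof. by rewrite discE closed_discE => /ltW. Qed.

Lemma Hinf_ball (e : fs_elt (@Hinf R)) : analytic_ball (snorm e) e.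
Proof.
have [ae be e0] : is_Hinf e := fs_carP e.
by split=> // z Dz; exact: (@snorm_ub R Hinf e z Dz).
Qed.

Lemma Hinf_exists F M : analytic_ball M F ->
  exists e : fs_elt (@Hinf R), (forall z, disc z -> e z = F z) /\ snorm e <= M.
Proof.
move=> FM; have M0 := analytic_ball_ge0 FM; case: FM => aF FM.
pose G z := if `[< disc z >] then F z else 0.
have GF z : disc z -> G z = F z by move=> Dz; rewrite /G asboolT.
have GH : is_Hinf G.
  split.
  - move=> z Dz; apply: (@cdiff_derivable _ _ _ (derive1 F z)).
    apply: (@cdiff_ext _ F); last exact: analytic_cdiff.
    have z1 := Dz; rewrite discE in z1.
    exists (1 - modulus z); first lra.
    by move=> w wz; rewrite GF// discE; have := le_modulusB w z; lra.
  - by exists M => z Dz; rewrite GF//; exact: FM.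
  - by move=> z Dz; rewrite /G asboolF.
have GP : G \in fs_pred (@Hinf R) by apply/asboolP.
exists (FsElt GP); split => //; apply: snorm_le => // z Dz /=.
by rewrite GF//; exact: FM.
Qed.

Lemma Hinf_ext (e f : fs_elt (@Hinf R)) : (forall z, disc z -> e z = f z) -> e = f.
Proof. exact: (@fs_ext R Hinf e f). Qed.

Definition cont_closed_disc F := forall z, closed_disc z -> forall e : R, 0 < e ->
  exists2 d : R, 0 < d & forall w, closed_disc w -> modulus (w - z) < d ->
    modulus (F w - F z) < e.

Lemma cont_closed_discP F :
  {within @closed_disc R, continuous F} <-> cont_closed_disc F.
Proof.
rewrite subspace_continuousP; split=> [H z Dz e e0|H z Dz].
  have cP := @cvgCP R C (within (@closed_disc R) (nbhs z)) (within_filter _ (nbhs_filter z)) F (F z).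
  have /nbhsCP[d d0 Hd] := proj1 cP (H z Dz) e e0.
  by exists d => // w Dw wz; exact: Hd.
have cP := @cvgCP R C (within (@closed_disc R) (nbhs z)) (within_filter _ (nbhs_filter z)) F (F z).
apply: (proj2 cP) => e e0; have [d d0 Hd] := H z Dz e e0.
by apply/nbhsCP; exists d => // w wz Dw; exact: Hd.
Qed.

Lemma disc_algebra_analytic (f : fs_elt (@disc_algebra R)) : analytic disc f.
Proof. by have [] : is_disc_algebra f := fs_carP f. Qed.

Lemma disc_algebra_cont (f : fs_elt (@disc_algebra R)) : cont_closed_disc f.
Proof. by apply/cont_closed_discP; have [] : is_disc_algebra f := fs_carP f. Qed.

Lemma disc_algebra_exists F : analytic disc F -> cont_closed_disc F ->
  exists f : fs_elt (@disc_algebra R), forall z, closed_disc z -> f z = F z.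
Proof.
move=> aF cF.
pose G z := if `[< closed_disc z >] then F z else 0.
have GF z : closed_disc z -> G z = F z by move=> Dz; rewrite /G asboolT.
have GA : is_disc_algebra G.
  split.
  - move=> z Dz; apply: (@cdiff_derivable _ _ _ (derive1 F z)).
    apply: (@cdiff_ext _ F); last exact: analytic_cdiff.
    have z1 := Dz; rewrite discE in z1.
    exists (1 - modulus z); first lra.
    by move=> w wz; rewrite GF// closed_discE; have := le_modulusB w z; lra.
  - apply/cont_closed_discP => z Dz e e0; have [d d0 Hd] := cF z Dz e e0.
    by exists d => // w Dw wz; rewrite !GF//; exact: Hd.
  - by move=> z Dz; rewrite /G asboolF.
have GP : G \in fs_pred (@disc_algebra R) by apply/asboolP.
by exists (FsElt GP).
Qed.

Lemma closed_disc_approx z (d : R) : closed_disc z -> 0 < d ->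
  exists2 w, disc w & modulus (w - z) < d.
Proof.
rewrite closed_discE => z1 d0; pose r := Num.max (1 / 2) (1 - d / 2).
have r1 : r < 1 by rewrite gt_max; apply/andP; split; lra.
have r0 : 1 / 2 <= r by rewrite le_max lexx.
have rd : 1 - d / 2 <= r by rewrite le_max lexx orbT.
have mz := modulus_ge0 z.
exists (r%:C * z).
  by rewrite discE modulusM modulus_real ger0_norm; nra.
have -> : r%:C * z - z = (r - 1)%:C * z by rewrite rmorphB/=; ring.
by rewrite modulusM modulus_real ler0_norm; nra.
Qed.

Lemma disc_algebra_le (f : fs_elt (@disc_algebra R)) z M : closed_disc z ->
  (forall w, disc w -> modulus (f w) <= M) -> modulus (f z) <= M.
Proof.
move=> Dz fM; apply/ler_addgt0Pr => e e0.
have [d d0 Hd] := disc_algebra_cont f Dz e0.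
have [w Dw wz] := closed_disc_approx Dz d0.
have := Hd w (disc_closed_disc Dw) wz; have := fM w Dw.
have := le_modulusB (f z) (f w); rewrite [modulus (f z - _)]modulusBC; lra.
Qed.

Lemma disc_algebra_ext (f h : fs_elt (@disc_algebra R)) :
  (forall z, disc z -> f z = h z) -> f = h.
Proof.
move=> fh; apply: (@fs_ext R disc_algebra f h) => z Dz; apply/eqP; rewrite -subr_eq0 -modulus_eq0 -fs_sub.
rewrite eq_le modulus_ge0 andbT; apply: disc_algebra_le => // w Dw.
by rewrite fs_sub fh// subrr modulus0.
Qed.

Lemma disc_algebra_restr (f : fs_elt (@disc_algebra R)) :
  exists e : fs_elt (@Hinf R), (forall z, disc z -> e z = f z) /\ snorm e <= snorm f.
Proof.
apply: Hinf_exists; split; first exact: disc_algebra_analytic.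
by move=> z /disc_closed_disc; exact: (@snorm_ub R disc_algebra).
Qed.

End Hinf_disc_algebra.

(** * The operator T_g inside the disc *)

Section Tg_properties.
Variables (R : realType) (g : Cplx R -> Cplx R).
Hypothesis ag : analytic disc g.
Local Notation C := (Cplx R).
Implicit Types (f u : C -> C) (z w : C).

Let dg := derive1 g.

Lemma Tg_seg f z : Tg g f z = seg (fun y => f y * dg y) 0 z.
Proof.
rewrite /Tg /seg; congr cintegral01; apply/funext => t.
by rewrite subr0 add0r mulrC.
Qed.

Lemma Tg0 f : Tg g f 0 = 0.
Proof.
rewrite /Tg; under eq_fun do rewrite mulr0.
have := @cintegral01_FTC R (fun=> 0) (fun=> 0); rewrite subrr; apply.
  by move=> t _ e e0; exists 1 => // s _; rewrite mulr0 !subrr modulus0 mulr_ge0// ltW.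
by move=> t _ e e0; exists 1 => // s _; rewrite subrr modulus0.
Qed.

Lemma disc_seg0 z : disc z -> on_segment disc 0 z.
Proof. by move=> Dz; apply: convexC_disc => //; exact: disc0. Qed.

Let cfg f : analytic disc f -> forall z, disc z -> ccont (fun y => f y * dg y) z.
Proof.
by move=> af z Dz; apply: ccontM; [exact: analytic_ccont|exact: derive1_ccont].
Qed.

Lemma eq_Tg f1 f2 z : analytic disc f1 -> analytic disc f2 ->
  (forall w, disc w -> f1 w = f2 w) -> disc z -> Tg g f1 z = Tg g f2 z.
Proof.
move=> a1 a2 f12 Dz; rewrite !Tg_seg; apply: eq_seg => t t01.
- by apply: cfg => //; exact: disc_seg0.
- by apply: cfg => //; exact: disc_seg0.
- by rewrite f12//; exact: disc_seg0.
Qed.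

Lemma derive1_bounded (r : R) : r < 1 ->
  exists2 G : R, 0 <= G & forall z, modulus z <= r -> modulus (dg z) <= G.
Proof.
move=> r1; have [r0|r0] := leP r 0.
  exists (modulus (dg 0)) => [|z zr]; first exact: modulus_ge0.
  suff -> : z = 0 by [].
  apply/eqP; rewrite -modulus_eq0 eq_le modulus_ge0 andbT; exact: le_trans zr r0.
have Dr y : closed_disc y -> disc (r%:C * y).
  rewrite discE closed_discE modulusM modulus_real gtr0_norm// => y1; nra.
have rC : (r%:C : C) != 0 by rewrite -modulus_gt0 modulus_real normr_gt0 gt_eqF.
have [|G HG] := @continuous_bounded_closed_disc R (fun y => dg (r%:C * y)).
  move=> y Dy e e0; have [d d0 Hd] := derive1_ccont ag (Dr y Dy) e0.
  exists (d / r) => [|w]; first by rewrite divr_gt0.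
  rewrite ltr_pdivlMr// => wy; apply: Hd.
  by rewrite -mulrBr modulusM modulus_real gtr0_norm// mulrC.
exists G => [|z zr].
  by apply: le_trans (HG 0 _); [exact: modulus_ge0|rewrite closed_discE modulus0].
have := HG (z / r%:C); rewrite mulrCA divff// mulr1; apply.
by rewrite closed_discE modulusM modulusV modulus_real gtr0_norm// ler_pdivrMr// mul1r.
Qed.

(** Since [derive1 g] is bounded on [|z| <= r], this makes T_g continuous for locally uniform
    convergence, whatever happens near the boundary. *)
Lemma Tg_small (r : R) : r < 1 -> exists2 G : R, 0 <= G & forall f (d : R),
  analytic disc f -> 0 <= d -> (forall z, modulus z <= r -> modulus (f z) <= d) ->
  forall z, modulus z <= r -> modulus (Tg g f z) <= G * d.
Proof.
move=> r1; have [G G0 HG] := derive1_bounded r1; exists G => // f d af d0 fd z zr.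
have Dz : disc z by rewrite discE (le_lt_trans zr).
rewrite Tg_seg; apply: le_trans (@seg_bound _ _ _ _ (G * d) _ _) _.
- by move=> t t01; apply: cfg => //; exact: disc_seg0.
- move=> t; rewrite in_itv/= => /andP[t0 t1].
  have tz : modulus (0 + t%:C * (z - 0)) <= r.
    rewrite add0r subr0 modulusM modulus_real ger0_norm//.
    by have := modulus_ge0 z; nra.
  rewrite modulusM mulrC; apply: ler_pM; rewrite ?modulus_ge0//; [exact: HG|exact: fd].
- by rewrite subr0 ler_piMr ?mulr_ge0//; lra.
Qed.

Lemma rdiff_inj (W : R -> C) (t : R) L L' : rdiff W t L -> rdiff W t L' -> L = L'.
Proof.
move=> H H'; apply/eqP; rewrite -subr_eq0 -modulus_eq0 eq_le modulus_ge0 andbT.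
apply/ler_addgt0Pr => e e0; rewrite add0r; have e2 : 0 < e / 2 by lra.
have [d d0 Hd] := H _ e2; have [d' d'0 Hd'] := H' _ e2.
pose m := Num.min d d' / 2; have m0 : 0 < m by rewrite divr_gt0// lt_min d0.
have md : m < d by rewrite /m ltr_pdivrMr// (@le_lt_trans _ _ d)// ?ge_min ?lexx//; lra.
have md' : m < d' by rewrite /m ltr_pdivrMr// (@le_lt_trans _ _ d')// ?ge_min ?lexx ?orbT//; lra.
have E : t + m - t = m by ring.
have := Hd (t + m); rewrite E gtr0_norm// => /(_ md) h1.
have := Hd' (t + m); rewrite E gtr0_norm// => /(_ md') h2.
rewrite -(ler_pM2l m0).
have -> : m * modulus (L - L') = modulus ((W (t + m) - W t - m%:C * L') - (W (t + m) - W t - m%:C * L)).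
  rewrite -[m in LHS]gtr0_norm// -modulus_real -modulusM; congr modulus; ring.
apply: le_trans (modulusB_le _ _) _; lra.
Qed.

(** Along the ray through [z] all path integrals share one antiderivative, which gives the radial
    derivative of [u]. As [u] is already known to be analytic, one direction determines its
    derivative. *)
Let Tg_cdiff_neq0 f u z : analytic disc f -> analytic disc u ->
  (forall w, disc w -> u w = Tg g f w) -> disc z -> z != 0 ->
  cdiff u z (f z * dg z).
Proof.
move=> af au uT Dz z0; have z1 := Dz; rewrite discE in z1.
(* With [b = z / s], the point [z] has the interior parameter [s] on the segment from 0 to [b],
   where the derivative is two-sided. *)
have mz : 0 < modulus z by rewrite modulus_gt0.
pose s := (1 + modulus z) / 2; have s0 : 0 < s by rewrite /s; lra.
have s1 : s < 1 by rewrite /s; lra.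
have zs : modulus z < s by rewrite /s; lra.
have sC : (s%:C : C) != 0 by rewrite -modulus_gt0 modulus_real normr_gt0 gt_eqF.
pose b := z / s%:C.
have zb : z = s%:C * b by rewrite /b mulrCA divff// mulr1.
have b0 : b != 0 by rewrite mulf_neq0// invr_eq0.
have Db : disc b.
  by rewrite discE modulusM modulusV modulus_real gtr0_norm// ltr_pdivrMr// mul1r.
pose k y := f y * dg y.
have ck : on_segment (ccont k) 0 b by move=> t t01; apply: cfg => //; exact: disc_seg0.
have [W dW HW] := seg_additive ck.
have uW (t : R) : t \in `[0, 1] -> u (t%:C * b) = W t - W 0.
  move=> t01; have Dt : disc (t%:C * b).
    by have := disc_seg0 Db t01; rewrite add0r subr0.
  have i0 : (0 : R) \in `[0, 1] by rewrite in_itv/= lexx ler01.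
  have E := HW 0 t i0 t01; rewrite subr0 !add0r mul0r in E.
  by rewrite (uT _ Dt) Tg_seg; exact: E.
have s01 : s \in `[0, 1] by rewrite in_itv/=; apply/andP; split; lra.
have := dW s s01; rewrite subr0 add0r -zb -/(k z) => dWs.
have dus : rdiff (fun t => u (0 + t%:C * b)) s (b * k z).
  move=> e e0; have [d d0 Hd] := dWs e e0.
  exists (Num.min d (Num.min s (1 - s))); first by rewrite !lt_min d0 s0 subr_gt0.
  move=> t; rewrite !lt_min => /and3P[td ts ts1].
  have t01 : t \in `[0, 1].
    rewrite in_itv/=; have := ler_norm (t - s); have := ler_norm (s - t).
    by rewrite [`|s - t|]distrC => ? ?; apply/andP; split; lra.
  rewrite !add0r !uW//; have -> : W t - W 0 - (W s - W 0) = W t - W s by ring.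
  exact: Hd.
have du : cdiff u (0 + s%:C * b) (derive1 u z).
  by rewrite add0r -zb; exact: analytic_cdiff.
have := rdiff_inj dus (rdiff_line du); rewrite [b * _]mulrC => /(mulIf b0) E.
by have := analytic_cdiff au Dz; rewrite -E.
Qed.

(** No ray passes through 0 as an interior point of such a segment; there the identity follows by
    continuity of both sides from nearby points. *)
Lemma Tg_cdiff f u z : analytic disc f -> analytic disc u ->
  (forall w, disc w -> u w = Tg g f w) -> disc z -> cdiff u z (f z * dg z).
Proof.
move=> af au uT Dz; have [z0|] := eqVneq z 0; last exact: Tg_cdiff_neq0.
suff -> : f z * dg z = derive1 u z by exact: analytic_cdiff.
apply/eqP; rewrite -subr_eq0 -modulus_eq0 eq_le modulus_ge0 andbT.
apply/ler_addgt0Pr => e e0; rewrite add0r; have e2 : 0 < e / 2 by lra.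
have [d d0 Hd] := cfg af Dz e2; have [d' d'0 Hd'] := derive1_ccont au Dz e2.
pose m := Num.min (Num.min d d') 1 / 2.
have mn0 : 0 < Num.min (Num.min d d') 1 by rewrite !lt_min d0 d'0 ltr01.
have m0 : 0 < m by rewrite divr_gt0.
have md : m < d by apply: lt_le_trans (_ : Num.min (Num.min d d') 1 <= _); [rewrite /m; lra|rewrite !ge_min lexx].
have md' : m < d' by apply: lt_le_trans (_ : Num.min (Num.min d d') 1 <= _); [rewrite /m; lra|rewrite !ge_min lexx orbT].
have m1 : m < 1 by apply: lt_le_trans (_ : Num.min (Num.min d d') 1 <= _); [rewrite /m; lra|rewrite !ge_min lexx orbT].
pose w : C := m%:C; have mw : modulus w = m by rewrite modulus_real gtr0_norm.
have Dw : disc w by rewrite discE mw.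
have w0 : w != 0 by rewrite -modulus_gt0 mw.
have := Hd w; have := Hd' w; rewrite z0 subr0 mw => /(_ md') h1 /(_ md).
have -> : f w * dg w = derive1 u w by rewrite (cdiff_derive1 (Tg_cdiff_neq0 af au uT Dw w0)).
move: h1; move: (derive1 u w) (f 0 * dg 0) (derive1 u 0) => x y t h1 h2.
have := modulus_triangle x y t; rewrite [modulus (y - x)]modulusBC; lra.
Qed.

End Tg_properties.

(** * Multipliers concentrating at a boundary point *)

Section multipliers.
Variables (R : realType) (zeta : Cplx R).
Hypothesis zeta1 : modulus zeta = 1.
Local Notation C := (Cplx R).
Implicit Types (z w : C) (r s t x y : R).

Let zeta0 : zeta != 0.
Proof. by rewrite -modulus_gt0 zeta1. Qed.

Definition lam z : C := 1 - z / zeta.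

(* On the closed disc [bump y] is 1 at [zeta] and tends to 0 elsewhere as
   [y] tends to 0. *)
Definition bump y z : C := y%:C / (y%:C + lam z).

Definition rbump y x : R := y / (y + x).

Lemma modulus_lam z : modulus (lam z) = modulus (z - zeta).
Proof.
have -> : lam z = - (z - zeta) / zeta by rewrite /lam; field.
by rewrite modulusM modulusV modulusN zeta1 invr1 mulr1.
Qed.

Lemma Re_lam z : closed_disc z -> 0 <= complex.Re (lam z).
Proof.
rewrite closed_discE => z1; rewrite /lam cReD cReN /= subr_ge0.
apply: le_trans (ler_norm _) _; apply: le_trans (Re_le_modulus _) _.
by rewrite modulusM modulusV zeta1 invr1 mulr1.
Qed.

(** The cross term [2 y Re (lam z)] is nonnegative on the closed disc. The bounds on [bump] and
    [1 - bump] rest on this. *)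
Lemma bump_denom y z : 0 < y -> closed_disc z ->
  y ^+ 2 + modulus (lam z) ^+ 2 <= modulus (y%:C + lam z) ^+ 2.
Proof.
move=> y0 /Re_lam; move: (lam z) => [a b] /= a0.
rewrite !modulus_sqrE /= add0r; have := mulr_ge0 (ltW y0) a0; rewrite !expr2; lra.
Qed.

Lemma le_of_sqr (a b : R) : 0 <= b -> a ^+ 2 <= b ^+ 2 -> a <= b.
Proof.
by move=> b0 ab; rewrite leNgt; apply/negP => ba; move: ab; rewrite leNgt !expr2 => /negP; apply; nra.
Qed.

Lemma bump_denom_ge y z : 0 < y -> closed_disc z -> y <= modulus (y%:C + lam z).
Proof.
move=> y0 Dz; apply: le_of_sqr; first exact: modulus_ge0.
by apply: le_trans (bump_denom y0 Dz); rewrite lerDl sqr_ge0.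
Qed.

Lemma bump_denom_ge_lam y z : 0 < y -> closed_disc z ->
  modulus (lam z) <= modulus (y%:C + lam z).
Proof.
move=> y0 Dz; apply: le_of_sqr; first exact: modulus_ge0.
by apply: le_trans (bump_denom y0 Dz); rewrite lerDr sqr_ge0.
Qed.

Lemma bump_denom_gt0 y z : 0 < y -> closed_disc z -> 0 < modulus (y%:C + lam z).
Proof. by move=> y0 Dz; exact: lt_le_trans (bump_denom_ge y0 Dz). Qed.

Lemma bump_denom_neq0 y z : 0 < y -> closed_disc z -> y%:C + lam z != 0.
Proof. by move=> y0 Dz; rewrite -modulus_gt0 bump_denom_gt0. Qed.

Lemma modulus_bump_le1 y z : 0 < y -> closed_disc z -> modulus (bump y z) <= 1.
Proof.
move=> y0 Dz; rewrite modulusM modulusV modulus_real gtr0_norm//.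
by rewrite ler_pdivrMr ?bump_denom_gt0// mul1r bump_denom_ge.
Qed.

Lemma bumpC y z : 0 < y -> closed_disc z -> 1 - bump y z = lam z / (y%:C + lam z).
Proof. by move=> y0 Dz; rewrite /bump; field; exact: bump_denom_neq0. Qed.

Lemma modulus_bumpC_le1 y z : 0 < y -> closed_disc z -> modulus (1 - bump y z) <= 1.
Proof.
move=> y0 Dz; rewrite bumpC// modulusM modulusV.
by rewrite ler_pdivrMr ?bump_denom_gt0// mul1r bump_denom_ge_lam.
Qed.

Lemma modulus_bumpC y z : 0 < y -> closed_disc z ->
  modulus (1 - bump y z) <= modulus (lam z) / y.
Proof.
move=> y0 Dz; rewrite bumpC// modulusM modulusV ler_wpM2l ?modulus_ge0//.
by rewrite lef_pV2 ?posrE ?bump_denom_gt0// bump_denom_ge.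
Qed.

Lemma modulus_bump y z : 0 < y -> closed_disc z -> 0 < modulus (lam z) ->
  modulus (bump y z) <= y / modulus (lam z).
Proof.
move=> y0 Dz l0; rewrite modulusM modulusV modulus_real gtr0_norm// ler_wpM2l ?(ltW y0)//.
by rewrite lef_pV2 ?posrE ?bump_denom_gt0// bump_denom_ge_lam.
Qed.

(* The real majorants [rbump] telescope along a decreasing sequence of
   parameters. *)
Lemma modulus_bumpB x y z : 0 < x -> x <= y -> closed_disc z ->
  modulus (bump y z - bump x z) <=
    2 * (rbump y (modulus (lam z)) - rbump x (modulus (lam z))).
Proof.
move=> x0 xy Dz; have y0 := lt_le_trans x0 xy.
set l := modulus (lam z); have l0 : 0 <= l := modulus_ge0 _.
have -> : bump y z - bump x z =
    (y - x)%:C * lam z / ((y%:C + lam z) * (x%:C + lam z)).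
  by rewrite /bump rmorphB /=; field; rewrite !bump_denom_neq0.
have -> : 2 * (rbump y l - rbump x l) = (y - x) * l * (2 / ((y + l) * (x + l))).
  rewrite /rbump; field; rewrite !gt_eqF//; lra.
rewrite !modulusM modulusV modulus_real ger0_norm ?subr_ge0// -/l.
rewrite ler_wpM2l ?mulr_ge0 ?subr_ge0// modulusM.
have yl : 0 < y + l by lra.
have xl : 0 < x + l by lra.
have p0 : 0 < (y + l) * (x + l) by rewrite mulr_gt0.
have q0 : 0 < modulus (y%:C + lam z) * modulus (x%:C + lam z).
  by rewrite mulr_gt0// bump_denom_gt0.
rewrite -[2 / _]invf_div lef_pV2 ?posrE ?divr_gt0//.
rewrite ler_pdivrMr//; apply: le_of_sqr; first by rewrite mulr_ge0// ltW.
have := bump_denom y0 Dz; have := bump_denom x0 Dz; rewrite -/l !exprMn.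
move: (modulus (y%:C + lam z)) (modulus (x%:C + lam z)) => a b hb ha.
have hy : (y + l) ^+ 2 <= 2 * a ^+ 2 by have := sqr_ge0 (y - l); nra.
have hx : (x + l) ^+ 2 <= 2 * b ^+ 2 by have := sqr_ge0 (x - l); nra.
have -> : a ^+ 2 * b ^+ 2 * 2 ^+ 2 = (2 * a ^+ 2) * (2 * b ^+ 2) by ring.
by apply: ler_pM => //; exact: sqr_ge0.
Qed.

Lemma rbump_ge0 x y : 0 < y -> 0 <= x -> 0 <= rbump y x.
Proof. by move=> y0 x0; rewrite divr_ge0 ?addr_ge0// ltW. Qed.

Lemma rbump_le1 x y : 0 < y -> 0 <= x -> rbump y x <= 1.
Proof. by move=> y0 x0; rewrite ler_pdivrMr; lra. Qed.

Lemma cdiff_bump y z : 0 < y -> closed_disc z ->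
  cdiff (bump y) z (y%:C / zeta / ((y%:C + lam z) * (y%:C + lam z))).
Proof.
move=> y0 Dz; have nz := bump_denom_neq0 y0 Dz.
have dl : cdiff (fun z => y%:C + lam z) z (0 + (0 - 1 * zeta^-1)).
  apply: cdiffD; first exact: cdiff_cst.
  apply: cdiffB; first exact: cdiff_cst.
  have := cdiffM (cdiff_id z) (cdiff_cst zeta^-1 z).
  by rewrite mulr0 add0r.
have := cdiffM (cdiff_cst y%:C z) (cdiff_comp dl (cdiff_inv nz)).
by congr cdiff; rewrite mul0r addr0 add0r sub0r mul1r; field; rewrite nz zeta0.
Qed.

Lemma modulus_bump_derive y z : 0 < y -> closed_disc z ->
  modulus (y%:C / zeta / ((y%:C + lam z) * (y%:C + lam z))) <= y^-1.
Proof.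
move=> y0 Dz; rewrite !modulusM modulusV modulusV modulusM zeta1 invr1 mulr1.
rewrite modulus_real gtr0_norm// ler_pdivrMr; last by rewrite mulr_gt0 ?bump_denom_gt0.
have := bump_denom_ge y0 Dz; move: (modulus _) => a ya.
by rewrite mulrC ler_pdivlMr//; nra.
Qed.

Lemma lam_radius t : lam (t%:C * zeta) = (1 - t)%:C.
Proof. by rewrite /lam rmorphB /=; field. Qed.

(** On the radius [lam] is real, so the modulus of the derivative of [bump] is exactly the
    derivative of its increasing restriction to the radius. *)
Lemma bump_derive_radius y t : 0 < y -> t <= 1 ->
  modulus (y%:C / zeta / ((y%:C + lam (t%:C * zeta)) * (y%:C + lam (t%:C * zeta)))) =
    y / (y + 1 - t) ^+ 2.
Proof.
move=> y0 t1; rewrite lam_radius -rmorphD /= !modulusM !modulusV !modulusM !modulus_real.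
rewrite zeta1 invr1 mulr1 gtr0_norm// addrA ger0_norm; last lra.
by rewrite expr2.
Qed.

(** This is [bump zeta y] at [t%:C * zeta]; it increases in [t] up to 1, and its increments measure
    the variation of [bump] along the radius. *)
Definition radial_weight y t : R := y / (y + 1 - t).

Lemma is_derive_radial_weight y t : 0 < y -> t <= 1 ->
  is_derive t 1 (radial_weight y) (y / (y + 1 - t) ^+ 2).
Proof.
move=> y0 t1; have d0 : y + 1 - t != 0 by rewrite gt_eqF; lra.
have dd : is_derive t 1 (fun t => y + 1 - t) (-1).
  have := @is_deriveB R R R (fun=> y + 1) id t 1 0 1 (is_derive_cst _ _ _) (is_derive_id _ _).
  by rewrite sub0r.
have := @is_deriveM R R (fun=> y) (fun t => (y + 1 - t)^-1) t 1 0 _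
  (is_derive_cst _ _ _) (@is_deriveV R (fun t => y + 1 - t) t (-1) 1 d0 dd).
congr is_derive.
rewrite -![_ *: _]/(_ * _) mulr0 addr0 mulrN1 opprK.
by [].
Qed.

(** The mean value theorem is used with majorant [A * radial_weight y] up to [r] and
    [D * radial_weight y] beyond. The split serves both cases: [Y] small before [r] and merely
    bounded after it, or the reverse. *)
Lemma radial_bound (P : C -> C) (p' Y : C -> C) (y r s A D : R) : 0 < y ->
  0 <= r -> r <= s -> s < 1 -> 0 <= A -> 0 <= D ->
  (forall z, disc z -> cdiff P z (p' z * Y z)) ->
  (forall t, t <= 1 -> modulus (p' (t%:C * zeta)) = y / (y + 1 - t) ^+ 2) ->
  (forall t, 0 <= t -> t <= r -> modulus (Y (t%:C * zeta)) <= A) ->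
  (forall t, r <= t -> t <= s -> modulus (Y (t%:C * zeta)) <= D) ->
  modulus (P (s%:C * zeta) - P 0) <=
    A * (radial_weight y r - radial_weight y 0) +
    D * (radial_weight y s - radial_weight y r).
Proof.
move=> y0 r0 rs s1 A0 D0 dP p'E YA YD.
have key a b K : 0 <= K -> 0 <= a -> a <= b -> b <= s ->
    (forall t, a <= t -> t <= b -> modulus (Y (t%:C * zeta)) <= K) ->
    modulus (P (b%:C * zeta) - P (a%:C * zeta)) <=
      K * radial_weight y b - K * radial_weight y a.
  move=> K0 a0 ab bs YK.
  have E t : P (t%:C * zeta) = P (0 + t%:C * zeta) by rewrite add0r.
  rewrite !E; apply: (@mean_value_bound R (fun t => P (0 + t%:C * zeta))
    (fun t => p' (t%:C * zeta) * Y (t%:C * zeta) * zeta) (fun t => K * radial_weight y t)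
    (fun t => K * (y / (y + 1 - t) ^+ 2))) => // t; rewrite in_itv/= => /andP[at1 tb].
  - apply: rdiff_line; rewrite add0r; apply: dP.
    by rewrite discE modulusM zeta1 mulr1 modulus_real ger0_norm; lra.
  - have t1 : t <= 1 by lra.
    have := @is_deriveM R R (fun=> K) (radial_weight y) t 1 0 _
      (is_derive_cst _ _ _) (is_derive_radial_weight y0 t1).
    by congr is_derive; rewrite -![_ *: _]/(_ * _) mulr0 addr0.
  - rewrite !modulusM zeta1 mulr1 p'E; last lra.
    rewrite mulrC ler_wpM2r//; last by apply: YK.
    by rewrite divr_ge0 ?sqr_ge0// ltW.
have := key 0 r A A0 (lexx _) r0 rs YA; have := key r s D D0 r0 rs (lexx _) YD.
rewrite mul0r => h1 h2; apply: le_trans (modulus_triangle (P (r%:C * zeta)) _ _) _; lra.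
Qed.

End multipliers.

(** * Values at a boundary point by integration along the radius *)

Section boundary_values.
Variables (R : realType) (g : Cplx R -> Cplx R).
Hypothesis ag : analytic disc g.
Local Notation C := (Cplx R).
Local Notation H := (fs_elt (@Hinf R)).
Local Notation A := (fs_elt (@disc_algebra R)).
Implicit Types (f e : H) (z w : C) (r s t x y : R).

Section unit_point.
Variable zeta : C.
Hypothesis zeta1 : modulus zeta = 1.

Let Dzeta : closed_disc zeta.
Proof. by rewrite closed_discE zeta1. Qed.

Lemma analytic_bump y : 0 < y -> analytic disc (bump zeta y).
Proof.
move=> y0 z Dz; apply: cdiff_derivable.
by apply: cdiff_bump => //; exact: disc_closed_disc.
Qed.

Lemma bump_mul f y : 0 < y ->
  exists e : H, (forall z, disc z -> e z = f z * bump zeta y z) /\ snorm e <= snorm f.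
Proof.
move=> y0; have [af fM] := Hinf_ball f; apply: Hinf_exists; split=> z Dz.
  exact: (cdiff_derivable (cdiffM (analytic_cdiff af Dz) (analytic_cdiff (analytic_bump y0) Dz))).
rewrite modulusM -[leRHS]mulr1; apply: ler_pM; rewrite ?modulus_ge0//; first exact: fM.
by apply: modulus_bump_le1 => //; exact: disc_closed_disc.
Qed.

Lemma disc_radius s : 0 <= s -> s < 1 -> disc (s%:C * zeta).
Proof. by move=> s0 s1; rewrite discE modulusM zeta1 mulr1 modulus_real ger0_norm. Qed.

Lemma radial_limit (h : A) (K : R) : (forall e : R, 0 < e -> exists2 s0, s0 < 1 &
    forall s, 0 <= s -> s0 <= s -> s < 1 -> modulus (h (s%:C * zeta)) <= K + e) ->
  modulus (h zeta) <= K.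
Proof.
move=> HK; apply/ler_addgt0Pr => e e0; have e2 : 0 < e / 2 by lra.
have [s0 s01 Hs] := HK _ e2; have [d d0 Hd] := disc_algebra_cont h Dzeta e2.
pose s := Num.max (Num.max 0 s0) (1 - d / 2).
have s0' : 0 <= s by rewrite !le_max lexx.
have s00 : s0 <= s by rewrite !le_max lexx orbT.
have sd : 1 - d / 2 <= s by rewrite !le_max lexx !orbT.
have s1 : s < 1 by rewrite !gt_max ltr01 s01 /=; lra.
have := Hs s s0' s00 s1; have := Hd _ (disc_closed_disc (disc_radius s0' s1)).
have -> : s%:C * zeta - zeta = (s - 1)%:C * zeta by rewrite rmorphB /=; ring.
rewrite modulusM zeta1 mulr1 modulus_real ler0_norm; last lra.
move=> /(_ ltac:(lra)) h1 h2.
have := le_modulusB (h zeta) (h (s%:C * zeta)).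
rewrite [modulus (h zeta - _)]modulusBC; lra.
Qed.

Lemma radial_weight_ge0 y t : 0 < y -> t <= 1 -> 0 <= radial_weight y t.
Proof. by move=> y0 t1; rewrite divr_ge0 ?(ltW y0)//; lra. Qed.

Lemma radial_weight_le1 y t : 0 < y -> t <= 1 -> radial_weight y t <= 1.
Proof. by move=> y0 t1; rewrite ler_pdivrMr; lra. Qed.

Lemma radial_weightB y r s : 0 < y -> r <= s -> s <= 1 ->
  radial_weight y s - radial_weight y r <= (1 - r) / y.
Proof.
move=> y0 rs s1.
have a0 : 0 < y + 1 - s by lra.
have b0 : 0 < y + 1 - r by lra.
have -> : radial_weight y s - radial_weight y r =
    y * (s - r) / ((y + 1 - s) * (y + 1 - r)).
  by rewrite /radial_weight; field; rewrite !gt_eqF.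
rewrite ler_pdivrMr ?mulr_gt0// mulrAC ler_pdivlMr//.
have : y * y <= (y + 1 - s) * (y + 1 - r) by apply: ler_pM; lra.
have := mulr_gt0 a0 b0; move: (_ * (y + 1 - r)) => p p0 yp; nra.
Qed.

Lemma radial_weight_le y r : 0 < y -> r < 1 -> radial_weight y r <= y / (1 - r).
Proof.
by move=> y0 r1; rewrite /radial_weight ler_wpM2l ?(ltW y0)// lef_pV2 ?posrE; lra.
Qed.

End unit_point.

Variable T : {linear H -> A}.
Hypothesis TT : is_Tg g T.
Variable M : R.
Hypothesis M0 : 0 <= M.
Hypothesis TM : forall f, snorm (T f) <= M * snorm f.

Lemma T_cdiff f z : disc z -> cdiff (T f) z (f z * derive1 g z).
Proof.
have [af _] := Hinf_ball f.
exact: (Tg_cdiff ag af (@disc_algebra_analytic R (T f)) (TT f)).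
Qed.

Lemma T_at0 f : T f 0 = 0.
Proof. by rewrite TT ?Tg0//; exact: disc0. Qed.

Lemma T_bound f z : closed_disc z -> modulus (T f z) <= M * snorm f.
Proof. by move=> Dz; apply: le_trans (TM f); exact: (@snorm_ub R disc_algebra). Qed.

Section unit_point2.
Variable zeta : C.
Hypothesis zeta1 : modulus zeta = 1.

Let Dzeta : closed_disc zeta.
Proof. by rewrite closed_discE zeta1. Qed.

Let dbump y z := y%:C / zeta / ((y%:C + lam zeta z) * (y%:C + lam zeta z)).

(** [P = (1 - bump) * T f - T e] has derivative [- dbump * T f]. Along the radius [|dbump|]
    integrates to at most 1 up to [r], where [T f] is below [a], and to at most [(1 - r) / y]
    beyond. The term [(1 - bump) * T f] tends to 0 at [zeta]. *)
Lemma T_bumpC f e y r (a B : R) : 0 < y -> 0 <= r -> r < 1 ->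
  (forall z, disc z -> e z = f z * (1 - bump zeta y z)) ->
  (forall z, disc z -> modulus (T f z) <= B) ->
  (forall z, modulus z <= r -> modulus (T f z) <= a) ->
  modulus (T e zeta) <= a + B * ((1 - r) / y).
Proof.
move=> y0 r0 r1 eE TB Ta.
have B0 : 0 <= B by apply: le_trans (TB 0 (disc0 R)); exact: modulus_ge0.
have a0 : 0 <= a by apply: le_trans (Ta 0 _); rewrite ?modulus_ge0// modulus0.
pose P z := (1 - bump zeta y z) * T f z - T e z.
have dP z : disc z -> cdiff P z (- dbump y z * T f z).
  move=> Dz; have Dcz := disc_closed_disc Dz.
  have := cdiffB (cdiffM (cdiffB (cdiff_cst 1 z) (cdiff_bump zeta1 y0 Dcz)) (T_cdiff f Dz))
    (T_cdiff e Dz).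
  by congr cdiff; rewrite eE// sub0r -/(dbump y z); ring.
apply: (radial_limit zeta1) => d d0.
(* Beyond this parameter [|1 - bump| <= (1 - s) / y] makes the boundary term at most [d]. *)
exists (Num.max r (1 - d * y / (B + 1))).
  by rewrite gt_max r1 /= gtrBl divr_gt0// ?mulr_gt0//; lra.
move=> s s0; rewrite ge_max => /andP[rs]; rewrite lerBlDr -lerBlDl ler_pdivlMr; last lra.
move=> sd s1.
have := @radial_bound R zeta zeta1 P (fun z => - dbump y z) (T f) y r s a B y0 r0 rs s1 a0 B0 dP.
have Dr := disc_radius zeta1.
move=> /(_ _ _ _)H.
have {}H : modulus (P (s%:C * zeta) - P 0) <= a + B * ((1 - r) / y).
  apply: le_trans (H _ _ _) _.
  - by move=> t t1; rewrite modulusN bump_derive_radius.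
  - by move=> t t0 tr; apply: Ta; rewrite modulusM zeta1 mulr1 modulus_real ger0_norm.
  - by move=> t rt ts; apply: TB; apply: Dr; lra.
  - apply: lerD; last by rewrite ler_wpM2l// radial_weightB// ltW.
    rewrite -[leRHS]mulr1 ler_wpM2l//.
    have := radial_weight_le1 y0 (ltW r1); have := radial_weight_ge0 y0 (@ler01 R); lra.
have P0 : P 0 = 0 by rewrite /P !T_at0 mulr0 subrr.
rewrite P0 subr0 in H.
have -> : T e (s%:C * zeta) = (1 - bump zeta y (s%:C * zeta)) * T f (s%:C * zeta) - P (s%:C * zeta).
  by rewrite /P; ring.
apply: le_trans (modulusB_le _ _) _; rewrite addrC lerD// modulusM.
have Ds := Dr s s0 s1.
have := modulus_bumpC zeta1 y0 (disc_closed_disc Ds).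
rewrite lam_radius// modulus_real ger0_norm; last lra.
move=> h1; apply: le_trans (ler_pM (modulus_ge0 _) (modulus_ge0 _) h1 (TB _ Ds)) _.
rewrite mulrAC ler_pdivrMr//.
nra.
Qed.

(** Since [bump] is 1 at [zeta], [T f] is replaced by [Y = T f - T f zeta], which is small there.
    The boundary term and the integral beyond [r] give [2 d]; before [r] the variation of [bump] is
    at most [y / (1 - r)]; the value at 0 gives [B y]. *)
Lemma T_bump f e y r (d B : R) : 0 < y -> 0 <= r -> r < 1 ->
  (forall z, disc z -> e z = f z * bump zeta y z) ->
  (forall z, closed_disc z -> modulus (T f z) <= B) ->
  (forall t, r <= t -> t < 1 -> modulus (T f (t%:C * zeta) - T f zeta) <= d) ->
  modulus (T e zeta) <= 2 * d + 2 * B * (y / (1 - r)) + B * y.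
Proof.
move=> y0 r0 r1 eE TB Td.
have B0 : 0 <= B by apply: le_trans (TB 0 (disc_closed_disc (disc0 R))); exact: modulus_ge0.
have d0 : 0 <= d by apply: le_trans (Td r _ _); rewrite ?modulus_ge0.
pose Y z := T f z - T f zeta.
pose P z := bump zeta y z * Y z - T e z.
have dP z : disc z -> cdiff P z (dbump y z * Y z).
  move=> Dz; have Dcz := disc_closed_disc Dz.
  have := cdiffB (cdiffM (cdiff_bump zeta1 y0 Dcz) (cdiffB (T_cdiff f Dz) (cdiff_cst (T f zeta) z)))
    (T_cdiff e Dz).
  by congr cdiff; rewrite eE// subr0 -/(dbump y z) /Y; ring.
have Dr := disc_radius zeta1.
apply: (radial_limit zeta1) => x x0; exists r => // s s0 rs s1.
have H : modulus (P (s%:C * zeta) - P 0) <= 2 * B * (y / (1 - r)) + d.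
  apply: le_trans (@radial_bound R zeta zeta1 P (dbump y) Y y r s (2 * B) d y0 r0 rs s1 _ d0 dP _ _ _) _.
  - by rewrite mulr_ge0.
  - by move=> t t1; rewrite bump_derive_radius.
  - move=> t t0 tr; apply: le_trans (modulusB_le _ _) _.
    have := TB _ Dzeta; have := TB _ (disc_closed_disc (Dr t t0 (le_lt_trans tr r1))); lra.
  - by move=> t rt ts; apply: Td => //; exact: le_lt_trans s1.
  - apply: lerD.
      rewrite ler_wpM2l ?mulr_ge0//.
      have := radial_weight_le y0 r1; have := radial_weight_ge0 y0 (@ler01 R); lra.
    rewrite -[leRHS]mulr1 ler_wpM2l//.
    have := radial_weight_le1 y0 (ltW s1); have := radial_weight_ge0 y0 (ltW r1); lra.
have P0 : modulus (P 0) <= B * y.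
  rewrite /P /Y !T_at0 subr0 sub0r modulusM modulusN mulrC.
  apply: ler_pM; rewrite ?modulus_ge0//; first exact: TB.
  rewrite /bump /lam mul0r subr0 -[1]/(1%:C) -rmorphD /= modulusM modulusV !modulus_real.
  by rewrite !gtr0_norm// ?ler_pdivrMr ?addr_gt0//; nra.
have -> : T e (s%:C * zeta) = bump zeta y (s%:C * zeta) * Y (s%:C * zeta) -
    (P (s%:C * zeta) - P 0) - P 0 by rewrite /P; ring.
apply: le_trans (modulusB_le _ _) _; apply: le_trans (lerD (modulusB_le _ _) (lexx _)) _.
have : modulus (bump zeta y (s%:C * zeta) * Y (s%:C * zeta)) <= d.
  rewrite modulusM -[d]mul1r; apply: ler_pM; rewrite ?modulus_ge0//; last exact: Td.
  by apply: modulus_bump_le1 => //; apply: disc_closed_disc; exact: Dr.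
lra.
Qed.

End unit_point2.
End boundary_values.

(** * Pointwise convergence on the closed disc *)

Section null_sequences.
Variables (R : realType) (g : Cplx R -> Cplx R).
Hypothesis ag : analytic disc g.
Local Notation C := (Cplx R).
Local Notation H := (fs_elt (@Hinf R)).
Local Notation A := (fs_elt (@disc_algebra R)).
Variable T : {linear H -> A}.
Hypothesis TT : is_Tg g T.
Variable M : R.
Hypothesis M0 : 0 <= M.
Hypothesis TM : forall f : H, snorm (T f) <= M * snorm f.

Variable f : nat -> H.
Hypothesis f2 : forall n, snorm (f n) <= 2.
Hypothesis f_null : forall r d : R, r < 1 -> 0 < d ->
  exists N, forall n, (N <= n)%N -> forall z, modulus z <= r -> modulus (f n z) <= d.

Lemma T_null_inner (r d : R) : r < 1 -> 0 < d ->
  exists N, forall n, (N <= n)%N -> forall z, modulus z <= r -> modulus (T (f n) z) <= d.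
Proof.
move=> r1 d0; have [G G0 HG] := Tg_small ag r1.
have e0 : 0 < d / (G + 1) by rewrite divr_gt0//; lra.
have [N HN] := f_null r1 e0; exists N => n Nn z zr.
have Dz : disc z by rewrite discE (le_lt_trans zr).
have [af _] := Hinf_ball (f n).
rewrite TT//; apply: le_trans (HG _ _ af (ltW e0) (HN n Nn) z zr) _.
by rewrite mulrCA ger_pMr// ler_pdivrMr; lra.
Qed.

Let TB n z : closed_disc z -> modulus (T (f n) z) <= 2 * M.
Proof.
move=> Dz; apply: le_trans (T_bound TM _ Dz) _.
by rewrite mulrC ler_wpM2r.
Qed.

Section boundary.
Variable zeta : C.
Hypothesis zeta1 : modulus zeta = 1.

Let Dzeta : closed_disc zeta.
Proof. by rewrite closed_discE zeta1. Qed.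

Lemma T_bumpC_null (y d : R) : 0 < y -> 0 < d ->
  exists N, forall n, (N <= n)%N -> forall e : H,
    (forall z, disc z -> e z = f n z * (1 - bump zeta y z)) -> modulus (T e zeta) <= d.
Proof.
move=> y0 d0; pose r := Num.max 0 (1 - y * d / (4 * M + 1)).
have r0 : 0 <= r by rewrite le_max lexx.
have M0' := M0; have q0 : 0 < 4 * M + 1 by lra.
have r1 : r < 1.
  by rewrite gt_max ltr01 /= gtrBl; apply: divr_gt0 => //; exact: mulr_gt0.
have [N HN] := T_null_inner r1 (divr_gt0 d0 (ltr0Sn _ 1)); exists N => n Nn e eE.
apply: le_trans (T_bumpC ag TT zeta1 y0 r0 r1 eE (B := 2 * M) _ (HN n Nn)) _.
  by move=> z /disc_closed_disc; exact: TB.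
have : 1 - r <= y * d / (4 * M + 1) by rewrite lerBlDl -lerBlDr le_max lexx orbT.
rewrite ler_pdivlMr; last lra.
move=> Hr; have : 2 * M * ((1 - r) / y) <= d / 2; last lra.
rewrite mulrA ler_pdivrMr//; lra.
Qed.

Lemma T_bump_null n (d : R) : 0 < d -> exists2 x : R, 0 < x &
  forall (y : R) (e : H), 0 < y -> y <= x -> (forall z, disc z -> e z = f n z * bump zeta y z) ->
    modulus (T e zeta) <= d.
Proof.
move=> d0; have M0' := M0; have d8 : 0 < d / 8 by lra.
have [s s0 Hs] := disc_algebra_cont (T (f n)) Dzeta d8.
pose r := Num.max 0 (1 - s / 2).
have r0 : 0 <= r by rewrite le_max lexx.
have r1 : r < 1 by rewrite gt_max ltr01 /=; lra.
have rs : 1 - s / 2 <= r by rewrite le_max lexx orbT.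
have q0 : 0 < 1 - r by lra.
(* The three terms of [T_bump] then become at most [d / 4], [d / 2] and [d / 4]. *)
exists (d * (1 - r) / (8 * (M + 1))); first by apply: divr_gt0; apply: mulr_gt0 => //; lra.
move=> y e y0; rewrite ler_pdivlMr; last by rewrite mulr_gt0//; lra.
move=> yd eE.
apply: le_trans (T_bump ag TT zeta1 y0 r0 r1 eE (B := 2 * M) (d := d / 8) (TB n) _) _.
  move=> t rt t1; apply: ltW; apply: Hs.
    by apply/disc_closed_disc/disc_radius => //; exact: le_trans rt.
  have -> : t%:C * zeta - zeta = (t - 1)%:C * zeta by rewrite rmorphB /=; ring.
  by rewrite modulusM zeta1 mulr1 modulus_real ler0_norm; lra.
have h1 : 2 * (2 * M) * (y / (1 - r)) <= d / 2.
  rewrite mulrA ler_pdivrMr//; nra.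
have h2 : 2 * M * y <= d / 4 by nra.
lra.
Qed.

(** The block is a rotation of [f n * (bump y - bump x)]. Taking [n] large makes the loss from
    [1 - bump y] at most [d / 3], then [x] small makes the loss from [bump x] at most [d / 3]. The
    rotation makes the values at [zeta] positive, so that blocks add up without cancellation. *)
Lemma T_block (d y : R) : 0 < d -> 0 < y ->
  (forall N, exists2 n, (N <= n)%N & d <= modulus (T (f n) zeta)) ->
  exists x : R, exists e : H, [/\ 0 < x, x <= y,
    forall z, disc z -> modulus (e z) <=
      4 * (rbump y (modulus (lam zeta z)) - rbump x (modulus (lam zeta z))) &
    exists2 k : R, d / 3 <= k & T e zeta = k%:C].
Proof.
move=> d0 y0 Hd; have d3 : 0 < d / 3 by lra.
have [N HN] := T_bumpC_null y0 d3; have [n Nn dn] := Hd N.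
have [E [EE _]] := bump_mul zeta1 (f n) y0.
have [x0 x00 Hx0] := T_bump_null n d3.
pose x := Num.min x0 y; have x_gt0 : 0 < x by rewrite lt_min x00.
have xy : x <= y by rewrite ge_min lexx orbT.
have xx0 : x <= x0 by rewrite ge_min lexx.
have [E' [EE' _]] := bump_mul zeta1 (f n) x_gt0.
have h1 : modulus (T (f n - E) zeta) <= d / 3.
  by apply: (HN n Nn) => z Dz; rewrite fs_sub EE//; ring.
have h2 : modulus (T E' zeta) <= d / 3 by apply: (Hx0 x).
have h3 : d / 3 <= modulus (T (E - E') zeta).
  rewrite linearB fs_sub; rewrite linearB fs_sub in h1.
  have := le_modulusB (T E zeta) (T E' zeta).
  have := le_modulusB (T (f n) zeta) (T (f n) zeta - T E zeta).
  by rewrite subKr; lra.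
have [c c1 cE] := exists_unimodular (T (E - E') zeta).
exists x, (c *: (E - E')); split => // [z Dz|].
  rewrite fs_scale fs_sub modulusM c1 mul1r EE// EE'// -mulrBr modulusM.
  have Hb := modulus_bumpB zeta1 x_gt0 xy (disc_closed_disc Dz).
  have [_ /(_ z Dz) fz] := Hinf_ball (f n); have fz2 := le_trans fz (f2 n).
  apply: le_trans (ler_wpM2r (modulus_ge0 _) fz2) _.
  by apply: le_trans (ler_wpM2l _ Hb) _ => //; rewrite mulrA -natrM.
by exists (modulus (T (E - E') zeta)) => //; rewrite linearZ fs_scale.
Qed.

(* The blocks given by [T_block] have disjoint ranges of parameters, so that
   the sum of any number of them remains bounded by 4 on the disc. *)
Lemma T_null_boundary (d : R) : 0 < d ->
  exists N, forall n, (N <= n)%N -> modulus (T (f n) zeta) < d.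
Proof.
move=> d0; have M0' := M0; apply: contrapT => nH.
have Hd N : exists2 n, (N <= n)%N & d <= modulus (T (f n) zeta).
  apply: contrapT => nN; apply: nH; exists N => n Nn.
  by rewrite ltNge; apply/negP => dn; apply: nN; exists n.
(* The upper parameter is universally quantified: after a block ending at [x], the remaining ones
   start from [x], and the majorants telescope to [4 * rbump y]. *)
have key k : forall y : R, 0 < y -> exists e : H,
    (forall z, disc z -> modulus (e z) <= 4 * rbump y (modulus (lam zeta z))) /\
    exists2 x : R, k%:R * (d / 3) <= x & T e zeta = x%:C.
  elim: k => [|k IHk] y y0.
    exists 0; split=> [z Dz|].
      by rewrite fs_zero modulus0 mulr_ge0// rbump_ge0// modulus_ge0.
    by exists 0; rewrite ?mul0r// linear0 fs_zero.
  have [x [e [x0 xy ez [a ad Ta]]]] := T_block d0 y0 Hd.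
  have [e' [ez' [b bd Tb]]] := IHk x x0.
  exists (e + e'); split=> [z Dz|].
    rewrite fs_add; apply: le_trans (modulusD _ _) _.
    by have := ez z Dz; have := ez' z Dz; rewrite mulrBr; lra.
  exists (a + b); last by rewrite linearD fs_add Ta Tb rmorphD.
  by rewrite -natr1 mulrDl mul1r addrC lerD.
(* With [2^k] blocks the value at [zeta] exceeds [4 M], although the norm of the sum is at most
   4. *)
have [k Hk] := @two_pow_unbounded R (4 * M / (d / 3)).
have [e [ez [x xk Tx]]] := key (2 ^ k)%N 1 ltr01.
have e4 : snorm e <= 4.
  apply: (@snorm_le R Hinf) => // z Dz; apply: le_trans (ez z Dz) _.
  rewrite -[leRHS]mulr1 ler_wpM2l// rbump_le1// ?modulus_ge0//.
have := T_bound TM e Dzeta; rewrite Tx modulus_real.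
rewrite ltr_pdivrMr in Hk; last lra.
rewrite natrX in xk; have := ler_norm x; have := ler_wpM2l M0 e4; lra.
Qed.

End boundary.

Lemma T_null z (d : R) : closed_disc z -> 0 < d ->
  exists N, forall n, (N <= n)%N -> modulus (T (f n) z) < d.
Proof.
rewrite closed_discE le_eqVlt => /orP[/eqP z1|z1] d0; first exact: T_null_boundary.
have [N HN] := T_null_inner z1 (divr_gt0 d0 (ltr0Sn _ 1)).
by exists N => n Nn; apply: le_lt_trans (HN n Nn z (lexx _)) _; lra.
Qed.

End null_sequences.

(** * Simons' argument *)

Section weakly_null.
Variables (R : realType) (g : Cplx R -> Cplx R).
Hypothesis ag : analytic disc g.
Local Notation C := (Cplx R).
Local Notation H := (fs_elt (@Hinf R)).
Local Notation A := (fs_elt (@disc_algebra R)).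

Lemma disc_algebra_norming (h : A) : exists2 b, closed_disc b & modulus (h b) = snorm h.
Proof.
have [U UU _] := ultra_nat.
have exb (n : nat) : exists b, closed_disc b /\ snorm h - (2 ^+ n)^-1 < modulus (h b).
  have hs : has_sup [set modulus (h z) | z in @closed_disc R].
    split; first by exists (modulus (h 0)), 0 => //; rewrite closed_discE modulus0.
    by exists (snorm h) => _ [z Dz <-]; exact: (@snorm_ub R disc_algebra).
  have p0 : 0 < (2 ^+ n : R)^-1 by rewrite invr_gt0 exprn_gt0.
  by have [_ [z Dz <-] Hz] := sup_adherent p0 hs; exists z.
have [x Hx] := choice exb.
have [V VV Vn] := ultra_nat.
have [b xb] : exists b, ulim V x b.
  apply: (@ulim_ex R _ V VV x 1); apply: filterS filterT => n _ /=.
  by have [] := Hx n; rewrite closed_discE.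
have Db : closed_disc b.
  rewrite closed_discE -[b]subr0; apply: (ulim_le VV xb).
  by apply: filterS filterT => n _ /=; have [] := Hx n; rewrite closed_discE subr0.
exists b => //; apply/eqP; rewrite eq_le (@snorm_ub R disc_algebra)//=.
apply/ler_addgt0Pr => e e0; have e2 : 0 < e / 2 by lra.
have [d d0 Hd] := disc_algebra_cont h Db e2.
have [N HN] := @two_pow_unbounded R (e / 2)^-1.
have [n [/= nb Nn]] := filter_ex (filterI (xb d d0) (Vn N)).
have [Dx hx] := Hx n; have := Hd _ Dx nb; have := le_modulusB (h (x n)) (h b).
have : (2 ^+ n)^-1 <= e / 2.
  rewrite -[leRHS]invrK lef_pV2 ?posrE ?invr_gt0 ?exprn_gt0//.
  by apply: le_trans (ltW HN) _; rewrite ler_eXn2l// ltr1n.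
lra.
Qed.

Lemma le_geometric (x y c : R) (n : nat) :
  (forall m, (n <= m)%N -> x <= y + c / 2 ^+ m) -> x <= y.
Proof.
move=> Hx; apply/ler_addgt0Pr => e e0.
have [N HN] := @two_pow_unbounded R (c / e).
have := Hx (maxn n N) (leq_maxl _ _).
have : c / 2 ^+ maxn n N <= e; last lra.
have p2 m : 0 < (2 : R) ^+ m by rewrite exprn_gt0.
rewrite ler_pdivrMr// mulrC -ler_pdivrMr//; apply: le_trans (ltW HN) _.
by rewrite ler_eXn2l ?ltr1n// leq_maxr.
Qed.

Variable T : {linear H -> A}.
Hypothesis TT : is_Tg g T.
Variable M : R.
Hypothesis M0 : 0 <= M.
Hypothesis TM : forall f : H, snorm (T f) <= M * snorm f.
Variables (S : H -> C) (K : R).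
Hypothesis Slin : forall c x y, S (c *: x + y) = c * S x + S y.
Hypothesis K0 : 0 <= K.
Hypothesis SK : forall x, modulus (S x) <= K * snorm (T x).

(** The bound 2 is that of a difference of two elements of the unit ball. *)
Definition null_seq (f : nat -> H) :=
  (forall n, snorm (f n) <= 2) /\
  forall r d : R, r < 1 -> 0 < d -> exists N, forall n, (N <= n)%N ->
    forall z, modulus z <= r -> modulus (f n z) <= d.

Let S0 : S 0 = 0.
Proof.
by apply/eqP; rewrite -modulus_eq0 eq_le modulus_ge0 andbT; apply: le_trans (SK 0) _;
  rewrite linear0 (_ : snorm 0 = 0) ?mulr0//; apply: (@complexI R); rewrite -normE normr0.
Qed.

Let SD x y : S (x + y) = S x + S y.
Proof. by rewrite -{1}[x]scale1r Slin mul1r. Qed.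

Let SZ c x : S (c *: x) = c * S x.
Proof. by rewrite -[c *: x]addr0 Slin S0 addr0. Qed.

(* [D n] contains the closed convex hull of the tail of [f];
   [e n] almost minimizes the norm of [T (a n + 2^-n e)] over [D n], and the
   limit [E] of the [a n] is tested at a point where [T E] attains its norm. *)
Lemma simons (f : nat -> H) (d : R) : null_seq f -> 0 < d ->
  exists n, complex.Re (S (f n)) < d.
Proof.
move=> [f2 f_null] d0; apply: contrapT => nH.
have M0' := M0; have K0' := K0.
have Sf n : d <= complex.Re (S (f n)).
  by rewrite leNgt; apply/negP => h; apply: nH; exists n.
(* The third clause expresses membership in the hull of the tail by pointwise bounds only, which
   pass to the infinite combinations formed below. *)
pose D n (e : H) := [/\ snorm e <= 2, d <= complex.Re (S e) &
  forall b s, closed_disc b -> (forall k, (n <= k)%N -> modulus (T (f k) b) <= s) ->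
    modulus (T e b) <= s].
have Df n : D n (f n) by split => // b s _; exact.
pose p (e : H) := snorm (T e).
pose q n : C := ((2 ^+ n)^-1)%:C.
(* The proof ends with [p E <= 3 x0], hence [Re (S E) <= 3 K x0 < d], against [d <= Re (S E)]. *)
pose x0 := d / (4 * (K + 1)).
have x00 : 0 < x0 by rewrite divr_gt0// mulr_gt0//; lra.
have exE (na : nat * H) : exists e : H, D na.1 e /\ forall e', D na.1 e' ->
    p (na.2 + q na.1 *: e) <= p (na.2 + q na.1 *: e') + x0 / 4 ^+ na.1.
  case: na => n a /=; pose E := [set p (a + q n *: e) | e in D n].
  have iE : has_inf E.
    split; first by exists (p (a + q n *: f n)), (f n).
    by exists 0 => _ [e _ <-]; exact: snorm_ge0.
  have y0 : 0 < x0 / 4 ^+ n by rewrite divr_gt0// exprn_gt0.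
  have [_ [e De <-] He] := inf_adherent y0 iE; exists e; split => // e' De'.
  apply: ltW; apply: lt_le_trans He _; rewrite lerD2r; apply: ge_inf; last by exists e'.
  by have [] := iE.
have [pick Hpick] := choice exE.
(* [pick (k, a k)] is selected with weight [2^-k], the whole remaining mass, but enters with half of
   it, [2^-(k+1)]. Hence [a n + q n *: e n] is [2 a (n+1) - a n], as used in [near_min]. *)
pose a := fix a n : H := if n is k.+1 then a k + q k.+1 *: pick (k, a k) else 0.
pose e n := pick (n, a n).
have De n : D n (e n) by have [] := Hpick (n, a n).
have aS n : a n.+1 = a n + q n.+1 *: e n by [].
have p2 n : 0 < (2 : R) ^+ n by rewrite exprn_gt0.
have qS n : (2 ^+ n : R)^-1 - (2 ^+ n.+1)^-1 = (2 ^+ n.+1)^-1.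
  by rewrite exprS invfM; field; rewrite gt_eqF.
have mq n : modulus (q n) = (2 ^+ n)^-1 by rewrite modulus_real gtr0_norm// invr_gt0.
have Dle n m x : (n <= m)%N -> D m x -> D n x.
  by move=> nm [h1 h2 h3]; split => // b s Db Hs; apply: h3 => // k /(leq_trans nm); exact: Hs.
have a_step n z : disc z -> modulus (a n.+1 z - a n z) <= 1 / 2 ^+ n.
  move=> Dz; rewrite aS fs_add fs_scale addrC addKr modulusM mq.
  have [e2 _ _] := De n; have [_ /(_ z Dz) ez] := Hinf_ball (e n).
  have me := le_trans ez e2; have u0 : 0 < (2 ^+ n.+1 : R)^-1 by rewrite invr_gt0.
  rewrite div1r; move: (qS n) u0 me; move: (2 ^+ n.+1)^-1 (2 ^+ n)^-1 (modulus _) => u v w.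
  by move=> uv u0 me; nra.
have exF z : exists l, disc z -> forall n, modulus (l - a n z) <= 2 * 1 / 2 ^+ n.
  have [Dz|nD] := pselect (disc z); last by exists 0.
  by have [l Hl] := geometric_limit (fun n => a_step n z Dz); exists l.
have [F HF] := choice exF.
have a_norm n : snorm (a n) <= 2 - 2 / 2 ^+ n.
  elim: n => [|n IHn].
    by rewrite expr0 divr1 subrr (_ : snorm 0 = 0)//; apply: (@complexI R); rewrite -normE normr0.
  rewrite aS; apply: le_trans (snormD _ _) _; rewrite snormZ mq.
  have [e2 _ _] := De n; have := qS n; have : 0 < (2 ^+ n.+1 : R)^-1 by rewrite invr_gt0.
  move: (2 ^+ n.+1)^-1 (2 ^+ n)^-1 IHn => u v IHn u0 uv; nra.
have [U UU Un] := ultra_nat.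
have Fball : analytic_ball 2 F.
  apply: (@analytic_ball_ulim R _ U UU 2 (fun n => a n) F) => [|z Dz].
    apply: filterS filterT => n _ /=; have [aa ab] := Hinf_ball (a n); split => // z Dz.
    apply: le_trans (ab z Dz) _; apply: le_trans (a_norm n) _.
    by rewrite gerBl divr_ge0// ltW.
  move=> t t0; have [N HN] := @two_pow_unbounded R (2 / t).
  apply: filterS (Un N) => n /= Nn; rewrite modulusBC; apply: le_lt_trans (HF z Dz n) _.
  rewrite mulr1 ltr_pdivrMr// mulrC -ltr_pdivrMr//; apply: lt_le_trans HN _.
  by rewrite ler_eXn2l// ltr1n.
have [E [EF E2]] := Hinf_exists Fball.
have Ea n : snorm (E - a n) <= 2 / 2 ^+ n.
  apply: (@snorm_le R Hinf) => [|z Dz]; first by rewrite divr_ge0// ltW.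
  by rewrite fs_sub EF//; have := HF z Dz n; rewrite mulr1.
have tail_S n m : (n <= m)%N ->
    d * ((2 ^+ n)^-1 - (2 ^+ m)^-1) <= complex.Re (S (a m - a n)).
  move=> /subnKC <-; elim: (m - n)%N => [|j IHj]; first by rewrite addn0 !subrr S0 mulr0.
  rewrite addnS aS addrAC SD SZ cReD cReZ.
  have [_ Se _] := De (n + j)%N; have := qS (n + j)%N.
  have : 0 < (2 ^+ (n + j).+1 : R)^-1 by rewrite invr_gt0.
  move: (2 ^+ (n + j).+1)^-1 (2 ^+ (n + j))^-1 IHj => u v IHj u0 uv; nra.
have tail_T n m b s : (n <= m)%N -> closed_disc b ->
    (forall k, (n <= k)%N -> modulus (T (f k) b) <= s) ->
    modulus (T (a m - a n) b) <= s * ((2 ^+ n)^-1 - (2 ^+ m)^-1).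
  move=> /subnKC <- Db Hs.
  elim: (m - n)%N => [|j IHj]; first by rewrite addn0 !subrr linear0 modulus0 mulr0.
  rewrite addnS aS addrAC linearD linearZ fs_add fs_scale.
  apply: le_trans (modulusD _ _) _; rewrite modulusM mq.
  have [_ _ /(_ b s Db)] := De (n + j)%N => /(_ _)Te.
  have {}Te : modulus (T (e (n + j)%N) b) <= s.
    by apply: Te => k nk; apply: Hs; apply: leq_trans nk; exact: leq_addr.
  have := qS (n + j)%N; have : 0 < (2 ^+ (n + j).+1 : R)^-1 by rewrite invr_gt0.
  move: (2 ^+ (n + j).+1)^-1 (2 ^+ (n + j))^-1 IHj => u v IHj u0 uv; nra.
(* The normalized tail of [E]. It belongs to [D n] and satisfies [E = a n + q n *: x n], so it
   competes with [e n], whose choice is thereby compared with [E] itself. *)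
pose x n := (2 ^+ n : R)%:C *: (E - a n).
have m2 n : modulus ((2 ^+ n : R)%:C : C) = 2 ^+ n by rewrite modulus_real gtr0_norm.
have xE n : E = a n + q n *: x n.
  rewrite /x scalerA -rmorphM /= mulVf ?gt_eqF// scale1r addrC subrK.
  by [].
have Sx n : d / 2 ^+ n <= complex.Re (S (E - a n)).
  apply: (@le_geometric _ _ (d + K * (M * 2)) n) => m nm.
  have -> : E - a n = (a m - a n) + (E - a m) by rewrite [RHS]addrC addrA subrK.
  rewrite SD cReD; have := tail_S n m nm; rewrite mulrBr.
  have : - complex.Re (S (E - a m)) <= K * (M * 2) / 2 ^+ m.
    apply: le_trans (ler_norm _) _; rewrite normrN; apply: le_trans (Re_le_modulus _) _.
    apply: le_trans (SK _) _; rewrite -mulrA ler_wpM2l//.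
    by apply: le_trans (TM _) _; rewrite -mulrA ler_wpM2l.
  by rewrite mulrDl; lra.
have Dx n : D n (x n).
  split.
  - rewrite snormZ m2 mulrC -ler_pdivlMr//; exact: Ea.
  - by rewrite SZ cReZ mulrC -ler_pdivrMr.
  - move=> b s Db Hs; rewrite linearZ fs_scale modulusM m2 mulrC -ler_pdivlMr//.
    have s0 : 0 <= s by apply: le_trans (Hs n (leqnn n)); exact: modulus_ge0.
    apply: (@le_geometric _ _ (M * 2) n) => m nm.
    have -> : E - a n = (a m - a n) + (E - a m) by rewrite [RHS]addrC addrA subrK.
    rewrite linearD fs_add; apply: le_trans (modulusD _ _) _; apply: lerD.
      apply: le_trans (tail_T n m b s nm Db Hs) _; rewrite ler_wpM2l// gerBl invr_ge0 ltW//.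
    by apply: le_trans (T_bound TM _ Db) _; rewrite -mulrA ler_wpM2l.
have near_min n : p (a n.+1 + a n.+1 - a n) <= p E + x0 / 4 ^+ n.
  have -> : a n.+1 + a n.+1 - a n = a n + q n *: e n.
    have -> : q n = q n.+1 + q n.+1.
      by rewrite /q -rmorphD /=; congr (_%:C); have := qS n; lra.
    rewrite scalerDl aS; move: (a n) (q n.+1 *: e n) => u X.
    by rewrite -addrA [u + X - u]addrAC subrr add0r addrA.
  by have [_ /(_ _ (Dx n))] := Hpick (n, a n); rewrite /= -xE.
have [b Db pb] := disc_algebra_norming (T E).
have [c c1 cb] := exists_unimodular (T E b); rewrite pb in cb.
(* [2^n * dd n] is [Re (c * T (x n) b)]. It starts at the norm of [T E] and, by [near_min] evaluated
   at [b], loses at most [x0 / 2^n] at step [n], hence less than [2 x0] in all. *)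
pose dd n := complex.Re (c * T (E - a n) b).
have dd0 : dd 0%N = p E by rewrite /dd subr0 cb.
have dd_step n : dd n - 2 * dd n.+1 <= x0 / 4 ^+ n.
  have -> : dd n - 2 * dd n.+1 = complex.Re (c * T (a n.+1 + a n.+1 - a n) b) - p E.
    have -> : p E = complex.Re (c * T E b) by rewrite cb.
    rewrite /dd; move: (a n) (a n.+1) => u v.
    have TB2 y z : T (y - z) b = T y b - T z b by rewrite linearB fs_sub.
    have TD2 y z : T (y + z) b = T y b + T z b by rewrite linearD fs_add.
    rewrite !TB2 TD2; move: (T E b) (T u b) (T v b) => t1 t2 t3.
    by rewrite !mulrBr !mulrDr !(cReD, cReN); ring.
  rewrite lerBlDr [_ / _ + _]addrC; apply: le_trans (near_min n).
  apply: le_trans (ler_norm _) _; apply: le_trans (Re_le_modulus _) _.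
  by rewrite modulusM c1 mul1r; exact: (@snorm_ub R disc_algebra).
have dd_ge n : p E - 2 * x0 * (1 - (2 ^+ n)^-1) <= 2 ^+ n * dd n.
  elim: n => [|n IHn]; first by rewrite expr0 invr1 subrr mulr0 subr0 mul1r dd0.
  have h := ler_wpM2l (ltW (p2 n)) (dd_step n).
  have E4 : 2 ^+ n * (x0 / 4 ^+ n) = x0 * (2 ^+ n)^-1.
    have -> : (4 : R) = 2 * 2 by lra.
    by rewrite exprMn; field; rewrite gt_eqF.
  rewrite E4 in h; have := qS n; rewrite exprSr; move: h IHn.
  move: (dd n) (dd n.+1) (2 ^+ n) (2 ^+ n)^-1 (2 ^+ n * 2)^-1 => u v w y t h IHn q1.
  have tE : t = y / 2 by lra.
  rewrite {q1}tE; lra.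
(* From [N] on the tail is below [x0] at [b], hence so is [T (x N)]; with the previous lower bound,
   [p E - 2 x0 <= x0]. *)
have [N HN] := T_null ag TT M0 TM f2 f_null Db x00.
have [_ _ /(_ b x0 Db)] := Dx N => /(_ _) h.
have {}h : modulus (T (x N) b) <= x0 by apply: h => k /HN /ltW.
have : 2 ^+ N * dd N <= modulus (T (x N) b).
  rewrite linearZ fs_scale modulusM m2 ler_wpM2l ?(ltW (p2 N))//.
  apply: le_trans (ler_norm _) _; apply: le_trans (Re_le_modulus _) _.
  by rewrite modulusM c1 mul1r.
have := dd_ge N; have : 0 < (2 ^+ N : R)^-1 by rewrite invr_gt0.
move: (2 ^+ N)^-1 => u u0 h1 h2.
have pE : p E <= 3 * x0 by nra.
have := Sx 0%N; rewrite expr0 divr1 subr0 => h3.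
have h4 := le_trans (ler_norm _) (Re_le_modulus (S E)).
have h5 := SK E; rewrite -/(p E) in h5.
have : x0 * (4 * (K + 1)) = d by rewrite /x0 divfK// gt_eqF// mulr_gt0//; lra.
nra.
Qed.

(** Rotating each [f n] makes [S (f n)] a nonnegative real, so that the bound on real parts bounds
    the modulus. *)
Lemma S_null (f : nat -> H) (d : R) : null_seq f -> 0 < d ->
  exists n, modulus (S (f n)) < d.
Proof.
move=> [f2 f_null] d0.
have exc n : exists c, modulus c = 1 /\ c * S (f n) = (modulus (S (f n)))%:C.
  by have [c] := exists_unimodular (S (f n)); exists c.
have [c Hc] := choice exc.
have [|n] := @simons (fun n => c n *: f n) d _ d0.
  split=> [n|r e r1 e0]; first by have [c1 _] := Hc n; rewrite snormZ c1 mul1r.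
  have [N HN] := f_null r e r1 e0; exists N => n Nn z zr.
  by have [c1 _] := Hc n; rewrite fs_scale modulusM c1 mul1r; exact: HN.
by have [_ E] := Hc n; rewrite SZ E /=; exists n.
Qed.

End weakly_null.

(** * The equivalences *)

Section operators.
Variables (R : realType) (g : Cplx R -> Cplx R).
Hypothesis ag : analytic disc g.
Local Notation C := (Cplx R).
Local Notation H := (fs_elt (@Hinf R)).
Local Notation A := (fs_elt (@disc_algebra R)).

Lemma inv_two_pow_lt (d : R) : 0 < d ->
  exists N, forall n, (N <= n)%N -> (2 ^+ n : R)^-1 < d.
Proof.
move=> d0; have [N HN] := @two_pow_unbounded R d^-1; exists N => n Nn.
rewrite -[d]invrK ltf_pV2 ?posrE ?invr_gt0 ?exprn_gt0//.
by apply: lt_le_trans HN _; rewrite ler_eXn2l// ltr1n.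
Qed.

Lemma inv_two_pow_gt0 n : 0 < (2 ^+ n : R)^-1.
Proof. by rewrite invr_gt0 exprn_gt0. Qed.

Lemma linear_exists (X Y : fun_space R) (L : fs_elt X -> fs_elt Y) :
  (forall c f h, L (c *: f + h) = c *: L f + L h) ->
  exists T : {linear fs_elt X -> fs_elt Y}, forall f, T f = L f.
Proof.
move=> Llin; have Ll : linear L by move=> c f h; exact: Llin.
pose lin : {linear fs_elt X -> fs_elt Y} :=
  HB.pack L (GRing.isLinear.Build _ _ _ _ L Ll).
by exists lin.
Qed.

(** [T'] is T_g with a possibly different target, and [phi \o T'] is the functional given to Simons'
    argument. The domination by the norm of [T x] in [A] is what allows functionals that are not
    defined on [A]. *)
Lemma weakly_compact_through_disc_algebra (Y : fun_space R) (T : {linear H -> A})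
    (T' : {linear H -> fs_elt Y}) : is_Tg g T -> bounded_op T -> bounded_op T' ->
  (forall phi : dual (fs_elt Y), exists2 K : R, 0 <= K &
    forall x, modulus (sval phi (T' x)) <= K * snorm (T x)) ->
  weakly_compact T'.
Proof.
move=> TT /bounded_opP[M M0 TM] bT' HK; apply: weakly_compact_of_ulim => // I U x UU x1.
have xball i : analytic_ball 1 (x i).
  have [ax xb] := Hinf_ball (x i); split => // z Dz; exact: le_trans (xb z Dz) (x1 i).
have exF z : exists l, disc z -> ulim U (fun i => x i z) l.
  have [Dz|nD] := pselect (disc z); last by exists 0.
  have [|l Hl] := @ulim_ex R _ U UU (fun i => x i z) 1; last by exists l.
  by apply: filterS filterT => i _; exact: (xball i).2.
have [F HF] := choice exF.
have UB : U [set i | analytic_ball 1 (x i)] by apply: filterS filterT => i _; exact: xball.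
have FB := analytic_ball_ulim UU UB HF.
have [x0 [x0F x01]] := Hinf_exists FB; exists x0 => // phi e e0.
have [K K0 SK] := HK phi.
have [//|G] := in_ultra_setVsetC [set i | modulus (sval phi (T' (x i)) - sval phi (T' x0)) < e] UU.
exfalso.
(* Uniform convergence on each smaller disc lets a sequence be extracted from the ultrafilter: the
   [n]-th index is good up to [2^-n] on [|z| <= 1 - 2^-n] while the functional stays [e] away. *)
have exi (n : nat) : exists i, e <= modulus (sval phi (T' (x i)) - sval phi (T' x0)) /\
    forall z, modulus z <= 1 - (2 ^+ n)^-1 -> modulus (x i z - x0 z) < (2 ^+ n)^-1.
  have r1 : 1 - (2 ^+ n : R)^-1 < 1 by rewrite gtrBl inv_two_pow_gt0.
  have V := ulim_uniform UU UB HF r1 (inv_two_pow_gt0 n).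
  have [i [/= Gi Vi]] := filter_ex (filterI G V); exists i; split.
    by rewrite leNgt; apply/negP => h; exact: Gi.
  move=> z zr; rewrite x0F; first exact: Vi.
  by rewrite discE (le_lt_trans zr).
have [s Hs] := choice exi.
pose f n := x (s n) - x0.
have fnull : null_seq f.
  split=> [n|r d r1 d0].
    rewrite /f -scaleN1r; apply: le_trans (snormD _ _) _.
    by rewrite snormZ modulusN modulus1 mul1r -[2]/(1 + 1) lerD.
  have r10 : 0 < 1 - r by lra.
  have [N HN] := inv_two_pow_lt r10; have [N' HN'] := inv_two_pow_lt d0.
  exists (maxn N N') => n; rewrite geq_max => /andP[Nn N'n] z zr.
  have [_ Hz] := Hs n; rewrite fs_sub; apply: le_trans (ltW (HN' n N'n)).
  by apply: ltW; apply: Hz; have := HN n Nn; lra.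
have Slin c (a b : H) : sval phi (T' (c *: a + b)) = c * sval phi (T' a) + sval phi (T' b).
  by rewrite !linearP.
have [n Hn] := S_null ag TT M0 TM Slin K0 SK fnull e0.
have [en _] := Hs n; move: Hn; rewrite /f linearB linearB ltNge => /negP; exact.
Qed.

(** * Continuous extension to the closed disc *)

Section extension.
Variable u : C -> C.
Hypothesis au : analytic disc u.
Variable B : R.
Hypothesis uB : forall z, disc z -> modulus (u z) <= B.
Hypothesis cauchy_u : forall zeta, modulus zeta = 1 -> forall e : R, 0 < e ->
  exists2 d : R, 0 < d & forall z w, disc z -> disc w -> modulus (z - zeta) < d ->
    modulus (w - zeta) < d -> modulus (u z - u w) < e.

(** Boundary values are limits of [u] along radii, taken along one ultrafilter for all [z]. The
    Cauchy condition, applied to the two dilated points, gives continuity at the boundary. *)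
Lemma disc_algebra_extension : exists h : A, forall z, disc z -> h z = u z.
Proof.
have [U UU Un] := ultra_nat.
pose r n : R := 1 - (2 ^+ n.+1)^-1.
have r0 n : 0 <= r n.
  by rewrite subr_ge0 invf_le1 ?exprn_gt0// exprn_ege1// ler1n.
have r1 n : r n < 1 by rewrite gtrBl inv_two_pow_gt0.
have rD n z : closed_disc z -> disc ((r n)%:C * z).
  rewrite closed_discE discE modulusM modulus_real ger0_norm// => z1.
  by have := modulus_ge0 z; have := r1 n; have := r0 n; nra.
have rz (d : R) : 0 < d -> exists N, forall n, (N <= n)%N -> forall z, closed_disc z ->
    modulus ((r n)%:C * z - z) < d.
  move=> d0; have [N HN] := inv_two_pow_lt d0; exists N => n Nn z.
  have E (q : R) : q%:C * z - z = (q - 1)%:C * z by rewrite rmorphB /=; ring.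
  rewrite closed_discE E => z1.
  rewrite modulusM modulus_real; have -> : r n - 1 = - (2 ^+ n.+1)^-1 by rewrite /r; ring.
  rewrite normrN gtr0_norm ?inv_two_pow_gt0//.
  apply: le_lt_trans (HN n.+1 (leqW Nn)); rewrite ler_piMr// ltW// inv_two_pow_gt0.
have exF z : exists l, closed_disc z -> ulim U (fun n => u ((r n)%:C * z)) l.
  have [Dz|nD] := pselect (closed_disc z); last by exists 0.
  have [|l Hl] := @ulim_ex R _ U UU (fun n => u ((r n)%:C * z)) B; last by exists l.
  by apply: filterS filterT => n _; apply: uB; exact: rD.
have [F HF] := choice exF.
have Fu z : disc z -> F z = u z.
  move=> Dz; have Dcz := disc_closed_disc Dz; apply: (ulim_unique UU (HF z Dcz)) => e e0.
  have [d d0 Hd] := analytic_ccont au Dz e0; have [N HN] := rz d d0.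
  by apply: filterS (Un N) => n Nn; apply: Hd; exact: HN.
have [||h hF] := @disc_algebra_exists R F.
- move=> z Dz; have z1 := Dz; rewrite discE in z1.
  apply: (@cdiff_derivable _ _ _ (derive1 u z)); apply: (@cdiff_ext _ u); last exact: analytic_cdiff.
  exists (1 - modulus z) => [|w wz]; first by lra.
  by rewrite Fu// discE; have := le_modulusB w z; lra.
- move=> z Dz e e0; have := Dz; rewrite closed_discE le_eqVlt => /orP[/eqP z1|z1].
    have e2 : 0 < e / 2 by lra.
    have [d d0 Hd] := cauchy_u z1 e2; have d2 : 0 < d / 2 by lra.
    have [N HN] := rz _ d2.
    exists (d / 2) => // w Dw wz.
    apply: (@le_lt_trans _ _ (e / 2)); last lra.
    have L := ulimD UU (HF w Dw) (ulimZ UU (-1) (HF z Dz)).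
    have -> : F w - F z = F w + -1 * F z - 0 by ring.
    apply: (ulim_le UU L); apply: filterS (Un N) => n /= Nn.
    have -> : u ((r n)%:C * w) + -1 * u ((r n)%:C * z) - 0 = u ((r n)%:C * w) - u ((r n)%:C * z) by ring.
    apply: ltW; apply: Hd; [exact: rD|exact: rD| |].
      apply: le_lt_trans (modulus_triangle w _ _) _; have := HN n Nn w Dw; lra.
    by have := HN n Nn z Dz; lra.
  have Dz1 : disc z by rewrite discE.
  have [d d0 Hd] := analytic_ccont au Dz1 e0.
  exists (Num.min d (1 - modulus z)) => [|w Dw]; first by rewrite lt_min d0 subr_gt0.
  rewrite lt_min => /andP[wd wz]; rewrite !Fu//; first exact: Hd.
  by rewrite discE; have := le_modulusB w z; lra.
by exists h => z Dz; rewrite hF ?Fu//; exact: disc_closed_disc.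
Qed.

End extension.

(** An element of [A] is determined by its values on the open disc, so any choice of extensions is
    linear; the norm bound passes to the closed disc by continuity. *)
Lemma Tg_bounded_of_extension (T0 : {linear H -> H}) : is_Tg g T0 -> bounded_op T0 ->
  (forall f : H, snorm f <= 1 -> exists h : A, forall z, disc z -> h z = T0 f z) ->
  Tg_bounded g Hinf disc_algebra.
Proof.
move=> TT /bounded_opP[M M0 TM] ext.
have ext' (f : H) : exists h : A, forall z, disc z -> h z = T0 f z.
  (* The added 1 keeps the scaling factor nonzero for [f = 0]. *)
  pose c := snorm f + 1; have c0 : 0 < c by rewrite ltr_wpDl// snorm_ge0.
  have cC : (c%:C : C) != 0 by rewrite -modulus_gt0 modulus_real normr_gt0 gt_eqF.
  have [|h hE] := ext (c%:C^-1 *: f).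
    by rewrite snormZ modulusV modulus_real gtr0_norm// mulrC ler_pdivrMr// mul1r lerDl.
  exists (c%:C *: h) => z Dz; rewrite fs_scale hE// linearZ fs_scale mulrA divff// mul1r.
  by [].
have [L HL] := choice ext'.
have [c f h|T TE] := @linear_exists Hinf disc_algebra L.
  apply: disc_algebra_ext => z Dz.
  by rewrite fs_lin !HL// linearP fs_lin.
exists T; split=> [f z Dz|]; first by rewrite TE HL// TT.
apply/bounded_opP; exists M => // f; apply: (@snorm_le R disc_algebra).
  by rewrite mulr_ge0// snorm_ge0.
move=> z Dz; apply: disc_algebra_le => // w Dw; rewrite TE HL//.
by apply: le_trans (TM f); exact: (@snorm_ub R Hinf).
Qed.

End operators.

(** * The four implications *)

Section implications.
Variables (R : realType) (g : Cplx R -> Cplx R).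
Hypothesis ag : analytic disc g.
Local Notation C := (Cplx R).
Local Notation H := (fs_elt (@Hinf R)).
Local Notation A := (fs_elt (@disc_algebra R)).

(* Integration by parts removes the derivative of [g]: with [p = 1 - bump zeta y]
   and [u = T f], [T e - p * u] has the bounded derivative [- p' * u]. *)
Lemma Tg_bumpC_oscillation (T : {linear H -> H}) (f e : H) zeta (y B : R) z w :
  is_Tg g T -> modulus zeta = 1 -> 0 < y ->
  (forall z, disc z -> e z = f z * (1 - bump zeta y z)) ->
  (forall z, disc z -> modulus (T f z) <= B) -> disc z -> disc w ->
  modulus (T e z - T e w) <=
    B / y * (modulus (z - w) + modulus (z - zeta) + modulus (w - zeta)).
Proof.
move=> TT zeta1 y0 eE TB Dz Dw.
have B0 : 0 <= B by apply: le_trans (TB 0 (disc0 R)); exact: modulus_ge0.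
have By : 0 <= B / y by rewrite divr_ge0// ltW.
pose dbump v := y%:C / zeta / ((y%:C + lam zeta v) * (y%:C + lam zeta v)).
pose P v := (1 - bump zeta y v) * T f v - T e v.
have dT (h : H) v : disc v -> cdiff (T h) v (h v * derive1 g v).
  have [ah _] := Hinf_ball h; have [aTh _] := Hinf_ball (T h).
  exact: (Tg_cdiff ag ah aTh (TT h)).
have dP v : disc v -> cdiff P v (- dbump v * T f v).
  move=> Dv; have Dcv := disc_closed_disc Dv.
  have := cdiffB (cdiffM (cdiffB (cdiff_cst 1 v) (cdiff_bump zeta1 y0 Dcv)) (dT f v Dv))
    (dT e v Dv).
  by congr cdiff; rewrite eE// sub0r -/(dbump v); ring.
have HP : modulus (P z - P w) <= B / y * modulus (z - w).
  have := @mean_value_le R (fun t => P (w + t%:C * (z - w)))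
    (fun t => - dbump (w + t%:C * (z - w)) * T f (w + t%:C * (z - w)) * (z - w))
    (B / y * modulus (z - w)) 0 1 ler01.
  rewrite mul0r addr0 mul1r [w + _]addrC subrK subr0 mulr1; apply => t t01.
    by apply: rdiff_line; apply: dP; exact: convexC_disc.
  have Dt := convexC_disc Dw Dz t01.
  rewrite modulusM ler_wpM2r ?modulus_ge0// modulusM modulusN mulrC.
  apply: ler_pM; rewrite ?modulus_ge0//; first exact: TB.
  by apply: modulus_bump_derive => //; exact: disc_closed_disc.
(* The boundary term is small because [|1 - bump|] is at most [|v - zeta| / y]. *)
have Q v : disc v -> modulus ((1 - bump zeta y v) * T f v) <= B / y * modulus (v - zeta).
  move=> Dv; rewrite modulusM -(modulus_lam zeta1) mulrC mulrAC -mulrA.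
  apply: ler_pM; rewrite ?modulus_ge0//; first exact: TB.
  by apply: modulus_bumpC => //; exact: disc_closed_disc.
have -> : T e z - T e w = (1 - bump zeta y z) * T f z - (1 - bump zeta y w) * T f w - (P z - P w).
  by rewrite /P; ring.
apply: le_trans (modulusB_le _ _) _; apply: le_trans (lerD (modulusB_le _ _) (lexx _)) _.
apply: le_trans (lerD (lerD (Q z Dz) (Q w Dw)) HP) _.
by rewrite -!mulrDr ler_wpM2l// [leRHS]addrAC -addrA [leRHS]addrC; lra.
Qed.

(* Boundary jumps of [h] are measured by the bounded functional [Lam], a limit
   of [h (z n) - h (w n)] along an ultrafilter. *)
Lemma weakly_compact_cauchy (T : {linear H -> H}) (f : H) zeta (e : R) :
  is_Tg g T -> weakly_compact T -> snorm f <= 1 -> modulus zeta = 1 -> 0 < e ->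
  exists2 d : R, 0 < d & forall z w, disc z -> disc w -> modulus (z - zeta) < d ->
    modulus (w - zeta) < d -> modulus (T f z - T f w) < e.
Proof.
move=> TT wT f1 zeta1 e0; apply: contrapT => nd.
(* Failure of the Cauchy condition gives two sequences tending to [zeta] along which [T f] keeps a
   jump of at least [e]. *)
have exzw (n : nat) : exists zw : C * C, [/\ disc zw.1, disc zw.2,
    modulus (zw.1 - zeta) < (2 ^+ n)^-1, modulus (zw.2 - zeta) < (2 ^+ n)^-1 &
    e <= modulus (T f zw.1 - T f zw.2)].
  apply: contrapT => nzw; apply: nd; exists (2 ^+ n)^-1 => [|z w Dz Dw zn wn].
    exact: inv_two_pow_gt0.
  by rewrite ltNge; apply/negP => h; apply: nzw; exists (z, w).
have [s Hs] := choice exzw.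
have [U UU Un] := ultra_nat.
have jump (h : H) n : modulus (h (s n).1 - h (s n).2) <= 2 * snorm h.
  have [D1 D2 _ _ _] := Hs n; apply: le_trans (modulusB_le _ _) _.
  by have := (@snorm_ub R Hinf h _ D1); have := (@snorm_ub R Hinf h _ D2); lra.
have exL (h : H) : exists l, ulim U (fun n => h (s n).1 - h (s n).2) l.
  apply: (@ulim_ex R _ U UU _ (2 * snorm h)).
  by apply: filterS filterT => n _; exact: jump.
have [Lam HLam] := choice exL.
have [c h1 h2|h|phi phiE] := @dual_exists R Hinf Lam 2.
- apply: (ulim_unique UU (HLam _)).
  have := ulimD UU (ulimZ UU c (HLam h1)) (HLam h2).
  by congr (ulim U _ _); apply/funext => n; rewrite !fs_lin; ring.
- rewrite -[Lam h]subr0; apply: (ulim_le UU (HLam h)).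
  by apply: filterS filterT => n _ /=; rewrite subr0; exact: jump.
pose y n : R := (2 ^+ n)^-1.
have y0 n : 0 < y n := inv_two_pow_gt0 R n.
have exE n : exists E : H, (forall z, disc z -> E z = f z * bump zeta (y n) z).
  by have [E [EE _]] := bump_mul zeta1 f (y0 n); exists E.
have [E EE] := choice exE.
pose x n := f - E n.
have xE n z : disc z -> x n z = f z * (1 - bump zeta (y n) z).
  by move=> Dz; rewrite fs_sub EE//; ring.
have fb z : disc z -> modulus (f z) <= 1.
  by move=> Dz; apply: le_trans f1; exact: (@snorm_ub R Hinf).
have x1 n : snorm (x n) <= 1.
  apply: (@snorm_le R Hinf) => // z Dz; rewrite xE// modulusM -[leRHS]mulr1.
  apply: ler_pM; rewrite ?modulus_ge0//; first exact: fb.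
  by apply: modulus_bumpC_le1 => //; exact: disc_closed_disc.
have [v Hv] := weakly_compact_ulim UU wT x1.
(* Evaluations identify the weak limit: on [|q| <= |z|] the removed part [f * bump] is at most
   [y n / (1 - |z|)], hence its image at [z] tends to 0. *)
have vE : v = T f.
  apply: Hinf_ext => z Dz; have [psi psiE] := @dual_eval R Hinf z Dz.
  have := Hv psi; rewrite psiE => Hz; apply: (ulim_unique UU Hz) => d d0.
  have z1 : modulus z < 1 by rewrite -discE.
  have [G G0 HG] := Tg_small ag z1.
  have c0 : 0 < d * (1 - modulus z) / (G + 1) by rewrite divr_gt0 ?mulr_gt0 ?subr_gt0//; lra.
  have [N HN] := inv_two_pow_lt c0.
  apply: filterS (Un N) => n /= Nn; rewrite psiE.
  have -> : T (x n) z - T f z = - T (E n) z by rewrite linearB fs_sub; ring.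
  have [aE _] := Hinf_ball (E n).
  have yz : 0 <= y n / (1 - modulus z) by rewrite divr_ge0 ?(ltW (y0 n))// subr_ge0 ltW.
  rewrite modulusN TT//; apply: le_lt_trans (HG _ _ aE yz _ z (lexx _)) _.
    move=> q qz; have Dq : disc q by rewrite discE (le_lt_trans qz).
    rewrite EE// modulusM -[leRHS]mul1r; apply: ler_pM; rewrite ?modulus_ge0//; first exact: fb.
    have lq : 1 - modulus z <= modulus (lam zeta q).
      rewrite modulus_lam// modulusBC; have := le_modulusB zeta q; lra.
    have l0 : 0 < modulus (lam zeta q) by apply: lt_le_trans lq; rewrite subr_gt0.
    apply: le_trans (modulus_bump zeta1 (y0 n) (disc_closed_disc Dq) l0) _.
    by rewrite ler_wpM2l ?(ltW (y0 n))// lef_pV2 ?posrE// subr_gt0.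
  have q0 : 0 < 1 - modulus z by lra.
  have := HN n Nn; rewrite -/(y n) ltr_pdivlMr; last lra.
  have := y0 n; rewrite mulrA ltr_pdivrMr//; nra.
(* For fixed [n] the oscillation estimate tends to 0 as both points tend to [zeta]. *)
have Lam0 n : Lam (T (x n)) = 0.
  apply: (ulim_unique UU (HLam _)) => d d0; rewrite /=.
  have TB z : disc z -> modulus (T f z) <= snorm (T f) by exact: (@snorm_ub R Hinf).
  have M0 := snorm_ge0 (T f).
  have c0 : 0 < d * y n / (4 * (snorm (T f) + 1)).
    by apply: divr_gt0; apply: mulr_gt0 => //; lra.
  have [N HN] := inv_two_pow_lt c0.
  apply: filterS (Un N) => m /= Nm; rewrite subr0.
  have [D1 D2 h1 h2 _] := Hs m.
  apply: le_lt_trans (Tg_bumpC_oscillation TT zeta1 (y0 n) (xE n) TB D1 D2) _.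
  have h3 : modulus ((s m).1 - (s m).2) <= modulus ((s m).1 - zeta) + modulus ((s m).2 - zeta).
    by apply: le_trans (modulus_triangle zeta _ _) _; rewrite [modulus (zeta - _)]modulusBC.
  have := HN m Nm; rewrite ltr_pdivlMr; last by rewrite mulr_gt0//; lra.
  move=> h4; rewrite mulrAC ltr_pdivrMr//.
  have s4 : modulus ((s m).1 - (s m).2) + modulus ((s m).1 - zeta) +
      modulus ((s m).2 - zeta) <= 4 * (2 ^+ m)^-1 by lra.
  apply: le_lt_trans (ler_wpM2l M0 s4) _; apply: le_lt_trans h4.
  by have := inv_two_pow_gt0 R m; lra.
have LamTf : Lam (T f) = 0.
  have := Hv phi; rewrite phiE vE => Hl; apply: (ulim_unique UU Hl) => d d0.
  by apply: filterS filterT => n _ /=; rewrite phiE Lam0 subrr modulus0.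
have [n /=] := filter_ex (HLam (T f) e e0).
have [_ _ _ _ he] := Hs n; rewrite LamTf subr0 => hl.
by have := le_lt_trans he hl; rewrite ltxx.
Qed.

Lemma weakly_compact_Hinf_bounded : Tg_weakly_compact g Hinf Hinf ->
  Tg_bounded g Hinf disc_algebra.
Proof.
move=> [T [TT wT]]; have [bT _] := wT.
apply: (Tg_bounded_of_extension TT bT) => f f1.
have [aT TB] := Hinf_ball (T f).
apply: (disc_algebra_extension aT TB) => zeta zeta1 e e0.
exact: weakly_compact_cauchy.
Qed.

Lemma dilation (f : H) (r : R) : 0 <= r -> r < 1 ->
  exists h : A, forall z, closed_disc z -> h z = f (r%:C * z).
Proof.
move=> r0 r1; have [af _] := Hinf_ball f.
have Dr z : closed_disc z -> disc (r%:C * z).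
  rewrite closed_discE discE modulusM modulus_real ger0_norm// => z1.
  by have := modulus_ge0 z; nra.
have dF z : closed_disc z ->
    cdiff (fun z => f (r%:C * z)) z (derive1 f (r%:C * z) * (r%:C * 1 + 0 * z)).
  move=> Dz; apply: (cdiff_comp (f := fun z => r%:C * z)) (analytic_cdiff af (Dr z Dz)).
  exact: cdiffM (cdiff_cst r%:C z) (cdiff_id z).
apply: disc_algebra_exists => [z /disc_closed_disc/dF/cdiff_derivable//|z Dz e e0].
by have [d d0 Hd] := cdiff_ccont (dF z Dz) e0; exists d => // w _; exact: Hd.
Qed.

Lemma weakly_compact_disc_algebra_bounded : Tg_bounded g Hinf Hinf ->
  Tg_weakly_compact g disc_algebra disc_algebra -> Tg_bounded g Hinf disc_algebra.
Proof.
move=> [T0 [TT0 bT0]] [T [TT wT]]; apply: (Tg_bounded_of_extension TT0 bT0) => f f1.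
have [U UU Un] := ultra_nat.
pose r n : R := 1 - (2 ^+ n.+1)^-1.
have r0 n : 0 <= r n.
  by rewrite subr_ge0 invf_le1 ?exprn_gt0// exprn_ege1// ler1n.
have r1 n : r n < 1 by rewrite gtrBl inv_two_pow_gt0.
have [x Hx] := choice (fun n => dilation f (r0 n) (r1 n)).
have fb z : disc z -> modulus (f z) <= 1.
  by move=> Dz; apply: le_trans f1; exact: (@snorm_ub R Hinf).
have Dr n z : closed_disc z -> disc ((r n)%:C * z).
  rewrite closed_discE discE modulusM modulus_real ger0_norm// => z1.
  by have := modulus_ge0 z; have := r0 n; have := r1 n; nra.
have x1 n : snorm (x n) <= 1.
  by apply: (@snorm_le R disc_algebra) => // z Dz; rewrite Hx//; apply: fb; exact: Dr.
have [h Hh] := weakly_compact_ulim UU wT x1; exists h => z Dz.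
have [psi psiE] := @dual_eval R disc_algebra z (disc_closed_disc Dz).
have := Hh psi; rewrite psiE => Hz; apply: (ulim_unique UU Hz) => d d0.
have z1 : modulus z < 1 by rewrite -discE.
have [G G0 HG] := Tg_small ag z1.
have [K K0 HK] := @analytic_lipschitz R.
have fball := Hinf_ball f.
(* A Lipschitz constant of [f] on [|w| <= |z|], so that dilation changes [f] there by at most
   [c * 2^-(n+1)]. *)
pose c := K * snorm f / (1 - modulus z); have c0 : 0 <= c.
  by rewrite divr_ge0 ?mulr_ge0 ?snorm_ge0 ?(ltW K0)// subr_ge0 ltW.
have t0 : 0 < d / (G * c + 1) by rewrite divr_gt0// ltr_wpDl// mulr_ge0.
have [N HN] := inv_two_pow_lt t0; apply: filterS (Un N) => n /= Nn; rewrite psiE.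
(* [T] acts on [A] and [T0] on H^oo; they are compared through the restriction [E] of [x n]. *)
have [E [EE _]] := disc_algebra_restr (x n).
have Txz : T (x n) z = T0 E z.
  have [aE _] := Hinf_ball E.
  rewrite TT// TT0//; apply: (eq_Tg ag (@disc_algebra_analytic R (x n)) aE) => // w Dw.
  by rewrite EE.
rewrite Txz -fs_sub -linearB TT0//; have [aEf _] := Hinf_ball (E - f).
have u0 := inv_two_pow_gt0 R n.+1.
have cu : 0 <= c * (2 ^+ n.+1)^-1 by rewrite mulr_ge0// ltW.
apply: le_lt_trans (HG _ _ aEf cu _ z (lexx _)) _.
  move=> w wz; have Dw : disc w by rewrite discE (le_lt_trans wz).
  rewrite fs_sub EE// Hx; last exact: disc_closed_disc.
  have rw : modulus ((r n)%:C * w) <= modulus z.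
    rewrite modulusM modulus_real ger0_norm//.
    by have := modulus_ge0 w; have := r1 n; nra.
  apply: le_trans (HK _ _ fball _ _ _ z1 wz rw) _; rewrite ler_wpM2l//.
  have E1 (q : R) : q%:C * w - w = (q - 1)%:C * w by rewrite rmorphB /=; ring.
  rewrite E1 modulusM modulus_real; have -> : r n - 1 = - (2 ^+ n.+1)^-1 by rewrite /r; ring.
  by rewrite normrN gtr0_norm// ler_piMr ?(ltW u0)//; lra.
have := HN n.+1 (leqW Nn); rewrite ltr_pdivlMr; last by rewrite ltr_wpDl// mulr_ge0.
by move: (2 ^+ n.+1)^-1 u0 => u u0; rewrite mulrA; nra.
Qed.

(** [T0 x] and [T x] agree on the open disc, so the norm of the first is at most that of the second,
    and each functional on H^oo is dominated as required. *)
Lemma bounded_weakly_compact_Hinf : Tg_bounded g Hinf Hinf ->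
  Tg_bounded g Hinf disc_algebra -> Tg_weakly_compact g Hinf Hinf.
Proof.
move=> [T0 [TT0 bT0]] [T [TT bT]]; exists T0; split => //.
apply: (weakly_compact_through_disc_algebra ag TT bT bT0) => phi.
have [K K0 HK] := dual_bounded phi; exists K => // x.
apply: le_trans (HK _) _; rewrite ler_wpM2l//.
apply: (@snorm_le R Hinf); first exact: snorm_ge0.
move=> z Dz; rewrite TT0// -TT//.
by apply: (@snorm_ub R disc_algebra); exact: disc_closed_disc.
Qed.

(** T_g on [A] is [T] composed with the restriction [S] to the open disc. As [S] does not increase
    norms, the image of the unit ball lies in the relatively weakly compact image under [T]. *)
Lemma bounded_weakly_compact_disc_algebra : Tg_bounded g Hinf disc_algebra ->
  Tg_weakly_compact g disc_algebra disc_algebra.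
Proof.
move=> [T [TT bT]].
have wT : weakly_compact T.
  apply: (weakly_compact_through_disc_algebra ag TT bT bT) => phi.
  by have [K K0 HK] := dual_bounded phi; exists K => // x; exact: HK.
have [res Hres] := choice (@disc_algebra_restr R).
have [c f h|S SE] := @linear_exists R disc_algebra Hinf res.
  apply: Hinf_ext => z Dz; rewrite fs_lin.
  by have [-> // _] := Hres (c *: f + h); have [-> // _] := Hres f; have [-> // _] := Hres h.
have S1 f : snorm (S f) <= snorm f by rewrite SE; have [] := Hres f.
have [c f h|TS TSE] := @linear_exists R disc_algebra disc_algebra (fun f => T (S f)).
  by rewrite !linearP.
exists TS; split.
  move=> f z Dz; rewrite TSE TT//; have [aS _] := Hinf_ball (S f).
  apply: (eq_Tg ag aS (@disc_algebra_analytic R f)) => // w Dw.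
  by rewrite SE; have [->] := Hres f.
split.
  have /bounded_opP[M M0 TM] := bT; apply/bounded_opP; exists M => // f.
  by rewrite TSE; apply: le_trans (TM _) _; rewrite ler_wpM2l.
have [_] := wT; rewrite !precompactE => cT; apply: (subclosed_compact _ cT).
  exact: closed_closure.
apply: closure_subset => _ [f /= f1 <-]; exists (S f) => //=.
by move: f1; rewrite !normE -[X in _ <= X]/(1%:C) !lecR; exact: le_trans.
Qed.

End implications.

Theorem corollary1p5 (R : realType) (g : Cplx R -> Cplx R)
    (g_analytic : analytic disc g)
    (g_bounded : Tg_bounded g Hinf Hinf) :
  (Tg_weakly_compact g Hinf Hinf <-> Tg_bounded g Hinf disc_algebra) /\
  (Tg_bounded g Hinf disc_algebra <->
   Tg_weakly_compact g disc_algebra disc_algebra).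
Proof.
split; split.
- exact: weakly_compact_Hinf_bounded.
- exact: bounded_weakly_compact_Hinf.
- exact: bounded_weakly_compact_disc_algebra.
- exact: weakly_compact_disc_algebra_bounded.
Qed.
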